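(* Let $(p_n)_{n\ge 1}$ be positive integers with $p=p_n\le n$ and $p/n\to\gamma$ as $n\to\infty$ for some constant $\gamma\in(0,1)$. For each $n$ let $\mathbf A=\mathbf A_n\in\mathbb R^{n\times n}$ be a deterministic matrix of full rank, and let $\lambda_1(\mathbf A\mathbf A^\top)\ge\cdots\ge\lambda_n(\mathbf A\mathbf A^\top)$ be the ordered eigenvalues of $\mathbf A\mathbf A^\top$. Assume there is a constant $C\ge 1$ not depending on $n$ such that $C^{-1}\le\lambda_n(\mathbf A\mathbf A^\top)\le\lambda_1(\mathbf A\mathbf A^\top)\le C$ for all $n$, and that $$\lim_{n\to\infty}\sum_{k=1}^n\Big(\lambda_k(\mathbf A_n\mathbf A_n^\top)-\frac1n\sum_{j=1}^n\lambda_j(\mathbf A_n\mathbf A_n^\top)\Big)^2=0 .$$ For each $n$ let $\mathbf u_1,\dots,\mathbf u_p$ be independent random vectors uniformly distributed on the unit sphere $\mathbb S^{n-1}\subset\mathbb R^n$, and let $\mathbf Y=\mathbf Y_n=(\mathbf A\mathbf u_1,\dots,\mathbf A\mathbf u_p)^\top\in\mathbb R^{p\times n}$. Then, as $n\to\infty$, $$\frac{\log\det(\mathbf Y\mathbf Y^\top)-\mu_n}{\sigma_n}\ \longrightarrow\ N(0,1)\quad\text{in distribution},$$ where $$\mu_n=\log\operatorname{tr}(\mathbf A\mathbf A^\top)-p\log n-\frac{\sigma_n^2}{2}+\sum_{i=1}^{p-1}\log\Big(\sum_{k=1}^n\lambda_k(\mathbf A\mathbf A^\top)\,t_{i,k}(\mathbf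 A)\Big),$$ $$\sigma_n^2=-2\frac pn+2\sum_{i=1}^{p-1}\frac{\sum_{k=1}^n\lambda_k^2(\mathbf A\mathbf A^\top)\,t_{i,k}(\mathbf A)}{\big(\sum_{k=1}^n\lambda_k(\mathbf A\mathbf A^\top)\,t_{i,k}(\mathbf A)\big)^2}.$$
   Context: For $1\le i\le p-1$ and $1\le k\le n$, $$t_{i,k}(\mathbf A)=\mathbb E\left[\frac{1}{1+\lambda_k(\mathbf A\mathbf A^\top)\,\mathbf w_{ik}^\top\big(\sum_{\ell=1,\,\ell\ne k}^n\lambda_\ell(\mathbf A\mathbf A^\top)\,\mathbf w_{i\ell}\mathbf w_{i\ell}^\top\big)^{-1}\mathbf w_{ik}}\right],$$ where $\mathbf w_{i1},\dots,\mathbf w_{in}$ are i.i.d. $i$-dimensional random column vectors with independent standard normal components (the inverse exists almost surely since $i\le n-1$). $\sigma_n$ denotes the positive square root of $\sigma_n^2$, which is considered for all sufficiently large $n$. The dependence on $n$ of $p,\mathbf A,\mathbf u_i,\mathbf Y,t_{i,k}$ is suppressed. *)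

(* Defs.v *)
From HB Require Import structures.
From mathcomp Require Import all_boot all_order all_algebra.
From mathcomp Require Import perm.
From mathcomp Require Import all_classical all_reals all_analysis.
From mathcomp Require Import measurable_realfun.

Set Implicit Arguments.
Unset Strict Implicit.
Unset Printing Implicit Defensive.

Import Order.TTheory GRing.Theory Num.Theory.
Import numFieldNormedType.Exports.

Local Open Scope classical_set_scope.
Local Open Scope ring_scope.

(* A random vector of R^n is a random variable with values in n.-tuple R, whose
   sigma-algebra is generated by the coordinates, i.e. is the Borel one. *)
Definition vec (R : realType) n (x : n.-tuple R) : 'cV[R]_n :=
  \col_i tnth x i.

Definition unvec (R : realType) n (v : 'cV[R]_n) : n.-tuple R :=
  [tuple v i 0 | i < n].

Section product_law.
Context d (T : measurableType d) (R : realType).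

Definition cons_pair n (z : T * n.-tuple T) : n.+1.-tuple T :=
  [tuple of z.1 :: z.2].

Lemma measurable_cons_pair n :
  measurable_fun [set: T * n.-tuple T] (@cons_pair n).
Proof. exact: measurable_cons. Qed.

HB.instance Definition _ n := isMeasurableFun.Build _ _ _ _ (@cons_pair n)
  (@measurable_cons_pair n).

(* The law of (X_1, ..., X_n) for X_1, ..., X_n i.i.d. with law P. *)
Fixpoint iid_law (P : probability T R) n : probability (n.-tuple T) R :=
  match n return probability (n.-tuple T) R with
  | 0 => \d_([tuple] : 0.-tuple T)
  | n'.+1 => distribution (P \x iid_law P n')%E (@cons_pair n')
  end.

End product_law.

(* normal_prob lives on measurableTypeR R, which has the same measurable sets
   as R but a different display; idTR transports it to R. *)
Section std_normal.
Context (R : realType).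

Definition idTR : measurableTypeR R -> R := idfun.

HB.instance Definition _ := @isMeasurableFun.Build _ _ _ _ idTR
  (@measurable_id _ _ setT).

Definition std_normal : probability R R := distribution (normal_prob 0 1) idTR.

(* The law of a vector of R^i with independent standard normal components. *)
Definition std_gaussian i : probability (i.-tuple R) R := iid_law std_normal i.

End std_normal.

Definition mutually_independent d d' (T : measurableType d)
    (T' : measurableType d') (R : realType) (P : probability T R)
    (I : finType) (X : I -> {RV P >-> T'}) : Prop :=
  forall (J : {set I}) (B : I -> set T'), (forall i, measurable (B i)) ->
  P (\bigcap_(i in [set` J]) (X i @^-1` B i))
    = (\prod_(i in J) P (X i @^-1` B i))%E.

Definition unit_sphere (R : realType) n : set (n.-tuple R) :=
  [set x | \sum_(i < n) tnth x i ^+ 2 = 1].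

(* The uniform distribution on the unit sphere is the rotation invariant
   probability measure carried by it. *)
Definition uniform_on_sphere (R : realType) n
    (mu : probability (n.-tuple R) R) : Prop :=
  mu (@unit_sphere R n) = 1%E /\
  forall O : 'M[R]_n, O^T *m O = 1%:M ->
  forall B : set (n.-tuple R), measurable B ->
  mu [set x | B (unvec (O *m vec x))] = mu B.

Definition ordered_eigenvalues (R : realType) n (B : 'M[R]_n)
    (lam : 'I_n -> R) : Prop :=
  char_poly B = \prod_(k < n) ('X - (lam k)%:P) /\
  (forall k l : 'I_n, (k <= l)%N -> lam l <= lam k).

Section centering.
Context (R : realType) (n : nat) (lam : 'I_n -> R).

(* W is the n-tuple (w_{i1}, ..., w_{in}) of vectors of R^i. For i < n and
   lam > 0 the matrix leave_one_out k W is almost surely invertible, so the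
   default value of invmx on singular matrices does not affect t_ i k. *)
Definition leave_one_out i (k : 'I_n) (W : n.-tuple (i.-tuple R)) : 'M[R]_i :=
  \sum_(l < n | l != k)
    lam l *: (vec (tnth W l) *m (vec (tnth W l))^T).

Definition quad_form i (k : 'I_n) (W : n.-tuple (i.-tuple R)) : R :=
  ((vec (tnth W k))^T *m invmx (leave_one_out k W) *m vec (tnth W k)) 0 0.

Definition t_ i (k : 'I_n) : R :=
  fine 'E_(iid_law (std_gaussian R i) n)
         [fun W => (1 + lam k * quad_form k W)^-1].

Definition sigma2 (p : nat) : R :=
  - 2 * (p%:R / n%:R) +
  2 * \sum_(1 <= i < p)
        ((\sum_(k < n) lam k ^+ 2 * t_ i k) /
         (\sum_(k < n) lam k * t_ i k) ^+ 2).

(* Num.sqrt is 0 on negative numbers: sigma is the intended square root only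
   when 0 <= sigma2 p, which holds for large n in the asymptotic regime. *)
Definition sigma (p : nat) : R := Num.sqrt (sigma2 p).

Definition mu (A : 'M[R]_n) (p : nat) : R :=
  ln (\tr (A *m A^T)) - p%:R * ln n%:R - sigma2 p / 2 +
  \sum_(1 <= i < p) ln (\sum_(k < n) lam k * t_ i k).

End centering.

Section logdet.
Context d (T : measurableType d) (R : realType) (P : probability T R).
Context (n p : nat) (A : 'M[R]_n) (u : 'I_p -> {RV P >-> n.-tuple R}).

Definition Ymx (w : T) : 'M[R]_(p, n) :=
  \matrix_(i < p) (A *m vec (u i w))^T.

Definition logdet (w : T) : R := ln (\det (Ymx w *m (Ymx w)^T)).

Lemma measurable_logdet : measurable_fun [set: T] logdet.
Proof.
apply: measurableT_comp => //; rewrite /determinant.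
apply: measurable_sum => s; apply: measurable_funM => //.
apply: measurable_prod => i _.
rewrite (_ : (fun _ => _) = (fun w =>
    \sum_j (\sum_k A j k * tnth (u i w) k) *
           (\sum_k A j k * tnth (u (s i) w) k))); last first.
  apply/funext => w; rewrite !mxE; apply: eq_bigr => j _.
  by rewrite !mxE; congr (_ * _); apply: eq_bigr => k _; rewrite !mxE.
have mu_ i' k : measurable_fun [set: T] (fun w => tnth (u i' w) k).
  by apply: (measurableT_comp (measurable_tnth k)) => //.
apply: measurable_sum => j; apply: measurable_funM;
  by apply: measurable_sum => k; apply: measurable_funM.
Qed.

HB.instance Definition _ := isMeasurableFun.Build _ _ _ _ logdet
  measurable_logdet.

Definition standardized_logdet (m s : R) (w : T) : R := (logdet w - m) / s.

Lemma measurable_standardized_logdet (m s : R) :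
  measurable_fun [set: T] (standardized_logdet m s).
Proof.
by apply: measurable_funM => //; apply: measurable_funB.
Qed.

HB.instance Definition _ m s := isMeasurableFun.Build _ _ _ _
  (standardized_logdet m s) (measurable_standardized_logdet m s).

End logdet.

Definition cvg_in_distribution (R : realType) (d : nat -> measure_display)
    (T : forall n, measurableType (d n)) (P : forall n, probability (T n) R)
    (X : forall n, {RV P n >-> R})
    (nu : probability R R) : Prop :=
  forall x : R, {for x, continuous (fun y : R => fine (nu `]-oo, y]%classic))} ->
  cdf (X n) x @[n --> \oo] --> nu `]-oo, x]%classic.

Arguments mutually_independent {d d' T T' R} P {I} X.
Arguments cvg_in_distribution {R d T} P X nu.

(* Main.v *)
(* Replacing A^T A by its spectral decomposition and using rotation invariance,
   Y Y^T becomes U diag(lam) U^T, where the rows of U are independent and uniform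
   on the sphere.  Write lam_k = m (1 + c_k) with m the mean eigenvalue.  Then
   log det (Y Y^T) = p log m + log det (U U^T) + sum_k c_k P_kk + O(sum_k c_k^2),
   P being the orthogonal projection onto the row space of U; by exchangeability
   the variance of the linear term is at most sum_k c_k^2, which tends to 0.

   The determinant det (U U^T) is the product of the squared distances of each
   row to the span of the preceding ones.  By rotation invariance these are
   independent, the j-th one having the law of the sum of n - j squared
   coordinates of a uniform unit vector.  Expanding the logarithm to second order
   leaves a sum of independent centred variables, to which Stein's method
   applies.

   The weights satisfy sum_k t_{i,k} = n - i exactly, and they are Lipschitz in
   lam_k because exchanging two of the Gaussian vectors only causes a rank-one
   perturbation.  Hence sum_k lam_k t_{i,k} = m (n - i) + O(sum_k (lam_k - m)^2),
   which identifies mu_n and sigma_n^2 with the centre and the variance of the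
   expansion. *)
Require Import Defs.
From HB Require Import structures.
From mathcomp Require Import all_boot all_order all_algebra.
From mathcomp Require Import all_classical all_reals all_analysis.
From mathcomp Require Import measurable_realfun perm ring lra zify.

Set Implicit Arguments.
Unset Strict Implicit.
Unset Printing Implicit Defensive.

Import Order.TTheory GRing.Theory Num.Theory.
Import numFieldNormedType.Exports.

Local Open Scope classical_set_scope.
Local Open Scope ring_scope.

(** * Bounded random variables *)

(** Two obstacles shape the proof. Logarithms of determinants are unbounded below, and the vectors
    lie on the sphere only almost surely. Hence everything that is integrated is bounded at every
    point: the vectors are modified on a null set, degenerate matrices get harmless values, and
    logarithms are only estimated pointwise, outside an event of small probability, by a bounded
    error. Moreover the probability spaces change with [n], so limits come last: one bound on the
    distribution function holds with constants independent of [n], and only its smallness conditions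
    are checked asymptotically.

    The moments on the sphere are found without a density. Under a rotation mixing two coordinates,
    the mean of a power of the tail sum is a polynomial in the squared sine of the angle; it is
    constant, and its linear coefficient gives an equation for the moment.

    In the centre, up to [n] logarithms each have relative error of order the sum of squared
    deviations over [n]. An error of first order in the deviations would not be summable; comparing
    the weights in pairs is what makes it quadratic. *)

Section tuple_rectangles.
Context d (T : measurableType d) (R : realType).

Definition rectangle n (B : 'I_n -> set T) : set (n.-tuple T) :=
  [set x | forall i, B i (tnth x i)].

Lemma rectangleE n (B : 'I_n -> set T) :
  rectangle B = \bigcap_(i in [set: 'I_n]) (@tnth n T)^~ i @^-1` B i.
Proof. by apply/seteqP; split => x Bx i; [move=> _|]; exact: Bx. Qed.

Lemma measurable_rectangle n (B : 'I_n -> set T) :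
  (forall i, measurable (B i)) -> measurable (rectangle B).
Proof.
move=> mB; rewrite rectangleE; apply: fin_bigcap_measurable => // i _.
by rewrite -[_ @^-1` _]setTI; apply: measurable_tnth.
Qed.

(** Rectangles are stable under intersection and include the one-coordinate cylinders that generate
    the sigma-algebra, so they determine a finite measure. *)
Lemma tuple_measure_ext n (m1 m2 : {measure set (n.-tuple T) -> \bar R}) :
  (m1 setT < +oo)%E ->
  (forall B : 'I_n -> set T, (forall i, measurable (B i)) ->
     m1 (rectangle B) = m2 (rectangle B)) ->
  forall A, measurable A -> m1 A = m2 A.
Proof.
move=> m1y m12 A mA.
pose G := [set X | exists2 B : 'I_n -> set T,
  (forall i, measurable (B i)) & X = rectangle B].
apply: (measure_unique G (fun=> setT)) => //.
- apply/seteqP; split.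
  + apply: smallest_sub; first exact: smallest_sigma_algebra.
    move=> X; rewrite -bigcup_seq => -[i _ [B mB <-{X}]].
    apply: sub_sigma_algebra.
    exists (fun j => if j == i then B else setT).
      by move=> j; case: ifP.
    apply/seteqP; split => x /=.
      by move=> [_ Bx] j; case: eqP => // ->.
    by move=> /(_ i); rewrite eqxx.
  + apply: smallest_sub; first exact: sigma_algebra_measurable.
    by move=> X [B mB ->]; exact: measurable_rectangle.
- move=> X Y [B mB ->] [B' mB' ->]; exists (fun i => B i `&` B' i).
    by move=> i; exact: measurableI.
  apply/seteqP; split => x; first by move=> [Bx B'x] i; split.
  by move=> BB; split=> i; have [] := BB i.
- by move=> _; exists (fun=> setT) => //; apply/seteqP; split.
- by apply/seteqP; split => // x _; exists 0%N.
- by move=> X [B mB ->]; exact: m12.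
Qed.

End tuple_rectangles.

Section bounded_rv.
Context d (T : measurableType d) (R : realType).
Implicit Types f g : T -> R.

(** The bound holds at every point, not almost everywhere: the class is closed under the operations
    below, and linearity and monotonicity of the expectation then carry no integrability
    condition. *)
Definition bounded_rv f :=
  measurable_fun setT f /\ exists K : R, forall x, `|f x| <= K.

Lemma brv_meas f : bounded_rv f -> measurable_fun setT f. Proof. by case. Qed.

Lemma eq_brv f g : f =1 g -> bounded_rv g -> bounded_rv f.
Proof. by move=> /funext ->. Qed.

Lemma brv_cst (c : R) : bounded_rv (fun=> c).
Proof. by split=> //; exists `|c|. Qed.

Lemma brvD f g : bounded_rv f -> bounded_rv g -> bounded_rv (fun x => f x + g x).
Proof.
move=> [mf [K fK]] [mg [L gL]]; split; first exact: measurable_funD.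
by exists (K + L) => x; apply: le_trans (ler_normD _ _) _; exact: lerD.
Qed.

Lemma brvN f : bounded_rv f -> bounded_rv (fun x => - f x).
Proof.
move=> [mf [K fK]]; split; first exact: measurableT_comp.
by exists K => x; rewrite normrN.
Qed.

Lemma brvB f g : bounded_rv f -> bounded_rv g -> bounded_rv (fun x => f x - g x).
Proof. by move=> bf bg; apply: brvD => //; exact: brvN. Qed.

Lemma brvM f g : bounded_rv f -> bounded_rv g -> bounded_rv (fun x => f x * g x).
Proof.
move=> [mf [K fK]] [mg [L gL]]; split; first exact: measurable_funM.
by exists (K * L) => x; rewrite normrM ler_pM.
Qed.

Lemma brvZ (c : R) f : bounded_rv f -> bounded_rv (fun x => c * f x).
Proof. by move=> bf; apply: brvM => //; exact: brv_cst. Qed.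

Lemma brvX f k : bounded_rv f -> bounded_rv (fun x => f x ^+ k).
Proof.
move=> bf; elim: k => [|k IH]; first exact: eq_brv (brv_cst 1).
by apply: eq_brv (brvM bf IH) => x; rewrite exprS.
Qed.

Lemma brv_norm f : bounded_rv f -> bounded_rv (fun x => `|f x|).
Proof.
move=> [mf [K fK]]; split; first exact: measurableT_comp.
by exists K => x; rewrite normr_id.
Qed.

Lemma brv_sum (I : Type) (s : seq I) (Q : pred I) (F : I -> T -> R) :
  (forall i, bounded_rv (F i)) -> bounded_rv (fun x => \sum_(i <- s | Q i) F i x).
Proof.
move=> bF; elim: s => [|i s IH].
  by apply: eq_brv (brv_cst 0) => x; rewrite big_nil.
have [Qi|Qi] := boolP (Q i).
  by apply: eq_brv (brvD (bF i) IH) => x; rewrite big_cons Qi.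
by apply: eq_brv IH => x; rewrite big_cons (negbTE Qi).
Qed.

Lemma brv_comp (g : R -> R) f :
  measurable_fun setT g -> (exists K, forall x, `|g x| <= K) ->
  measurable_fun setT f -> bounded_rv (fun x => g (f x)).
Proof.
by move=> mg [K gK] mf; split; [exact: measurableT_comp|exists K].
Qed.

Lemma brv_indic (A : set T) : measurable A -> bounded_rv (\1_A : T -> R).
Proof.
move=> mA; split; first exact: measurable_indic.
by exists 1 => x; rewrite indicE; case: (_ \in _); rewrite ?normr1 ?normr0.
Qed.

End bounded_rv.

Section expectation_bounded.
Context d (T : measurableType d) (R : realType) (P : probability T R).
Implicit Types f g : T -> R.

Definition Ex f : R := \int[P]_x f x.

Lemma brv_integrable f : bounded_rv f -> P.-integrable setT (EFin \o f).
Proof.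
move=> [mf [K fK]]; apply: measurable_bounded_integrable => //.
  exact: le_lt_trans (probability_le1 _ _) (ltry _).
by exists K; split; [exact: num_real|move=> M KM x _ /=; apply: le_trans (ltW KM)].
Qed.

Lemma Ex_EFin f : bounded_rv f -> (\int[P]_x (f x)%:E)%E = (Ex f)%:E.
Proof. by move=> /brv_integrable bf; rewrite fineK //; exact: integrable_fin_num. Qed.

Lemma eq_Ex f g : f =1 g -> Ex f = Ex g.
Proof. by move=> fg; apply: eq_Rintegral => x _. Qed.

Lemma Ex_cst c : Ex (fun=> c) = c.
Proof. 
rewrite /Ex Rintegral_cst //.
have P1 : P setT = 1%E := probability_setT P.
by move: P1 => /= ->; rewrite mulr1.
 Qed.

Lemma ExD f g : bounded_rv f -> bounded_rv g ->
  Ex (fun x => f x + g x) = Ex f + Ex g.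
Proof. by move=> /brv_integrable bf /brv_integrable bg; exact: RintegralD. Qed.

Lemma ExB f g : bounded_rv f -> bounded_rv g ->
  Ex (fun x => f x - g x) = Ex f - Ex g.
Proof. by move=> /brv_integrable bf /brv_integrable bg; exact: RintegralB. Qed.

Lemma ExZ c f : bounded_rv f -> Ex (fun x => c * f x) = c * Ex f.
Proof. by move=> /brv_integrable bf; exact: RintegralZl. Qed.

Lemma Ex_sum (I : Type) (s : seq I) (Q : pred I) (F : I -> T -> R) :
  (forall i, bounded_rv (F i)) ->
  Ex (fun x => \sum_(i <- s | Q i) F i x) = \sum_(i <- s | Q i) Ex (F i).
Proof.
move=> bF; elim: s => [|i s IH].
  by rewrite big_nil -[RHS](Ex_cst 0); apply: eq_Ex => x; rewrite big_nil.
rewrite big_cons -IH; case: ifP => Qi.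
  by rewrite -ExD //; [apply: eq_Ex => x; rewrite big_cons Qi|exact: brv_sum].
by apply: eq_Ex => x; rewrite big_cons Qi.
Qed.

Lemma Ex_le f g : bounded_rv f -> bounded_rv g -> (forall x, f x <= g x) ->
  Ex f <= Ex g.
Proof.
by move=> /brv_integrable bf /brv_integrable bg fg; exact: le_Rintegral.
Qed.

Lemma Ex_ge0 f : (forall x, 0 <= f x) -> 0 <= Ex f.
Proof. by move=> f0; exact: Rintegral_ge0. Qed.

Lemma Ex_norm f : bounded_rv f -> `|Ex f| <= Ex (fun x => `|f x|).
Proof. by move=> /brv_integrable bf; exact: le_normr_Rintegral. Qed.

(** Serves identities between Gaussian weights that may fail on degenerate samples. *)
Lemma Ex_ae_eq f g : bounded_rv f -> bounded_rv g -> (exists N, [/\ measurable N,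
  P N = 0%E & forall x, ~ N x -> f x = g x]) -> Ex f = Ex g.
Proof.
move=> [mf _] [mg _] [N [mN PN fg]]; congr fine; apply: ae_eq_integral => //.
- exact/measurable_EFinP.
- exact/measurable_EFinP.
- exists N; split=> // x /= nfg; apply: contrapT => Nx; apply: nfg => _.
  by rewrite fg.
Qed.

Definition Pr (A : set T) : R := fine (P A).

Lemma PrE A : measurable A -> P A = (Pr A)%:E.
Proof. by move=> mA; rewrite /Pr fineK // fin_num_measure. Qed.

Lemma Ex_indic A : measurable A -> Ex (\1_A) = Pr A.
Proof. by move=> mA; rewrite /Ex /Pr /Rintegral integral_indic // setIT. Qed.

Lemma PrU_le A B : measurable A -> measurable B -> Pr (A `|` B) <= Pr A + Pr B.
Proof.
move=> mA mB; rewrite -lee_fin EFinD -!PrE //; last exact: measurableU.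
exact: measureU2.
Qed.

Lemma markov_Ex f c : bounded_rv f -> (forall x, 0 <= f x) -> 0 < c ->
  Pr [set x | c <= f x] <= Ex f / c.
Proof.
move=> bf f0 c0.
have mA : measurable [set x | c <= f x].
  by rewrite -[X in measurable X]setTI; apply: measurable_fun_le => //; case: bf.
rewrite ler_pdivlMr // mulrC -Ex_indic // -ExZ //; last exact: brv_indic.
apply: Ex_le => //; first by apply: brvZ; exact: brv_indic.
move=> x; rewrite indicE; have [|_] := boolP (x \in _); last by rewrite mulr0.
by rewrite inE mulr1.
Qed.

End expectation_bounded.

(** * Independence *)

Lemma mfun_of d d' (T : measurableType d) (T' : measurableType d')
  (X : T -> T') : measurable_fun setT X ->
  exists X' : {mfun T >-> T'}, X' = X :> (T -> T').
Proof. by move=> /mem_set mX; exists (mfun_Sub mX). Qed.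

Section independence.
Context d (T : measurableType d) (R : realType) (P : probability T R).

Definition indep d1 d2 (E1 : measurableType d1) (E2 : measurableType d2)
    (X : T -> E1) (Y : T -> E2) :=
  forall A B, measurable A -> measurable B ->
    P ((X @^-1` A) `&` (Y @^-1` B)) = (P (X @^-1` A) * P (Y @^-1` B))%E.

Context d1 d2 d3 d4 (E1 : measurableType d1) (E2 : measurableType d2)
  (E3 : measurableType d3) (E4 : measurableType d4).

Lemma indep_comp (X : T -> E1) (Y : T -> E2) (f : E1 -> E3) (g : E2 -> E4) :
  measurable_fun setT f -> measurable_fun setT g ->
  indep X Y -> indep (fun x => f (X x)) (fun x => g (Y x)).
Proof.
move=> mf mg XY A B mA mB.
have mfA : measurable (f @^-1` A) by rewrite -[_ @^-1` _]setTI; exact: mf.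
have mgB : measurable (g @^-1` B) by rewrite -[_ @^-1` _]setTI; exact: mg.
exact: (XY _ _ mfA mgB).
Qed.

Lemma indep_prod (X : {mfun T >-> E1}) (Y : {mfun T >-> E2}) : indep X Y ->
  forall C, measurable C ->
  (distribution P X \x distribution P Y)%E C = P ((fun x => (X x, Y x)) @^-1` C).
Proof.
move=> XY C mC.
have mXY : measurable_fun setT (fun x => (X x, Y x)).
  by apply/measurable_fun_pairP; split.
have [Z ZE] := mfun_of mXY.
rewrite -ZE; apply: (@product_measure_unique _ _ _ _ _ (distribution P X)
  (distribution P Y) (distribution P Z)) => // A B mA mB.
transitivity (P (Z @^-1` (A `*` B))); first by [].
by rewrite ZE; exact: (XY A B mA mB).
Qed.

(** Fubini over the law of [X]: whatever the value of [X], the section of [C] has probability [c].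
    An event built from both variables can thus be independent of [X], as happens for a distance
    computed from the past. *)
Lemma indep_const_section (X : {mfun T >-> E1}) (Y : {mfun T >-> E2})
    (C : set (E1 * E2)) (c : \bar R) : indep X Y -> measurable C ->
  (forall e, P (Y @^-1` [set y | C (e, y)]) = c) ->
  forall B, measurable B ->
  P ((X @^-1` B) `&` [set x | C (X x, Y x)]) = (P (X @^-1` B) * c)%E.
Proof.
move=> XY mC Cc B mB.
have mBC : measurable ((B `*` setT) `&` C) by apply: measurableI => //; exact: measurableX.
transitivity ((distribution P X \x distribution P Y)%E ((B `*` setT) `&` C)).
  rewrite indep_prod //; congr (P _); apply/seteqP; split => x /=.
    by move=> [].
  by move=> [[]].
have c0 : (0 <= c)%E by rewrite -(Cc (X point)).
rewrite /product_measure1 (eq_integral (fun e => (c * (\1_B e)%:E)%E)); last first.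
  move=> e _ /=; rewrite indicE; have [eB|eB] := boolP (e \in B).
    rewrite mule1 -(Cc e) /distribution /pushforward; congr (P _).
    apply/seteqP; split => x /=; rewrite /xsection /= inE.
      by move=> [].
    by move=> Cx; split=> //; split => //; move: eB; rewrite inE.
  rewrite mule0; have -> : xsection ((B `*` setT) `&` C) e = set0; last exact: measure0.
  apply/seteqP; split => // y; rewrite /xsection /= inE => -[[]].
  by move=> /= Be; move: eB; rewrite notin_setE.
rewrite ge0_integralZl //; last exact/measurable_EFinP/measurable_indic.
by rewrite integral_indic // setIT muleC.
Qed.

Lemma prod_measure_ext (m1 m2 : {measure set (E1 * E2)%type -> \bar R}) :
  (m1 setT < +oo)%E ->
  (forall A B, measurable A -> measurable B -> m1 (A `*` B) = m2 (A `*` B)) ->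
  forall C, measurable C -> m1 C = m2 C.
Proof.
move=> m1y m12 C mC.
pose G := [set X | exists A, exists B, [/\ measurable A, measurable B &
  X = (A `*` B : set (E1 * E2))]].
apply: (measure_unique G (fun=> setT)) => //.
- rewrite measurable_prod_measurableType; congr (<<s _ >>).
  apply/seteqP; split => X /=.
    by move=> [A mA [B mB <-]]; exists A, B.
  by move=> [A [B [mA mB ->]]]; exists A => //; exists B.
- move=> _ _ [A [B [mA mB ->]]] [A' [B' [mA' mB' ->]]].
  exists (A `&` A'), (B `&` B'); split; [exact: measurableI..|by rewrite setXI].
- by move=> _; exists setT, setT; split => //; rewrite setXTT.
- by apply/seteqP; split => // x _; exists 0%N.
- by move=> X [A [B [mA mB ->]]]; exact: m12.
Qed.

End independence.

Section independence_assoc.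
Context d (T : measurableType d) (R : realType) (P : probability T R).
Context d1 d2 d3 (E1 : measurableType d1) (E2 : measurableType d2)
  (E3 : measurableType d3).

Lemma indepA (X : {mfun T >-> E1}) (Y : {mfun T >-> E2}) (Z : {mfun T >-> E3}) :
  indep P X Y -> indep P (fun x => (X x, Y x)) Z ->
  indep P X (fun x => (Y x, Z x)).
Proof.
move=> XY XYZ A C mA mC.
have mYZ : measurable_fun setT (fun x => (Y x, Z x)).
  by apply/measurable_fun_pairP; split.
have YZ : indep P Y Z.
  apply: (@indep_comp _ _ _ _ _ _ _ _ _ _ _ _ _ _ snd id) XYZ => //.
have XYZ1 B D : measurable B -> measurable D ->
    P ((X @^-1` A) `&` (Y @^-1` B) `&` (Z @^-1` D)) =
    (P (X @^-1` A) * P ((Y @^-1` B) `&` (Z @^-1` D)))%E.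
  move=> mB mD; rewrite YZ // muleA -XY //.
  by rewrite -(XYZ (A `*` B) D) //; exact: measurableX.
have mXA : measurable (X @^-1` A) by rewrite -[_ @^-1` _]setTI; exact: measurable_funPT.
have PX_fin : P (X @^-1` A) \is a fin_num.
  by rewrite fin_num_measure // -[_ @^-1` _]setTI; exact: measurable_funPT.
have [W WE] := mfun_of mYZ.
have r0 : 0 <= fine (P (X @^-1` A)) by rewrite fine_ge0.
(* With [A] fixed, both sides are finite measures in [C]: the law of [(Y, Z)] restricted to the
   event that [X] is in [A], and the law of [(Y, Z)] scaled by the probability of that event.
   Products of sets decide their equality. *)
transitivity (pushforward (mrestr P mXA) W C); first by rewrite /pushforward WE setIC.
transitivity (mscale (NngNum r0) (distribution P W) C); last first.
  by rewrite /mscale /= fineK // /distribution /pushforward WE.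
apply: prod_measure_ext => //.
  apply: (@le_lt_trans _ _ (1%:E)); last exact: ltry.
  have := probability_le1 P mXA; congr (_ <= _)%E.
  by rewrite /= /pushforward /mrestr preimage_setT setTI.
move=> B D mB mD.
transitivity (P (((fun x => (Y x, Z x)) @^-1` (B `*` D)) `&` (X @^-1` A))).
  by rewrite -WE.
transitivity ((NngNum r0)%:num%:E * P (W @^-1` (B `*` D)))%E; last by [].
rewrite /= fineK // WE setIC.
by have := XYZ1 B D mB mD; rewrite -setIA.
Qed.

Lemma indepC (X : T -> E1) (Y : T -> E2) : indep P X Y -> indep P Y X.
Proof. by move=> XY A B mA mB; rewrite setIC XY // muleC. Qed.

End independence_assoc.

Section independence_real.
Context d (T : measurableType d) (R : realType) (P : probability T R).

Lemma Ex_comp d1 (E1 : measurableType d1) (X : {mfun T >-> E1}) (g : E1 -> R) :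
  measurable_fun setT g -> bounded_rv (fun x => g (X x)) ->
  Ex P (fun x => g (X x)) = Ex (distribution P X) g.
Proof.
move=> mg bg; rewrite /Ex /Rintegral integral_distribution //.
- exact/measurable_EFinP.
- exact: brv_integrable.
Qed.

Lemma indep_Ex_mul (X Y : T -> R) : bounded_rv X -> bounded_rv Y ->
  indep P X Y -> Ex P (fun x => X x * Y x) = Ex P X * Ex P Y.
Proof.
move=> bX bY XY.
have [X' X'E] := mfun_of (brv_meas bX); have [Y' Y'E] := mfun_of (brv_meas bY).
move: bX bY XY; rewrite -X'E -Y'E => bX bY XY.
have [K XK] := bX.2; have [L YL] := bY.2.
have K0 : 0 <= K by apply: le_trans (XK point).
have L0 : 0 <= L by apply: le_trans (YL point).
(* The product is unbounded on [R * R]; clamping each factor at its bound changes nothing along [X']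
   and [Y'] and makes Fubini applicable. *)
pose cl (M x : R) := Num.max (- M) (Num.min M x).
have clE M x : `|x| <= M -> cl M x = x.
  by rewrite ler_norml => /andP[? ?]; rewrite /cl min_r // max_r.
have clM M x : 0 <= M -> `|cl M x| <= M.
  move=> M0; rewrite ler_norml /cl le_max lexx /= ge_max ge_min lexx /=.
  by rewrite andbT (le_trans _ M0) // oppr_le0.
have mcl M : measurable_fun setT (cl M).
  by apply: measurable_maxr => //; exact: measurable_minr.
have mXY : measurable_fun setT (fun x => (X' x, Y' x)).
  by apply/measurable_fun_pairP; split.
have [Z ZE] := mfun_of mXY.
pose g (z : R * R) := cl K z.1 * cl L z.2.
have mg : measurable_fun setT g.
  by apply: measurable_funM; apply: measurableT_comp.
have gKL z : `|g z| <= K * L by rewrite normrM ler_pM // clM.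
transitivity (Ex P (fun x => g (Z x))).
  by apply: eq_Ex => x; rewrite ZE /g /= !clE.
rewrite Ex_comp //; last first.
  by split; [exact: measurableT_comp|exists (K * L)].
transitivity (Ex (distribution P X' \x distribution P Y')%E g).
  congr fine; apply: eq_measure_integral => A mA _.
  rewrite [RHS](@indep_prod _ _ _ P _ _ _ _ X' Y') //.
  by rewrite -ZE.
have bg d1 (T1 : measurableType d1) (h : T1 -> R * R) : measurable_fun setT h ->
    bounded_rv (fun z => g (h z)).
  by move=> mh; split; [exact: measurableT_comp|exists (K * L)].
have bcl M : 0 <= M -> bounded_rv (cl M).
  by move=> M0; split => //; exists M => x; exact: clM.
have EX : Ex (distribution P X') (cl K) = Ex P X'.
  rewrite -Ex_comp //; first by apply: eq_Ex => x; exact: clE.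
  by split; [exact: measurableT_comp|exists K => x; exact: clM].
have EY : Ex (distribution P Y') (cl L) = Ex P Y'.
  rewrite -Ex_comp //; first by apply: eq_Ex => x; exact: clE.
  by split; [exact: measurableT_comp|exists L => x; exact: clM].
rewrite -EX -EY mulrC -ExZ; last exact: bcl.
rewrite /Ex /Rintegral -integral12_prod_meas1; last first.
  have bgid : bounded_rv g by exact: (bg _ _ id).
  exact: (@brv_integrable _ _ R (distribution P X' \x distribution P Y')%E g).
congr fine; apply: eq_integral => x _.
transitivity (Ex (distribution P Y') (fun y => cl K x * cl L y))%:E.
  rewrite -Ex_EFin //.
  by apply: brvZ; exact: bcl.
by rewrite ExZ 1?mulrC //; exact: bcl.
Qed.

End independence_real.

(** * The normal distribution function *)

Section calculus.
Context (R : realType).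
Implicit Types (f g df : R -> R) (x y a b K : R).

Lemma is_derive_continuous f x (a : R) : is_derive x 1 f a -> {for x, continuous f}.
Proof. by move=> [dfx _]; exact/differentiable_continuous/derivable1_diffP. Qed.

Lemma deriv_mono f df (a b : R) : a <= b ->
  (forall x, a <= x <= b -> is_derive x 1 f (df x)) ->
  (forall x, a <= x <= b -> 0 <= df x) -> f a <= f b.
Proof.
move=> ab fdf df0.
have [||c cab E] := @MVT_segment R f df a b ab.
- by move=> x; rewrite in_itv /= => /andP[ax xb]; apply: fdf; rewrite !ltW.
- apply: continuous_in_subspaceT => x; rewrite inE /= in_itv /= => xab.
  exact: is_derive_continuous (fdf x xab).
- by rewrite -subr_ge0 E mulr_ge0 ?subr_ge0 // df0 // -in_itv.
Qed.

Lemma deriv_mvt f df : (forall x, is_derive x 1 f (df x)) ->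
  forall x y, exists2 z, (Num.min x y <= z <= Num.max x y) & f y - f x = df z * (y - x).
Proof.
move=> fdf.
have cf A : {within A, continuous f}.
  by apply: continuous_subspaceT => x; exact: is_derive_continuous (fdf x).
suff H x y : x <= y -> exists2 z, x <= z <= y & f y - f x = df z * (y - x).
  move=> x y; have [xy|/ltW yx] := leP x y; first exact: H.
  have [z zxy E] := H _ _ yx; exists z => //.
  by rewrite -opprB E -mulrN opprB.
move=> xy; have [z zxy E] := @MVT_segment R f df x y xy (fun z _ => fdf z) (cf _).
by exists z => //; move: zxy; rewrite in_itv.
Qed.

Lemma deriv_lipschitz f df K : (forall x, is_derive x 1 f (df x)) ->
  (forall x, `|df x| <= K) -> forall x y, `|f x - f y| <= K * `|x - y|.
Proof.
move=> fdf dfK x y; have [z _ ->] := deriv_mvt fdf y x.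
by rewrite normrM ler_wpM2r.
Qed.

Lemma taylor1_lipschitz f df K : (forall x, is_derive x 1 f (df x)) ->
  (forall x y, `|df x - df y| <= K * `|x - y|) ->
  forall x e, `|f (x + e) - f x - e * df x| <= K * e ^+ 2.
Proof.
move=> fdf dfK x e; have [z zxy ->] := deriv_mvt fdf x (x + e).
have -> : df z * (x + e - x) - e * df x = (df z - df x) * e by ring.
rewrite normrM -(real_normK (num_real e)) expr2 mulrA ler_wpM2r //.
have K0 : 0 <= K.
  by have := dfK 1 0; rewrite subr0 normr1 mulr1; apply: le_trans.
apply: le_trans (dfK _ _) _; rewrite ler_wpM2l //.
move: zxy; have [e0|e0] := leP 0 e.
  rewrite min_l ?max_r ?lerDl // => /andP[xz zx].
  by rewrite !ger0_norm ?subr_ge0 // lerBlDl.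
rewrite min_r ?max_l ?gerDl ?(ltW e0) // => /andP[xz zx].
have zx0 : z - x <= 0 by rewrite subr_le0.
by rewrite (ler0_norm zx0) (ltr0_norm e0); lra.
Qed.

Lemma continuous_bounded_segment f (a b : R) : continuous f ->
  exists K, forall x, a <= x <= b -> `|f x| <= K.
Proof.
move=> cf; have [ab|ba] := leP a b; last first.
  by exists 0 => x /andP[ax xb]; move: ba; rewrite ltNge (le_trans ax xb).
have cfn : {within `[a, b], continuous (fun x => `|f x|)}.
  apply: continuous_subspaceT => x; apply: cvg_norm; exact: cf.
have [c _ fc] := EVT_max ab cfn.
by exists `|f c| => x xab; apply: fc; rewrite in_itv.
Qed.

End calculus.

Section gaussian_density.
Context (R : realType).
Notation leb := (@lebesgue_measure R).

Implicit Types (x y : R).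

Definition phi : R -> R := normal_pdf 0 1.

Lemma phiE x : phi x = normal_peak 1 * expR (- (x ^+ 2 / 2)).
Proof.
rewrite /phi normal_pdfE ?oner_neq0 // /normal_fun subr0 expr1n mulNr.
by rewrite -mulr_natr mul1r.
Qed.

Lemma phi_gt0 x : 0 < phi x.
Proof. by rewrite phiE mulr_gt0 ?expR_gt0 // normal_peak_gt0 // oner_neq0. Qed.

Lemma is_derive_phi x : is_derive x 1 phi (- x * phi x).
Proof.
have phif : phi = normal_peak 1 *: (expR \o (fun x : R => - (x ^+ 2 / 2))).
  by apply/funext => y /=; rewrite phiE.
rewrite [X in is_derive _ _ X _]phif phiE.
have d2 : is_derive x 1 (fun x : R => - (x ^+ 2 / 2)) (- x).
  have -> : (fun x : R => - (x ^+ 2 / 2)) = (- 2^-1) *: ((fun x : R => x) * (fun x : R => x)).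
    by apply/funext => y /=; rewrite -[RHS]/(- 2^-1 * (y * y)); field.
  by apply: is_derive_eq; rewrite /GRing.scale /=; field.
apply: is_derive_eq.
rewrite /GRing.scale /=. ring.
Qed.

Lemma continuous_phi : continuous phi.
Proof. by move=> x; exact: is_derive_continuous (is_derive_phi x). Qed.

Lemma measurable_phi : measurable_fun setT phi.
Proof. exact: measurable_normal_pdf. Qed.

Lemma integrable_phi (g : R -> R) (D : set R) : measurable D ->
  bounded_rv g -> leb.-integrable D (EFin \o (fun t => g t * phi t)).
Proof.
move=> mD [mg [K gK]]; apply: (@integrableS _ _ _ _ setT) => //.
have iK : leb.-integrable setT (EFin \o (fun t => K * phi t)).
  exact: (integrableZl measurableT K (integrable_normal_pdf 0 1)).
apply: le_integrable iK => //.
- by apply/measurable_EFinP/measurable_funM => //; exact: measurable_phi.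
- move=> t _ /=; rewrite lee_fin !normrM.
  by rewrite ler_wpM2r // (le_trans (gK t)) // ler_norm.
Qed.

Definition phi_int (g : R -> R) (x : R) : R :=
  \int[leb]_(t in `]-oo, x]) (g t * phi t).

Lemma is_derive_phi_int (g : R -> R) x : bounded_rv g -> continuous g ->
  is_derive x 1 (phi_int g) (g x * phi x).
Proof.
move=> bg cg; have [||||dF FE] := @continuous_FTC1 R (fun t => g t * phi t) -oo%O x (x + 1).
- by rewrite ltrDl.
- exact: integrable_phi.
- by rewrite ltNyr.
- by apply: cvgM; [exact: cg|exact: continuous_phi].
- have FE' : 'D_1 (phi_int g) x = g x * phi x by rewrite -derive1E; exact: FE.
  exact: (DeriveDef dF FE').
Qed.

Definition Phi : R -> R := phi_int (fun=> 1).

Lemma is_derive_Phi x : is_derive x 1 Phi (phi x).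
Proof.
by rewrite -[X in is_derive _ _ _ X]mul1r; apply: is_derive_phi_int;
  [exact: brv_cst|exact: cst_continuous].
Qed.

Lemma PhiE x : std_normal R `]-oo, x]%classic = (Phi x)%:E.
Proof.
rewrite /std_normal /distribution /pushforward /= /normal_prob /Phi /phi_int.
rewrite /Rintegral fineK; last first.
  by apply: integrable_fin_num => //; apply: integrable_phi => //; exact: brv_cst.
by apply: eq_integral => t _; rewrite mul1r.
Qed.

End gaussian_density.

Section gaussian_tail.
Context (R : realType).
Implicit Types x y : R.
Notation Phi := (@Phi R).
Notation phi := (@phi R).

Lemma Phi_ge0 x : 0 <= Phi x.
Proof. by rewrite -lee_fin -PhiE. Qed.

Lemma Phi_le1 x : Phi x <= 1.
Proof. by rewrite -lee_fin -PhiE; exact: probability_le1. Qed.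

Lemma Phi_limits e : 0 < e ->
  exists2 M : R, 0 < M & forall x, M <= x -> 1 - Phi x <= e /\ Phi (- x) <= e.
Proof.
move=> e0.
have [X XE] := mfun_of (@measurable_id _ R setT).
have PX : @cdf _ _ _ (std_normal R) X = fun y => (Phi y)%:E.
  by apply/funext => y; rewrite -PhiE /cdf /distribution /pushforward XE.
have := @cvg_cdfy1 _ _ _ (std_normal R) X; rewrite PX.
move=> /fine_cvgP[_ /cvgrPdist_le /(_ e e0)] [M [_ HM]].
have := @cvg_cdfNy0 _ _ _ (std_normal R) X; rewrite PX.
move=> /fine_cvgP[_ /cvgrPdist_le /(_ e e0)] [N [_ HN]].
exists (`|M| + `|N| + 1) => [|x Mx]; first by rewrite ltr_wpDl // addr_ge0.
have MM := ler_norm M; have NN := ler_norm (- N); have M0 := normr_ge0 M.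
have N0 := normr_ge0 N; rewrite normrN in NN.
have : M < x by lra.
have : - x < N by lra.
move=> /HN /=; rewrite sub0r normrN => HN'.
move=> /HM /=; rewrite ler_norml => /andP[_ HM'].
split => //; exact: le_trans (ler_norm _) HN'.
Qed.

(** The sum has derivative zero because [phi] is even, and its constant value is read off at
    infinity. *)
Lemma Phi_symm x : Phi x + Phi (- x) = 1.
Proof.
have dS y : is_derive y 1 (fun z => Phi z + Phi (- z)) 0.
  have d1 := is_derive_Phi y; have d2 := is_derive_Phi (- y).
  have d3 : is_derive y 1 (Phi \o (@GRing.opp R)) (phi (- y) * -1).
    exact: is_derive1_comp.
  have -> : (fun z => Phi z + Phi (- z)) = Phi \+ (Phi \o (@GRing.opp R)) by [].
  apply: is_derive_eq.
  by rewrite !phiE sqrrN; ring.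
have Sc y : Phi y + Phi (- y) = Phi x + Phi (- x).
  exact: (@is_derive_0_is_cst R _ y x dS).
apply/eqP; rewrite -subr_eq0 -normr_le0; apply/ler_addgt0Pl => e e0.
rewrite addr0.
have [M M0 /(_ M (lexx M)) [M1 M2]] := Phi_limits e0.
rewrite -(Sc M) ler_norml; apply/andP; split; last by have := Phi_le1 M; lra.
by have := Phi_ge0 (- M); lra.
Qed.

Lemma phi_le_peak x : phi x <= normal_peak 1.
Proof. by apply: normal_pdf_ub; rewrite oner_neq0. Qed.

(** [1 - Phi z - phi z / z] has derivative [phi z / z ^+ 2] and tends to [0] at infinity, hence is
    nonpositive. *)
Lemma mills_upper x : 0 < x -> (1 - Phi x) * x <= phi x.
Proof.
move=> x0.
suff H : 1 - Phi x <= phi x / x by rewrite -ler_pdivlMr.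
apply/ler_addgt0Pl => e e0.
have [M M0 HM] := Phi_limits e0.
pose y := Num.max x M.
have xy : x <= y by rewrite le_max lexx.
have My : M <= y by rewrite le_max lexx orbT.
pose U := (fun z => 1 - Phi z - phi z / z).
have : U x <= U y.
  apply: (@deriv_mono R U (fun z => phi z / z ^+ 2) x y xy).
  - move=> z /andP[xz _].
    have z0 : 0 < z by lra.
    have dv : is_derive z 1 (fun z : R => z^-1) (- z ^- 2).
      have zn0 : (fun z : R => z) z != 0 by rewrite gt_eqF.
      have := @is_deriveV R (fun z : R => z) z 1 1 zn0.
      by rewrite /GRing.scale /= mulr1; apply; exact: is_derive_id.
    have d1 := is_derive_Phi z; have d2 := is_derive_phi z.
    have -> : U = (cst 1 - Phi) - phi * (fun z : R => z^-1) by [].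
    apply: is_derive_eq; rewrite /GRing.scale /=; field.
    by rewrite gt_eqF.
  - by move=> z /andP[xz _]; rewrite divr_ge0 ?ltW ?phi_gt0 // exprn_gt0 //; lra.
rewrite /U; have [HM1 _] := HM y My.
  have : 0 <= phi y / y by rewrite divr_ge0 ?ltW ?phi_gt0 //; lra.
  lra.
Qed.

(** Same scheme: [U] below has derivative [3 * phi z / z ^+ 4] and tends to [0] at infinity. *)
Lemma mills_lower x : 0 < x -> phi x * (x ^+ 2 - 1) <= (1 - Phi x) * x ^+ 3.
Proof.
move=> x0.
suff H : phi x * (x^-1 - x^-1 ^+ 3) <= 1 - Phi x.
  have : phi x * (x^-1 - x^-1 ^+ 3) * x ^+ 3 <= (1 - Phi x) * x ^+ 3.
    by rewrite ler_wpM2r // exprn_ge0 // ltW.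
  congr (_ <= _); field.
  by rewrite gt_eqF.
apply/ler_addgt0Pl => e e0.
(* Far enough for [phi y / y] to be at most [e], since [phi] is bounded by its peak. *)
pose y := Num.max x (normal_peak 1 / e).
have pk0 : 0 < normal_peak (1 : R) by rewrite normal_peak_gt0 // oner_neq0.
have xy : x <= y by rewrite le_max lexx.
have My : normal_peak 1 / e <= y by rewrite le_max lexx orbT.
pose U := (fun z => phi z * (z^-1 - z^-1 ^+ 3) - (1 - Phi z)).
have : U x <= U y.
  apply: (@deriv_mono R U (fun z => 3 * phi z * z^-1 ^+ 4) x y xy).
  - move=> z /andP[xz _].
    have z0 : 0 < z by lra.
    have dv : is_derive z 1 (fun z : R => z^-1) (- z ^- 2).
      have zn0 : (fun z : R => z) z != 0 by rewrite gt_eqF.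
      have := @is_deriveV R (fun z : R => z) z 1 1 zn0.
      by rewrite /GRing.scale /= mulr1; apply; exact: is_derive_id.
    have d1 := is_derive_Phi z; have d2 := is_derive_phi z.
    pose v : R -> R := fun z => z^-1.
    have -> : U = phi * (v - v * (v * v)) - (cst 1 - Phi).
      by apply/funext => w; rewrite /U !exprS expr0 mulr1.
    apply: is_derive_eq.
    have E1 : (v * v) z = z^-1 * z^-1 by [].
    have E2 : (v - v * (v * v)) z = z^-1 - z^-1 * (z^-1 * z^-1) by [].
    rewrite E1 E2 /GRing.scale /v /=; field.
    by rewrite gt_eqF.
  - move=> z /andP[xz _]; have z0 : 0 < z by lra.
    rewrite mulr_ge0 ?exprn_ge0 ?invr_ge0 ?(ltW z0) //.
    by rewrite mulr_ge0 // ltW // phi_gt0.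
rewrite /U => HU.
  have y0 : 0 < y by lra.
  suff : phi y * (y^-1 - y^-1 ^+ 3) <= e by have := Phi_le1 y; lra.
  apply: (@le_trans _ _ (normal_peak 1 * y^-1)); last first.
    by rewrite ler_pdivrMr // mulrC -ler_pdivrMr.
  apply: (@le_trans _ _ (phi y * y^-1)); last first.
    by rewrite ler_wpM2r ?phi_le_peak // invr_ge0 ltW.
  by rewrite ler_wpM2l ?(ltW (phi_gt0 _)) // gerBl exprn_ge0 // invr_ge0 ltW.
Qed.

End gaussian_tail.

(** * Lipschitz approximation of half-line indicators *)

Section stein_equation.
Context (R : realType).
Implicit Types x y : R.
Notation Phi := (@Phi R).
Notation phi := (@phi R).
Notation leb := (@lebesgue_measure R).

(** A Lipschitz substitute for the indicator of a half-line, equal to [1] up to [a] and to [0] from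
    [b] on. For the indicator itself the solution of Stein's equation has a discontinuous
    derivative. *)
Definition ramp (a b x : R) : R := Num.max 0 (Num.min 1 ((b - x) / (b - a))).

Lemma ramp_ge0 a b x : 0 <= ramp a b x.
Proof. by rewrite /ramp le_max lexx. Qed.

Lemma ramp_le1 a b x : ramp a b x <= 1.
Proof. by rewrite /ramp ge_max ler01 ge_min lexx. Qed.

Lemma ramp_left a b x : a < b -> x <= a -> ramp a b x = 1.
Proof.
move=> ab xa; rewrite /ramp min_l; first by rewrite max_r.
by rewrite ler_pdivlMr ?subr_gt0 //; lra.
Qed.

Lemma ramp_right a b x : a < b -> b <= x -> ramp a b x = 0.
Proof.
move=> ab bx; rewrite /ramp max_l // ge_min; apply/orP; right.
by rewrite ler_pdivrMr ?subr_gt0 //; lra.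
Qed.

Lemma ramp_lipschitz a b x y : a < b ->
  `|ramp a b x - ramp a b y| <= (b - a)^-1 * `|x - y|.
Proof.
move=> ab; have ab0 : 0 < (b - a)^-1 by rewrite invr_gt0 subr_gt0.
have -> : (b - a)^-1 * `|x - y| = `|(b - x) / (b - a) - (b - y) / (b - a)|.
  rewrite -mulrBl normrM (gtr0_norm ab0) mulrC distrC; congr (`|_| * _); ring.
rewrite /ramp; set u := _ / _; set v := _ / _.
have Hmm (s t : R) : `|Num.max 0 s - Num.max 0 t| <= `|s - t|.
  rewrite !maxEle; case: ifPn; case: ifPn; rewrite -?ltNge => ? ?;
    rewrite !ler_norml ?ler_normr ?subrr;
    have := ler_norm (s - t); have := ler_norm (- (s - t)); rewrite normrN;
    move=> ? ?; apply/andP; split; lra.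
have Hm (s t : R) : `|Num.min 1 s - Num.min 1 t| <= `|s - t|.
  rewrite !minEle; case: ifPn; case: ifPn; rewrite -?ltNge => ? ?;
    rewrite !ler_norml ?ler_normr ?subrr;
    have := ler_norm (s - t); have := ler_norm (- (s - t)); rewrite normrN;
    move=> ? ?; apply/andP; split; lra.
exact: le_trans (Hmm _ _) (Hm _ _).
Qed.

Lemma lipschitz_continuous (f : R -> R) (K : R) :
  (forall x y, `|f x - f y| <= K * `|x - y|) -> continuous f.
Proof.
move=> fK x; apply/cvgrPdist_le => e e0.
have K0 : 0 <= K.
  by have := fK 1 0; rewrite subr0 normr1 mulr1; apply: le_trans.
have K1 : 0 < K + 1 by rewrite ltr_wpDl.
near=> y; apply: le_trans (fK _ _) _.
apply: (@le_trans _ _ ((K + 1) * `|x - y|)).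
  by rewrite ler_wpM2r // lerDl.
rewrite mulrC -ler_pdivlMr //.
near: y; apply: cvgr_dist_le; last by rewrite divr_gt0.
exact: cvg_id.
Unshelve. all: by end_near. Qed.

Lemma ramp_brv a b : a < b -> bounded_rv (ramp a b).
Proof.
move=> ab; split.
  apply: continuous_measurable_fun; apply: lipschitz_continuous => x y.
  exact: ramp_lipschitz.
by exists 1 => x; rewrite ger0_norm ?ramp_ge0 ?ramp_le1.
Qed.

Lemma ramp_continuous a b : a < b -> continuous (ramp a b).
Proof. by move=> ab; apply: lipschitz_continuous => x y; exact: ramp_lipschitz. Qed.

End stein_equation.

(** * Stein's method *)

Section stein_solution.
Context (R : realType) (a b : R) (ab : a < b).
Implicit Types x y : R.
Notation Phi := (@Phi R).
Notation phi := (@phi R).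
Notation leb := (@lebesgue_measure R).
Let h := ramp a b.

Definition ramp_mean : R := \int[leb]_t (h t * phi t).
Let c := ramp_mean.

Let int_h (D : set R) : measurable D -> leb.-integrable D (EFin \o (fun t => h t * phi t)).
Proof. by move=> mD; apply: integrable_phi => //; exact: ramp_brv. Qed.

Lemma phi_int_ramp_left x : x <= a -> phi_int h x = Phi x.
Proof.
move=> xa; apply: eq_Rintegral => t; rewrite inE /= in_itv /= => tx.
by rewrite /h ramp_left // (le_trans tx).
Qed.

Lemma phi_int_ramp_right x : b <= x -> phi_int h x = c.
Proof.
move=> bx; rewrite /phi_int Rintegral_mkcond; apply: eq_Rintegral => t _.
rewrite patchE; case: ifPn => //; rewrite notin_setE /= in_itv /= => /negP.
by rewrite -ltNge => xt; rewrite /h ramp_right ?mul0r // (le_trans bx) // ltW.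
Qed.

Lemma ramp_mean_ge : Phi a <= c.
Proof.
rewrite /Phi /phi_int Rintegral_mkcond; apply: le_Rintegral => //.
- rewrite -restrict_EFin; apply: (iffLR (integrable_mkcond _ _)) => //.
  by apply: integrable_phi => //; exact: brv_cst.
- exact: int_h.
move=> t _; rewrite patchE; case: ifPn.
  by rewrite inE /= in_itv /= => ta; rewrite /h ramp_left.
by move=> _; rewrite mulr_ge0 ?ramp_ge0 // ltW // phi_gt0.
Qed.

Lemma ramp_mean_le : c <= Phi b.
Proof.
rewrite /Phi /phi_int Rintegral_mkcond; apply: le_Rintegral => //.
- exact: int_h.
- rewrite -restrict_EFin; apply: (iffLR (integrable_mkcond _ _)) => //.
  by apply: integrable_phi => //; exact: brv_cst.
move=> t _; rewrite patchE; case: ifPn.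
  by move=> _; rewrite ler_wpM2r ?ramp_le1 // ltW // phi_gt0.
rewrite notin_setE /= in_itv /= => /negP; rewrite -ltNge => bt.
by rewrite /h ramp_right ?mul0r // ltW.
Qed.

Let c01 : 0 <= c <= 1.
Proof.
by rewrite (le_trans _ ramp_mean_ge) ?Phi_ge0 // (le_trans ramp_mean_le) // Phi_le1.
Qed.

(** Multiplying [f' - x f = h - c] by the integrating factor [phi] turns its left side into the
    derivative of [f * phi], which is then integrated from minus infinity. *)
Definition stein_fun x : R := (phi_int h x - c * Phi x) / phi x.
Let f := stein_fun.

Lemma is_derive_stein x : is_derive x 1 f (h x - c + x * f x).
Proof.
have d1 : is_derive x 1 (phi_int h) (h x * phi x).
  by apply: is_derive_phi_int; [exact: ramp_brv|exact: ramp_continuous].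
have d2 := is_derive_Phi x; have d3 := is_derive_phi x.
have px0 := phi_gt0 x.
have d4 : is_derive x 1 (fun z => (phi z)^-1) (- phi x ^- 2 *: (- x * phi x)).
  by apply: (@is_deriveV R phi x); rewrite gt_eqF.
have -> : f = (phi_int h - c *: Phi) * (fun z => (phi z)^-1) by [].
apply: is_derive_eq.
have -> : (phi_int h - c *: Phi) x = phi_int h x - c * Phi x by [].
have -> : ((phi_int h - c *: Phi) * (fun z => (phi z)^-1)) x = f x by [].
rewrite /f /stein_fun /GRing.scale /=; field.
by rewrite gt_eqF.
Qed.

Lemma stein_continuous : continuous f.
Proof. by move=> x; exact: is_derive_continuous (is_derive_stein x). Qed.

Lemma stein_right x : b <= x -> f x = c * (1 - Phi x) / phi x.
Proof. by move=> bx; rewrite /f /stein_fun phi_int_ramp_right // mulrBr mulr1. Qed.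

Lemma stein_left x : x <= a -> f x = (1 - c) * Phi x / phi x.
Proof. by move=> xa; rewrite /f /stein_fun phi_int_ramp_left //; congr (_ / _); ring. Qed.

Let f' x := h x - c + x * f x.

(** Beyond the ramp the solution is a constant [q] times the Mills ratio, so the two Mills
    inequalities bound it together with the expressions that [f'] and [x f'] take there. *)
Let tail x (q : R) : 1 <= x -> 0 <= q <= 1 ->
  let F := q * (1 - Phi x) / phi x in
  [/\ `|F| <= 1, `|x * F - q| <= 1 & `|x * (x * F - q)| <= 1].
Proof.
move=> x1 /andP[q0 q1] F.
have x0 : 0 < x by lra.
have px0 := phi_gt0 x.
pose m := (1 - Phi x) / phi x.
have FE : F = q * m by rewrite /F /m mulrA.
have mu : m * x <= 1.
  by rewrite /m mulrAC ler_pdivrMr // mul1r mills_upper.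
have ml : x ^+ 2 - 1 <= m * x ^+ 3.
  by rewrite /m mulrAC ler_pdivlMr // mulrC mills_lower.
have m0 : 0 <= m by rewrite divr_ge0 ?(ltW px0) // subr_ge0 Phi_le1.
have m1 : m <= 1 by apply: le_trans mu; rewrite ler_peMr.
have B : - 1 <= x * (x * m - 1).
  have : x * (x * (x * m - 1)) >= x * (- 1).
    apply: (@le_trans _ _ (-1)); first by rewrite mulrN1 lerN2.
    have -> : x * (x * (x * m - 1)) = m * x ^+ 3 - x ^+ 2 by ring.
    lra.
  by rewrite ler_pM2l.
have B' : x * (x * m - 1) <= 0 by rewrite pmulr_rle0 // subr_le0 mulrC.
have P1 : `|x * F - q| <= 1.
  have -> : x * F - q = - (q * (1 - m * x)) by rewrite FE; ring.
  have m01 : 0 <= 1 - m * x by rewrite subr_ge0.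
  rewrite normrN (ger0_norm (mulr_ge0 q0 m01)); apply: mulr_ile1 => //.
  by rewrite gerBl mulr_ge0 // ltW.
split => //.
- have qm0 : 0 <= q * m by exact: mulr_ge0.
  by rewrite FE (ger0_norm qm0); exact: mulr_ile1.
- have -> : x * (x * F - q) = q * (x * (x * m - 1)) by rewrite FE; ring.
  rewrite normrM (ger0_norm q0); apply: mulr_ile1 => //.
  by rewrite ler_norml B /=; exact: le_trans B' ler01.
Qed.

(** The third quantity is the derivative of [x f]; its bound is what makes [f'] Lipschitz.
    Continuity suffices on a compact interval, the tail estimate applies outside. *)
Lemma stein_bounds : exists K, forall x,
  [/\ `|f x| <= K, `|f' x| <= K & `|f x + x * f' x| <= K].
Proof.
have cf' : continuous f'.
  move=> x; apply: cvgD; first by apply: cvgB; [exact: ramp_continuous|exact: cvg_cst].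
  by apply: cvgM; [exact: cvg_id|exact: stein_continuous].
have cg : continuous (fun x => f x + x * f' x).
  move=> x; apply: cvgD; first exact: stein_continuous.
  by apply: cvgM; [exact: cvg_id|exact: cf'].
(* Outside [[-M, M]] the ramp is constant and [|x| >= 1], as the tail estimate requires. *)
pose M : R := 1 + `|a| + `|b|.
have M0 : 1 <= M by rewrite /M -addrA lerDl addr_ge0.
have [K1 HK1] := continuous_bounded_segment (- M) M stein_continuous.
have [K2 HK2] := continuous_bounded_segment (- M) M cf'.
have [K3 HK3] := continuous_bounded_segment (- M) M cg.
have Mm : - M <= M <= M by rewrite lexx andbT; lra.
have K10 := le_trans (normr_ge0 _) (HK1 M Mm).
have K20 := le_trans (normr_ge0 _) (HK2 M Mm).
have K30 := le_trans (normr_ge0 _) (HK3 M Mm).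
have Na := ler_norm (- a); have Nb := ler_norm b; rewrite normrN in Na.
have a0 := normr_ge0 a; have b0 := normr_ge0 b.
exists (2 + K1 + K2 + K3) => x.
have [xM|Mx] := leP x M; last first.
  have bx : b <= x by rewrite /M in Mx *; lra.
  have x1 : 1 <= x by lra.
  have [F1 F2 F3] := tail x1 c01; rewrite -stein_right // in F1 F2 F3.
  have f'E : f' x = x * f x - c by rewrite /f' /h ramp_right // sub0r addrC.
  rewrite f'E; split; [lra|lra|].
  by apply: le_trans (ler_normD _ _) _; lra.
have [Mx|Mx] := leP (- M) x.
  have Mxx : - M <= x <= M by rewrite Mx.
  by split; [have := HK1 x Mxx|have := HK2 x Mxx|have := HK3 x Mxx]; lra.
have xa : x <= a by rewrite /M in Mx *; lra.
have x1 : 1 <= - x by lra.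
have c01' : 0 <= 1 - c <= 1 by case/andP: c01 => ? ?; apply/andP; split; lra.
(* The left tail is the right tail reflected, with [1 - c] in place of [c]. *)
have [F1 F2 F3] := tail x1 c01'.
have PE : 1 - Phi (- x) = Phi x by rewrite -(Phi_symm x); ring.
have pE : phi (- x) = phi x by rewrite !phiE sqrrN.
rewrite PE pE -stein_left // in F1 F2 F3.
have f'E : f' x = x * f x + (1 - c) by rewrite /f' /h ramp_left // addrC.
have F2' : `|x * f x + (1 - c)| <= 1.
  by rewrite -normrN opprD -mulNr.
have F3' : `|x * (x * f x + (1 - c))| <= 1.
  by have -> : x * (x * f x + (1 - c)) = - x * (- x * f x - (1 - c)) by ring.
rewrite f'E; split; [lra|lra|].
by apply: le_trans (ler_normD _ _) _; lra.
Qed.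

End stein_solution.

Lemma stein_exists (R : realType) (a b : R) : a < b ->
  exists c : R, exists K : R, exists f : R -> R, exists f' : R -> R,
  [/\ Phi a <= c <= Phi b, 0 <= K,
      (forall x : R, is_derive x 1 f (f' x) /\ f' x - x * f x = ramp a b x - c),
      (forall x, `|f x| <= K /\ `|f' x| <= K) &
      forall x y, `|f' x - f' y| <= K * `|x - y|].
Proof.
move=> ab; have [K HK] := stein_bounds ab.
have K0 : 0 <= K by case: (HK 0) => /(le_trans (normr_ge0 _)).
have K1 : 0 < (b - a)^-1 by rewrite invr_gt0 subr_gt0.
exists (ramp_mean a b), (K + (b - a)^-1), (stein_fun a b).
exists (fun x => ramp a b x - ramp_mean a b + x * stein_fun a b x).
split.
- by rewrite ramp_mean_ge // ramp_mean_le.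
- lra.
- by move=> x; split; [exact: is_derive_stein|ring].
- by move=> x; case: (HK x) => ? ? _; split; lra.
move=> x y.
have dg (z : R) : is_derive z 1 (fun t => t * stein_fun a b t) (stein_fun a b z +
    z * (ramp a b z - ramp_mean a b + z * stein_fun a b z)).
  have d1 := is_derive_stein ab z.
  have -> : (fun t => t * stein_fun a b t) = (@id R) * stein_fun a b by [].
  by apply: is_derive_eq; rewrite /GRing.scale /=; ring.
have L := deriv_lipschitz dg (fun z => let: And3 _ _ H := HK z in H) x y.
have L2 := ramp_lipschitz x y ab.
rewrite mulrDl.
set u := ramp a b x in L2 *; set v := ramp a b y in L2 *; set w := ramp_mean a b.
set s := x * _ in L *; set t := y * _ in L *.
have -> : u - w + s - (v - w + t) = (s - t) + (u - v) by ring.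
by apply: le_trans (ler_normD _ _) _; exact: lerD.
Qed.

(** * Independence of a summand from the sum of the others *)

Section leave_one_out_independence.
Context d (T : measurableType d) (R : realType) (P : probability T R).

(** Each variable is independent of a single random element [U] through which all earlier ones
    factor. In the application [U] is the family of preceding vectors. *)
Definition sequentially_indep (N : nat) (xi : nat -> T -> R) :=
  forall j, (j < N)%N -> exists d' (E : measurableType d') (U : {mfun T >-> E})
    (g : nat -> E -> R),
    indep P U (xi j) /\
    forall i, (i < j)%N -> measurable_fun setT (g i) /\ xi i =1 (fun w => g i (U w)).

(** Induction on the length of the sum. A new [xi k] is independent of the pair formed by [xi i] and
    the partial sum, both being functions of [U]; [indepA] then moves it next to the partial sum. *)
Lemma sequentially_indep_loo N xi : (forall i, measurable_fun setT (xi i)) ->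
  sequentially_indep N xi -> forall i, (i < N)%N ->
  indep P (xi i) (fun w => \sum_(0 <= j < N | j != i) xi j w).
Proof.
move=> mxi SI i iN.
suff H k : (i < k <= N)%N -> indep P (xi i) (fun w => \sum_(0 <= j < k | j != i) xi j w).
  by apply: H; rewrite iN leqnn.
elim: k => // k IH /andP[ik kN].
have msum (d' : measure_display) (E : measurableType d') (g : nat -> E -> R) k' :
    (forall j, (j < k')%N -> measurable_fun setT (g j)) ->
    measurable_fun setT (fun e => \sum_(0 <= j < k' | j != i) g j e).
  move=> mg.
  have -> : (fun e => \sum_(0 <= j < k' | j != i) g j e) =
      (fun e => \sum_(j < k') (if val j != i then g j e else 0)).
    apply/funext => e.
    transitivity (\sum_(0 <= j < k') (if j != i then g j e else 0)).
      exact: big_mkcond.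
    exact: big_mkord.
  apply: measurable_sum => j.
  by case: (boolP (val j != i)) => // _; exact: mg.
move: ik; rewrite ltnS leq_eqVlt => /orP[/eqP <-|ik].
  have [d' [E [U [g [UX gU]]]]] := SI i iN.
  apply: indepC.
  have mg : measurable_fun setT (fun e => \sum_(0 <= j < i | j != i) g j e).
    by apply: msum => j ji; have [] := gU j ji.
  have := indep_comp mg (@measurable_id _ _ setT) UX; congr (indep P _ _).
  apply/funext => w; rewrite [RHS]big_mkcond big_nat_recr //= eqxx addr0 -big_mkcond.
  rewrite [LHS]big_nat_cond [RHS]big_nat_cond; apply: eq_bigr => j /andP[/andP[_ ji] _].
  by have [_ ->] := gU j ji.
have [d' [E [U [g [UX gU]]]]] := SI k kN.
have XY : indep P (xi i) (fun w => \sum_(0 <= j < k | j != i) xi j w).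
  by apply: IH; rewrite ik ltnW.
have [X XE] := mfun_of (mxi i).
have [Z ZE] := mfun_of (mxi k).
have [Y YE] := mfun_of (msum _ _ _ k (fun j _ => mxi j)).
rewrite -XE -YE in XY; rewrite -ZE in UX.
have XYZ : indep P (fun w => (X w, Y w)) Z.
  have mg : measurable_fun setT (fun e => (g i e, \sum_(0 <= j < k | j != i) g j e)).
    apply/measurable_fun_pairP; split => /=; first by have [] := gU i ik.
    by apply: msum => j jk; have [] := gU j jk.
  have := indep_comp mg (@measurable_id _ _ setT) UX; congr (indep P _ _).
  apply/funext => w; rewrite XE YE; have [_ ->] := gU i ik; congr (_, _).
  rewrite [LHS]big_nat_cond [RHS]big_nat_cond; apply: eq_bigr => j /andP[/andP[_ ji] _].
  by have [_ ->] := gU j ji.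
have madd : measurable_fun setT (fun z : R * R => z.1 + z.2) by exact: measurable_funD.
have := indep_comp (@measurable_id _ _ setT) madd (indepA XY XYZ).
congr (indep P _ _); first by rewrite XE.
apply/funext => w /=; rewrite YE ZE [RHS]big_mkcond big_nat_recr //=.
by rewrite gtn_eqF // -big_mkcond.
Qed.

End leave_one_out_independence.

Section stein_clt.
Context (R : realType).

(** Weighted arithmetic-geometric inequality. It replaces odd absolute moments by even moments of
    order at most four, the ones available on the sphere. *)
Lemma cube_le (e x : R) : 0 < e -> `|x| ^+ 3 <= (e * x ^+ 2 + x ^+ 4 / e) / 2.
Proof.
move=> e0; have x0 := normr_ge0 x.
have -> : x ^+ 2 = `|x| ^+ 2 by rewrite real_normK ?num_real.
have -> : x ^+ 4 = `|x| ^+ 4.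
  by rewrite -[4%N]/(2 * 2)%N !exprM real_normK ?num_real.
set y := `|x| in x0 *; rewrite -subr_ge0.
have -> : (e * y ^+ 2 + y ^+ 4 / e) / 2 - y ^+ 3 = y ^+ 2 * (e - y) ^+ 2 / (2 * e).
  by field; rewrite gt_eqF.
have e2 : 0 <= 2 * e by lra.
by rewrite (divr_ge0 _ e2) // mulr_ge0 // sqr_ge0.
Qed.

Lemma abs_le (e x : R) : 0 < e -> `|x| <= (e + x ^+ 2 / e) / 2.
Proof.
move=> e0; have x0 := normr_ge0 x.
have -> : x ^+ 2 = `|x| ^+ 2 by rewrite real_normK ?num_real.
set y := `|x| in x0 *; rewrite -subr_ge0.
have -> : (e + y ^+ 2 / e) / 2 - y = (e - y) ^+ 2 / (2 * e).
  by field; rewrite gt_eqF.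
have e2 : 0 <= 2 * e by lra.
by rewrite (divr_ge0 _ e2) // sqr_ge0.
Qed.

(** The constants are chosen before the probability space because the spaces vary with [n]. The
    parameter [e] is free: of the order of the square root of the sum of fourth moments, it yields
    an error of that same order. *)
Lemma stein_clt (a b : R) : a < b -> exists c : R, exists K : R,
  [/\ Phi a <= c <= Phi b, 0 <= K &
  forall d (T : measurableType d) (P : probability T R) (N : nat)
    (xi : nat -> T -> R) (e : R),
    (forall i, bounded_rv (xi i)) -> sequentially_indep P N xi ->
    (forall i, (i < N)%N -> Ex P (xi i) = 0) ->
    \sum_(0 <= i < N) Ex P (fun w => xi i w ^+ 2) = 1 -> 0 < e ->
    `|Ex P (fun w => ramp a b (\sum_(0 <= i < N) xi i w)) - c| <=
    K * (e + (\sum_(0 <= i < N) Ex P (fun w => xi i w ^+ 4)) / e)].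
Proof.
move=> ab; have [c [K [f [f' [cab K0 fdf fK f'K]]]]] := stein_exists ab.
exists c, K; split => // d T P N xi e bxi SI xi0 v1 e0.
have df (x : R) : is_derive x 1 f (f' x) by have [] := fdf x.
have mf : measurable_fun setT f.
  by apply: continuous_measurable_fun => x; exact: is_derive_continuous (df x).
have mf' : measurable_fun setT f'.
  by apply: continuous_measurable_fun; exact: lipschitz_continuous f'K.
pose W w := \sum_(0 <= i < N) xi i w.
pose Wi i w := \sum_(0 <= j < N | j != i) xi j w.
have bW : bounded_rv W by exact: brv_sum.
have bWi i : bounded_rv (Wi i) by exact: brv_sum.
have bf V : bounded_rv V -> bounded_rv (fun w : T => f (V w)).
  by move=> bV; apply: brv_comp (brv_meas bV) => //; exists K => x; have [] := fK x.
have bf' V : bounded_rv V -> bounded_rv (fun w : T => f' (V w)).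
  by move=> bV; apply: brv_comp (brv_meas bV) => //; exists K => x; have [] := fK x.
have WE i : (i < N)%N -> forall w, W w = Wi i w + xi i w.
  move=> iN w; rewrite /W /Wi (bigD1_seq i) ?mem_index_iota ?iota_uniq //= addrC //.
have -> : Ex P (fun w => ramp a b (W w)) - c = Ex P (fun w => f' (W w) - W w * f (W w)).
  rewrite -[X in _ - X](Ex_cst P c) -ExB; last exact: brv_cst.
    by apply: eq_Ex => w; have [_ ->] := fdf (W w).
  apply: brv_comp (brv_meas bW); first by have [] := ramp_brv ab.
  by have [_] := ramp_brv ab.
pose v i := Ex P (fun w => xi i w ^+ 2); pose k i := Ex P (fun w => xi i w ^+ 4).
have v0 i : 0 <= v i by apply: Ex_ge0 => w; exact: sqr_ge0.
(* The variances add up to [1], so the mean of [f' (W w)] can be distributed over the summands. *)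
have E1 : Ex P (fun w => f' (W w) - W w * f (W w)) =
    \sum_(0 <= i < N) (v i * Ex P (fun w => f' (W w)) - Ex P (fun w => xi i w * f (W w))).
  rewrite sumrB -mulr_suml v1 mul1r -Ex_sum; last by move=> i; apply: brvM => //; exact: bf.
  rewrite ExB; [|exact: bf'|apply: brvM => //; exact: bf].
  by congr (_ - _); apply: eq_Ex => w; rewrite mulr_suml.
rewrite E1; apply: le_trans (ler_norm_sum _ _ _) _.
have -> : K * (e + (\sum_(0 <= i < N) k i) / e) =
    \sum_(0 <= i < N) K * (e * v i + k i / e).
  by rewrite -mulr_sumr big_split /= -mulr_sumr v1 mulr1 -mulr_suml.
rewrite big_nat_cond [leRHS]big_nat_cond; apply: ler_sum => i /andP[/andP[_ iN] _].
have loo := sequentially_indep_loo (fun i => brv_meas (bxi i)) SI iN.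
have i1 : Ex P (fun w => xi i w * f (Wi i w)) = 0.
  rewrite indep_Ex_mul ?xi0 ?mul0r //; first exact: bf.
  exact: (indep_comp (@measurable_id _ _ setT) mf loo).
have i2 : Ex P (fun w => xi i w ^+ 2 * f' (Wi i w)) = v i * Ex P (fun w => f' (Wi i w)).
  rewrite indep_Ex_mul //; [exact: brvX|exact: bf'|].
  apply: (@indep_comp _ _ _ _ _ _ _ _ _ _ _ _ _ _ (fun x : R => x ^+ 2) f' _ mf' loo).
  exact: exprn_measurable.
pose E3 := Ex P (fun w => `|xi i w| ^+ 3).
(* Expand [f] at the sum without [xi i]: independence kills the constant term and turns the linear
   one into [v i] times the mean of [f'] there, leaving a cubic Taylor remainder. *)
have B1 : `|Ex P (fun w => xi i w * f (W w)) - v i * Ex P (fun w => f' (Wi i w))| <= K * E3.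
  rewrite -i2 -[X in `|X - _|]subr0 -i1 -ExB; last 2 first.
  - by apply: brvM => //; exact: bf.
  - by apply: brvM => //; exact: bf.
  have b1 : bounded_rv (fun w => xi i w * f (W w)) by apply: brvM => //; exact: bf.
  have b2 : bounded_rv (fun w => xi i w * f (Wi i w)) by apply: brvM => //; exact: bf.
  have b3 : bounded_rv (fun w => xi i w ^+ 2 * f' (Wi i w)).
    by apply: brvM; [exact: brvX|exact: bf'].
  rewrite -ExB //; last exact: brvB.
  apply: le_trans (Ex_norm _ _) _; first by apply: brvB => //; exact: brvB.
  rewrite -ExZ; last by apply: brvX; exact: brv_norm.
  apply: Ex_le.
  - by apply: brv_norm; apply: brvB => //; exact: brvB.
  - by apply: brvZ; apply: brvX; exact: brv_norm.
  move=> w; rewrite (WE i iN).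
  have -> : xi i w * f (Wi i w + xi i w) - xi i w * f (Wi i w) - xi i w ^+ 2 * f' (Wi i w)
    = xi i w * (f (Wi i w + xi i w) - f (Wi i w) - xi i w * f' (Wi i w)) by ring.
  rewrite normrM exprS mulrCA ler_wpM2l // -[X in X <= _]mulr1.
  rewrite mulr1 real_normK ?num_real //; exact: taylor1_lipschitz.
have B2 : `|Ex P (fun w => f' (W w)) - Ex P (fun w => f' (Wi i w))| <=
    K * Ex P (fun w => `|xi i w|).
  rewrite -ExB; [|exact: bf'|exact: bf'].
  apply: le_trans (Ex_norm _ _) _; first by apply: brvB; exact: bf'.
  rewrite -ExZ; last exact: brv_norm.
  apply: Ex_le; [by apply: brv_norm; apply: brvB; exact: bf'|by apply: brvZ; exact: brv_norm|].
  move=> w; apply: le_trans (f'K _ _) _.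
  by rewrite (WE i iN) addrAC subrr add0r.
have E3le : E3 <= (e * v i + k i / e) / 2.
  have -> : (e * v i + k i / e) / 2 = Ex P (fun w => (e * xi i w ^+ 2 + e^-1 * xi i w ^+ 4) * 2^-1).
    under [RHS]eq_Ex do rewrite mulrC.
    rewrite ExZ ?ExD ?ExZ //; try (by apply: brvX); try (by apply: brvZ; apply: brvX).
      by rewrite -/(v i) -/(k i); ring.
    by apply: brvD; apply: brvZ; apply: brvX.
  apply: Ex_le; [by apply: brvX; exact: brv_norm| |].
    by apply: brvM; [apply: brvD; apply: brvZ; exact: brvX|exact: brv_cst].
  by move=> w; rewrite [e^-1 * _]mulrC; exact: cube_le.
have E1le : Ex P (fun w => `|xi i w|) <= (e + v i / e) / 2.
  have -> : (e + v i / e) / 2 = Ex P (fun w => (e + e^-1 * xi i w ^+ 2) * 2^-1).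
    under [RHS]eq_Ex do rewrite mulrC.
    rewrite ExZ ?ExD ?ExZ ?Ex_cst //; try exact: brv_cst; try (by apply: brvX); try (by apply: brvZ; apply: brvX).
      by rewrite -/(v i); ring.
    by apply: brvD; [exact: brv_cst|apply: brvZ; apply: brvX].
  apply: Ex_le; [exact: brv_norm| |].
    by apply: brvM; [apply: brvD; [exact: brv_cst|apply: brvZ; exact: brvX]|exact: brv_cst].
  by move=> w; rewrite [e^-1 * _]mulrC; exact: abs_le.
(* The variance of [xi i ^+ 2] is nonnegative. This absorbs the [v i ^+ 2] that comes from [v i]
   times the first absolute moment. *)
have vk : v i ^+ 2 <= k i.
  have : 0 <= Ex P (fun w => (xi i w ^+ 2 - v i) ^+ 2) by apply: Ex_ge0 => w; exact: sqr_ge0.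
  have -> : Ex P (fun w => (xi i w ^+ 2 - v i) ^+ 2) =
      Ex P (fun w => xi i w ^+ 4 + ((- 2 * v i) * xi i w ^+ 2 + v i ^+ 2)).
    by apply: eq_Ex => w; ring.
  have b2 : bounded_rv (fun w => - 2 * v i * xi i w ^+ 2) by apply: brvZ; exact: brvX.
  rewrite ExD ?ExD ?ExZ ?Ex_cst //; try exact: brvX; try exact: brv_cst.
    by rewrite -/(v i) -/(k i); lra.
  by apply: brvD => //; exact: brv_cst.
set Efw := Ex P (fun w => f' (W w)) in B2 *.
set Efi := Ex P (fun w => f' (Wi i w)) in B1 B2.
set Exf := Ex P (fun w => xi i w * f (W w)) in B1 *.
have -> : v i * Efw - Exf = v i * (Efw - Efi) - (Exf - v i * Efi) by ring.
apply: le_trans (ler_normB _ _) _; rewrite normrM (ger0_norm (v0 i)).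
apply: (@le_trans _ _ (v i * (K * ((e + v i / e) / 2)) + K * ((e * v i + k i / e) / 2))).
  apply: lerD.
    by rewrite ler_wpM2l //; apply: le_trans B2 _; rewrite ler_wpM2l.
  by apply: le_trans B1 _; rewrite ler_wpM2l.
have -> : v i * (K * ((e + v i / e) / 2)) + K * ((e * v i + k i / e) / 2) =
  K * (e * v i + (v i ^+ 2 + k i) / 2 / e) by field; rewrite gt_eqF.
rewrite ler_wpM2l // lerD2l; apply: ler_wpM2r; first by rewrite invr_ge0 ltW.
by lra.
Qed.

End stein_clt.

(** * Gram determinants *)

Section orthogonal_triangularization.
Context (R : rcfType).

Definition sqnorm n (x : 'rV[R]_n) : R := (x *m x^T) 0 0.

Lemma sqnormE n (x : 'rV[R]_n) : sqnorm x = \sum_k x 0 k ^+ 2.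
Proof. by rewrite /sqnorm !mxE; apply: eq_bigr => k _; rewrite !mxE expr2. Qed.

Lemma sqnorm_ge0 n (x : 'rV[R]_n) : 0 <= sqnorm x.
Proof. by rewrite sqnormE sumr_ge0 // => k _; rewrite sqr_ge0. Qed.

Lemma sqnorm_eq0 n (x : 'rV[R]_n) : (sqnorm x == 0) = (x == 0).
Proof.
rewrite sqnormE psumr_eq0; last by move=> k _; rewrite sqr_ge0.
apply/allP/eqP => [x0|-> k _]; last by rewrite mxE expr0n eqxx implybT.
by apply/rowP => k; have /implyP := x0 k (mem_index_enum k);
  rewrite mxE sqrf_eq0 => /(_ isT)/eqP.
Qed.

Lemma sqnorm_gt0 n (x : 'rV[R]_n) : (0 < sqnorm x) = (x != 0).
Proof. by rewrite lt0r sqnorm_ge0 andbT sqnorm_eq0. Qed.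

Lemma sqnorm_orthogonal n (x : 'rV[R]_n) (O : 'M[R]_n) :
  O *m O^T = 1%:M -> sqnorm (x *m O) = sqnorm x.
Proof. by move=> OO; rewrite /sqnorm trmx_mul mulmxA -(mulmxA x) OO mulmx1. Qed.

(* The reflection exchanging y and |y| e_0. *)
Lemma householder n (y : 'rV[R]_n.+1) : exists O : 'M[R]_n.+1,
  O^T *m O = 1%:M /\ y *m O = Num.sqrt (sqnorm y) *: delta_mx 0 0.
Proof.
pose e : 'rV[R]_n.+1 := Num.sqrt (sqnorm y) *: delta_mx 0 0.
have ee : sqnorm e = sqnorm y.
  rewrite sqnormE (bigD1 0) //= big1 => [|k k0].
    by rewrite !mxE !eqxx mulr1 addr0 sqr_sqrtr // sqnorm_ge0.
  by rewrite !mxE (negbTE k0) andbF mulr0 expr0n.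
have [ye|yve] := eqVneq y e; first by exists 1%:M; rewrite trmx1 !mulmx1.
have [v vE] : exists v, v = y - e by exists (y - e).
have v0 : sqnorm v != 0 by rewrite sqnorm_eq0 vE subr_eq0.
have scal (a b : 'rV[R]_n.+1) : a *m b^T = ((a *m b^T) 0 0)%:M by exact: mx11_scalar.
(* Since [e] and [y] have equal norms, the component of [y] along [v] is [v / 2], so the reflection
   takes [y] to [y - v = e]. *)
have yv : (y *m v^T) 0 0 = sqnorm v / 2.
  have dBl (a b c : 'rV[R]_n.+1) :
      ((a - b) *m c^T) 0 0 = (a *m c^T) 0 0 - (b *m c^T) 0 0.
    by rewrite mulmxBl mxE [X in _ + X]mxE.
  have dC (a b : 'rV[R]_n.+1) : (a *m b^T) 0 0 = (b *m a^T) 0 0.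
    by rewrite -[in LHS](trmxK a) -trmx_mul mxE.
  have dBr (a b c : 'rV[R]_n.+1) :
      (c *m (a - b)^T) 0 0 = (c *m a^T) 0 0 - (c *m b^T) 0 0.
    by rewrite [LHS]dC dBl; congr (_ - _); exact: dC.
  have -> : sqnorm v = sqnorm y - (y *m e^T) 0 0 - (y *m e^T) 0 0 + sqnorm e.
    by rewrite /sqnorm vE dBl !dBr (dC e y); ring.
  by rewrite [in LHS]vE dBr ee -/(sqnorm y); field.
exists (1%:M - (2 / sqnorm v) *: (v^T *m v)); split.
  have -> : (1%:M - (2 / sqnorm v) *: (v^T *m v))^T = 1%:M - (2 / sqnorm v) *: (v^T *m v).
    have : (v^T *m v)^T = v^T *m v by rewrite trmx_mul trmxK.
    move: (v^T *m v) => V VV; apply/matrixP => i j.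
    by rewrite -{2}VV !mxE eq_sym.
  rewrite mulmxBl mul1mx mulmxBr mulmx1 -scalemxAl -scalemxAr.
  have -> : v^T *m v *m (v^T *m v) = sqnorm v *: (v^T *m v).
    by rewrite !mulmxA -(mulmxA v^T) scal -/(sqnorm v) mul_mx_scalar scalemxAl.
  move: (v^T *m v) => V; apply/matrixP => i j; rewrite !mxE.
  by move: v0; move: (sqnorm v) => r r0; field.
rewrite mulmxBr mulmx1 -scalemxAr mulmxA scal yv mul_scalar_mx scalerA.
have -> : 2 / sqnorm v * (sqnorm v / 2) = 1 by field.
by rewrite scale1r vE opprB addrC subrK.
Qed.

Lemma qr_exists m n (U : 'M[R]_(m, n)) : exists O : 'M[R]_n,
  O^T *m O = 1%:M /\ forall (a : 'I_m) (b : 'I_n), (a < b)%N -> (U *m O) a b = 0.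
Proof.
elim: m n U => [|m IH] n U; first by exists 1%:M; rewrite trmx1 mulmx1; split => // -[].
case: n U => [|n] U; first by exists 1%:M; rewrite trmx1 mulmx1; split => // a [].
have [Q [QQ Qy]] := householder (row 0 U).
pose U' : 'M[R]_(m, n) := \matrix_(i, j) (U *m Q) (lift 0 i) (lift 0 j).
have [ O' [OO' OU']] := IH n U'.
pose B0 : 'M[R]_(1 + n) := block_mx (1%:M : 'M[R]_1) 0 0 O'.
have BB0 : B0^T *m B0 = 1%:M.
  rewrite /B0 tr_block_mx mulmx_block !trmx0 !mul0mx !mulmx0 !addr0 add0r OO' trmx1 mulmx1.
  by rewrite -scalar_mx_block.
pose B : 'M[R]_n.+1 := B0.
have BB : B^T *m B = 1%:M := BB0.
exists (Q *m B); split.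
  by rewrite trmx_mul mulmxA -(mulmxA B^T) QQ mulmx1.
move=> a b; have [b' ->|->] := unliftP 0 b; last by [].
have BE c : B c (lift 0 b') = if unlift 0 c is Some c' then O' c' b' else 0.
  rewrite /B /B0; have [c' ->|->] := unliftP 0 c.
    by rewrite -!rshift1; exact: (block_mxEdr (1%:M : 'M[R]_1) 0 0 O' c' b').
  have e0 : (0 : 'I_n.+1) = lshift n (0 : 'I_1) by apply/val_inj.
  have eb : lift 0 b' = rshift 1 b' by rewrite rshift1.
  rewrite eb e0; apply: etrans (block_mxEur (1%:M : 'M[R]_1) 0 0 O' 0 b') _.
  by rewrite mxE.
move=> ab; rewrite mulmxA mxE big_ord_recl BE unlift_none mulr0 add0r.
under eq_bigr do rewrite BE liftK.
have [a' aE|aE] := unliftP 0 a; last first.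
  rewrite big1 // => c _; suff -> : (U *m Q) a (lift 0 c) = 0 by rewrite mul0r.
  have := congr1 (fun M : 'rV_n.+1 => M 0 (lift 0 c)) Qy.
  by rewrite -row_mul !mxE /= mulr0 aE.
have ab' : (a' < b')%N by move: ab; rewrite aE.
rewrite -[RHS](OU' a' b' ab') [RHS]mxE.
by apply: eq_bigr => c _; rewrite [in RHS]mxE aE.
Qed.

End orthogonal_triangularization.

Section gram_determinant.
Context (R : rcfType) (n : nat).

(** The newest vector goes on top, so that adding one is a [col_mx] and the Gram matrix grows by a
    block. The resulting reversal of the rows does not affect the Gram determinant. *)
Fixpoint stack (u : nat -> 'rV[R]_n) j : 'M[R]_(j, n) :=
  if j is j'.+1 then col_mx (u j') (stack u j') : 'M[R]_(1 + j', n) else 0.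

Definition gram (u : nat -> 'rV[R]_n) j : R := \det (stack u j *m (stack u j)^T).

Lemma stackE u j (a : 'I_j) : row a (stack u j) = u (j - a.+1)%N.
Proof.
elim: j a => [[]//|j IH a].
have [a' ->|->] := unliftP 0 a.
  have E1 : row (rshift 1 a') (col_mx (u j) (stack u j)) = row a' (stack u j).
    by rewrite rowKd.
  transitivity (row a' (stack u j)); first by rewrite -rshift1; exact: E1.
  by rewrite IH; congr u; rewrite /= /bump /=; lia.
have e0 : (0 : 'I_j.+1) = lshift j (0 : 'I_1) by apply/val_inj.
have E1 : row (lshift j 0) (col_mx (u j) (stack u j)) = row 0 (u j) by rewrite rowKu.
transitivity (row 0 (u j)); first by rewrite [in LHS]e0; exact: E1.
by rewrite row_id subSS subn0.
Qed.

Lemma eq_stack u v j : (forall i, (i < j)%N -> u i = v i) -> stack u j = stack v j.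
Proof.
elim: j => //= j IH uv; rewrite uv // IH // => i ij; apply: uv; exact: ltnW.
Qed.

Lemma eq_gram u v j : (forall i, (i < j)%N -> u i = v i) -> gram u j = gram v j.
Proof. by move=> /eq_stack uv; rewrite /gram uv. Qed.

(** [O] makes the stack lower triangular, hence supported on the first [j] coordinates, which its
    rows span because the determinant is nonzero. The first [j] coordinates of [y *m O] are cleared
    by row operations; the others are orthogonal to the stack. That [O] does not depend on [y] is
    what later gives each distance a law independent of the past. *)
Lemma gram_step (u : nat -> 'rV[R]_n) j : gram u j != 0 ->
  exists O : 'M[R]_n, O^T *m O = 1%:M /\
  forall y : 'rV[R]_n, \det (col_mx y (stack u j) *m (col_mx y (stack u j))^T) =
    gram u j * \sum_(k < n | (j <= k)%N) (y *m O) 0 k ^+ 2.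
Proof.
move=> g0; have [ O [OO OU]] := qr_exists (stack u j).
exists O; split => // y.
have OOt : O *m O^T = 1%:M by apply: mulmx1C.
have orth m1 m2 (A : 'M[R]_(m1, n)) (B : 'M[R]_(m2, n)) : A *m B^T = (A *m O) *m (B *m O)^T.
  by rewrite trmx_mul mulmxA -(mulmxA A) OOt mulmx1.
rewrite /gram (orth _ _ (stack u j) (stack u j)) in g0 *.
rewrite (orth _ _ (col_mx y (stack u j)) (col_mx y (stack u j))) mul_col_mx.
set L := stack u j *m O in g0 OU *; set y' := y *m O.
have Lk a (k : 'I_n) : (j <= k)%N -> L a k = 0.
  by move=> jk; apply: OU; apply: leq_trans (ltn_ord a) jk.
pose D : 'M[R]_n := pid_mx j.
have yD (x : 'rV[R]_n) k : (x *m D) 0 k = if (k < j)%N then x 0 k else 0.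
  rewrite mxE (bigD1 k) //= big1 ?addr0 => [|l lk].
    by rewrite !mxE eqxx /=; case: ifP => _; rewrite ?mulr1 ?mulr0.
  by rewrite !mxE -val_eqE in lk *; rewrite (negbTE lk) mulr0.
have LD : L *m D = L.
  apply/row_matrixP => a; rewrite row_mul; apply/rowP => k; rewrite yD mxE.
  by case: ltnP => // jk; rewrite Lk.
have rL : \rank L = j.
  apply/eqP; rewrite eqn_leq rank_leq_row /=.
  have : row_free (L *m L^T) by rewrite row_free_unit unitmxE unitfE.
  by rewrite /row_free => /eqP {1}<-; exact: mxrankM_maxl.
have jn : (j <= n)%N by rewrite -[X in (X <= _)%N]rL rank_leq_col.
have DL : (D <= L)%MS.
  have LsD : (L <= D)%MS by rewrite -LD submxMl.
  have [_ /esym] := mxrank_leqif_eq LsD.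
  by rewrite rL rank_pid_mx // eqxx => /eqmxP ->.
have /submxP[c cE] : (y' *m D <= L)%MS by rewrite (submx_trans (submxMl _ _)).
pose y2 := y' - y' *m D.
have y2E k : y2 0 k = if (j <= k)%N then y' 0 k else 0.
  by rewrite mxE [X in _ + X]mxE yD; case: ltnP => _; rewrite ?subrr ?subr0.
have y2D : y2 + y' *m D = y' by rewrite /y2 subrK.
clearbody y2.
have y2L : y2 *m L^T = 0.
  apply/rowP => a; rewrite mxE [RHS]mxE big1 // => k _; rewrite y2E [X in _ * X]mxE.
  by case: leqP => jk; rewrite ?mul0r // Lk ?mulr0.
have -> : col_mx y' L = block_mx (1%:M : 'M[R]_1) c 0 1%:M *m col_mx y2 L.
  by rewrite mul_block_col !mul1mx mul0mx add0r -cE y2D.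
rewrite trmx_mul !mulmxA -(mulmxA (block_mx _ _ _ _)) !det_mulmx det_tr.
rewrite det_ublock !det1 !mul1r mulr1 tr_col_mx mul_col_row y2L.
rewrite -[L *m y2^T]trmxK trmx_mul trmxK y2L trmx0 det_lblock mulrC; congr (_ * _).
rewrite det_mx11 -/(sqnorm y2) sqnormE [RHS]big_mkcond; apply: eq_bigr => k _.
by rewrite y2E; case: ifP => _ //; rewrite expr0n.
Qed.

End gram_determinant.

(** * Log-determinants of positive definite matrices *)

Section positive_definite.
Context (R : realType).

Definition qform n (B : 'M[R]_n) (x : 'rV[R]_n) : R := (x *m B *m x^T) 0 0.

Definition posdef n (B : 'M[R]_n) :=
  B^T = B /\ forall x : 'rV[R]_n, x != 0 -> 0 < qform B x.

(** Induction through the Schur complement [S]: the determinant is [b * \det S], the trace can only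
    decrease from [B'] to [S], and [ln b <= b - 1]. *)
Lemma posdef_det n (B : 'M[R]_n) : posdef B ->
  0 < \det B /\ ln (\det B) <= \tr B - n%:R.
Proof.
elim: n B => [|n IH] B.
  by move=> _; rewrite det_mx00 ltr01 ln1 /mxtrace big_ord0 subrr.
move: B; rewrite -[n.+1]/(1 + n)%N => B [Bsym Bpos].
pose b := B 0 0; pose c : 'rV[R]_n := ursubmx B; pose B' : 'M[R]_n := drsubmx B.
have bE : ulsubmx B = b%:M.
  rewrite [LHS]mx11_scalar; congr (_%:M); rewrite !mxE /b; congr (B _ _); exact: val_inj.
have cE : dlsubmx B = c^T by rewrite /c trmx_ursub Bsym.
have BE : B = block_mx b%:M c c^T B' by rewrite -bE -cE submxK.
have B's : B'^T = B' by rewrite /B' trmx_drsub Bsym.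
have b0 : 0 < b.
  have := Bpos (row_mx (1%:M : 'M[R]_1) 0).
  rewrite /qform BE mul_row_block !mul1mx !mul0mx !addr0 tr_row_mx mul_row_col.
  rewrite trmx0 mulmx0 addr0 trmx1 mulmx1 mxE eqxx mulr1n; apply; apply/eqP => /matrixP/(_ 0 (lshift n 0)).
  by rewrite row_mxEl !mxE eqxx => /eqP; rewrite oner_eq0.
pose S : 'M[R]_n := B' - b^-1 *: (c^T *m c).
have Ssym : S^T = S.
  by rewrite /S linearB /= linearZ /= trmx_mul trmxK B's.
have SE : B = block_mx 1%:M 0 (b^-1 *: c^T) 1%:M *m block_mx b%:M c 0 S.
  rewrite mulmx_block !mul1mx !mul0mx !addr0 BE; congr block_mx.
    by rewrite -scalemxAl mul_mx_scalar scalerA mulVf ?gt_eqF // scale1r.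
  by rewrite -scalemxAl /S addrC subrK.
have Spos z : z != 0 -> 0 < qform S z.
  move=> z0; pose x : 'rV[R]_(1 + n) := row_mx (- b^-1 *: (z *m c^T)) z.
  have -> : qform S z = qform B x.
    rewrite /qform; congr (fun_of_matrix _ 0 0).
    have xE : x *m block_mx 1%:M 0 (b^-1 *: c^T) 1%:M = row_mx 0 z.
      rewrite mul_row_block !mulmx1 mulmx0 add0r -scalemxAr.
      by rewrite scaleNr addNr.
    rewrite SE mulmxA xE mul_row_block !mul0mx mulmx0 !add0r tr_row_mx mul_row_col.
    by rewrite mul0mx add0r.
  apply: Bpos; apply/eqP => x0; move/eqP: z0; apply.
  by rewrite -[LHS](@row_mxKr _ 1 1 n (- b^-1 *: (z *m c^T))) -/x x0 linear0.
have [S0 Sle] := IH S (conj Ssym Spos).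
have detB : \det B = b * \det S.
  by rewrite SE det_mulmx det_lblock det_ublock !det1 !mul1r det_scalar expr1.
split; first by rewrite detB mulr_gt0.
rewrite detB lnM ?posrE //.
have -> : \tr B = b + \tr B'.
  by rewrite BE mxtrace_block mxtrace_scalar mulr1n.
have trS : \tr S <= \tr B'.
  rewrite /S linearB /= linearZ /= gerBl mulr_ge0 ?invr_ge0 ?(ltW b0) //.
  rewrite mxtrace_mulC /mxtrace big_ord1 -/(sqnorm c); exact: sqnorm_ge0.
have lnb : ln b <= b - 1.
  have := @le_ln1Dx R (b - 1); have -> : 1 + (b - 1) = b by ring.
  by apply; lra.
rewrite -[(1 + n)%N]/n.+1 -natr1; lra.
Qed.

Lemma posdef_unit n (B : 'M[R]_n) : posdef B -> B \in unitmx.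
Proof. by move=> /posdef_det[B0 _]; rewrite unitmxE unitfE gt_eqF. Qed.

Lemma posdef_inv n (B : 'M[R]_n) : posdef B -> posdef (invmx B).
Proof.
move=> pB; have Bu := posdef_unit pB; have [Bs Bp] := pB.
have Bis : (invmx B)^T = invmx B by rewrite trmx_inv Bs.
split => // x x0.
have -> : qform (invmx B) x = qform B (x *m invmx B).
  by rewrite /qform trmx_mul Bis (mulmxKV Bu) mulmxA.
apply: Bp; apply: contra x0 => /eqP x0.
by rewrite -(mulmxKV Bu x) x0 mul0mx.
Qed.

Lemma qform_inv_le n (B : 'M[R]_n) (x : 'rV[R]_n) : posdef B ->
  (forall y : 'rV[R]_n, sqnorm y / 2 <= qform B y) ->
  qform (invmx B) x <= 2 * sqnorm x.
Proof.
move=> pB Bge; have Bu := posdef_unit pB; have [Bs _] := pB.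
have Bis : (invmx B)^T = invmx B by rewrite trmx_inv Bs.
pose y := x *m invmx B.
have qE : qform (invmx B) x = qform B y.
  by rewrite /qform /y trmx_mul Bis (mulmxKV Bu) mulmxA.
have yx : qform (invmx B) x = (y *m x^T) 0 0 by [].
have Hy := Bge y.
(* The pairing of [y] and [x] equals both [qform (invmx B) x] and [qform B y]; expanding this square
   produces the factor [2]. *)
have H : 0 <= sqnorm (x - 2^-1 *: y) by exact: sqnorm_ge0.
have e1 : sqnorm (x - 2^-1 *: y) =
    sqnorm x - (y *m x^T) 0 0 + sqnorm y / 4.
  rewrite !sqnormE [(y *m _) 0 0]mxE -sumrB mulr_suml -big_split /=.
  by apply: eq_bigr => k _; rewrite !mxE; field.
by rewrite e1 in H; rewrite yx in qE *; lra.
Qed.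

Lemma ln_det_perturb p (K : 'M[R]_p) : K^T = K ->
  (forall y : 'rV[R]_p, sqnorm y / 2 <= qform (1%:M + K) y) ->
  0 < \det (1%:M + K) /\
  `|ln (\det (1%:M + K)) - \tr K| <= 2 * \sum_a sqnorm (row a K).
Proof.
move=> Ks Kge; set B := 1%:M + K.
have pB : posdef B.
  split; first by rewrite /B linearD /= trmx1 Ks.
  by move=> x x0; apply: lt_le_trans (Kge x); rewrite divr_gt0 // sqnorm_gt0.
have Bu := posdef_unit pB.
have [B0 Ble] := posdef_det pB.
have [Bi0 Bile] := posdef_det (posdef_inv pB).
split => //.
have trB : \tr B = p%:R + \tr K by rewrite /B linearD /= mxtrace1.
have BiE : invmx B = 1%:M - K + K *m invmx B *m K.
  have KB : B *m K = K *m B by rewrite /B mulmxDl mulmxDr mul1mx mulmx1.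
  rewrite -[RHS](mulKmx Bu) -[LHS]mulmx1; congr (_ *m _); rewrite mulmxDr !mulmxA KB.
  rewrite (mulmxK Bu) mulmxBr mulmx1 /B mulmxDl mul1mx.
  by move: (K *m K) => K2; apply/matrixP => i j; rewrite !mxE; ring.
have trBi : \tr (invmx B) = p%:R - \tr K + \tr (K *m invmx B *m K).
  by rewrite {1}BiE linearD /= linearB /= mxtrace1.
have trKBK : \tr (K *m invmx B *m K) <= 2 * \sum_a sqnorm (row a K).
  rewrite mulr_sumr; apply: ler_sum => a _.
  have -> : (K *m invmx B *m K) a a = qform (invmx B) (row a K).
    by rewrite /qform -row_mul -[in LHS]Ks [LHS]mxE [RHS]mxE; apply: eq_bigr => j _; rewrite !mxE Ks.
  exact: qform_inv_le.
rewrite det_inv lnV ?posrE // in Bile.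
rewrite ler_norml; apply/andP; split; first lra.
apply: (@le_trans _ _ 0); first lra.
by rewrite mulr_ge0 // sumr_ge0 // => a _; exact: sqnorm_ge0.
Qed.

End positive_definite.

Section row_projection.
Context (R : realType) (p n : nat).
Implicit Types (U : 'M[R]_(p, n)) (d : 'I_n -> R).

Definition rowproj U : 'M[R]_n := U^T *m invmx (U *m U^T) *m U.

Lemma gram_sym U : (U *m U^T)^T = U *m U^T.
Proof. by rewrite trmx_mul trmxK. Qed.

Lemma rowproj_sym U : (rowproj U)^T = rowproj U.
Proof. by rewrite /rowproj !trmx_mul trmxK trmx_inv gram_sym mulmxA. Qed.

Lemma rowprojC U k l : rowproj U k l = rowproj U l k.
Proof.
have trE (M : 'M[R]_n) : M^T l k = M k l by rewrite mxE.
by rewrite -[LHS]trE rowproj_sym.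
Qed.

Lemma rowproj_idem U : \det (U *m U^T) != 0 -> rowproj U *m rowproj U = rowproj U.
Proof.
move=> g0; have gu : U *m U^T \in unitmx by rewrite unitmxE unitfE.
by rewrite /rowproj -!mulmxA (mulmxA U) (mulKmx gu).
Qed.

Lemma rowproj_diag U k : \det (U *m U^T) != 0 ->
  rowproj U k k = \sum_l rowproj U k l ^+ 2.
Proof.
move=> g0; rewrite -{1}(rowproj_idem g0) mxE; apply: eq_bigr => l _.
by rewrite [X in _ * X]rowprojC expr2.
Qed.

Lemma rowproj_diag01 U k : \det (U *m U^T) != 0 -> 0 <= rowproj U k k <= 1.
Proof.
move=> g0; have E := rowproj_diag k g0.
have Q0 : 0 <= rowproj U k k by rewrite E sumr_ge0 // => l _; rewrite sqr_ge0.
rewrite Q0 /= leNgt; apply/negP => Q1.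
have : rowproj U k k ^+ 2 <= rowproj U k k.
  by rewrite [leRHS]E (bigD1 k) //= lerDl sumr_ge0 // => l _; rewrite sqr_ge0.
by rewrite expr2 => H; nra.
Qed.

Lemma rowproj_orthogonal U (O : 'M[R]_n) : O *m O^T = 1%:M ->
  rowproj (U *m O) = O^T *m rowproj U *m O.
Proof.
move=> OO; rewrite /rowproj trmx_mul.
have -> : U *m O *m (O^T *m U^T) = U *m U^T.
  by rewrite mulmxA -(mulmxA U) OO mulmx1.
by rewrite !mulmxA.
Qed.

(* With U = L E, L invertible and E having orthonormal rows, the quotient of
   the two Gram determinants is det (1 + E D E^T), whose logarithm is linearised
   by ln_det_perturb. *)
Lemma ln_det_weighted U d (m : R) : \det (U *m U^T) != 0 -> 0 < m ->
  (forall k, `|d k| <= 2^-1) ->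
  let W := U *m diag_mx (\row_k (m * (1 + d k))) *m U^T in
  [/\ 0 < \det (U *m U^T), 0 < \det W &
  `|ln (\det W) -
    (p%:R * ln m + ln (\det (U *m U^T)) + \sum_k d k * rowproj U k k)|
  <= 2 * \sum_k d k ^+ 2].
Proof.
move=> g0 m0 d2 W.
have [ O [OO OU]] := qr_exists U.
have OOt : O *m O^T = 1%:M by exact: mulmx1C.
have pn : (p <= n)%N.
  rewrite leqNgt; apply/negP => np; move/eqP: g0; apply.
  apply/eqP; rewrite -[_ == 0]negbK -unitfE -unitmxE -row_free_unit /row_free.
  by rewrite neq_ltn (leq_ltn_trans (mxrankM_maxl _ _)) // (leq_ltn_trans (rank_leq_col _)).
(* Only the first [p] columns of [U *m O] can be nonzero; [L] keeps them and [E] consists of the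
   first [p] rows of [O^T]. *)
pose L : 'M[R]_p := (U *m O) *m (pid_mx p : 'M[R]_(n, p)).
pose E : 'M[R]_(p, n) := (pid_mx p : 'M[R]_(p, n)) *m O^T.
have UE : U = L *m E.
  have UD : (U *m O) *m (pid_mx p : 'M[R]_n) = U *m O.
    apply/matrixP => a k; rewrite mxE (bigD1 k) //= big1 ?addr0 => [|l lk].
      rewrite [X in _ * X]mxE eqxx /=; case: ltnP => pk; rewrite ?mulr1 //.
      by rewrite mulr0 OU // (leq_trans (ltn_ord a)).
    by rewrite [X in _ * X]mxE; rewrite -val_eqE in lk; rewrite (negbTE lk) mulr0.
  rewrite /L /E mulmxA -(mulmxA (U *m O)) mul_pid_mx !minnn UD.
  by rewrite -mulmxA OOt mulmx1.
have EE : E *m E^T = 1%:M.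
  rewrite /E trmx_mul trmxK mulmxA -(mulmxA (pid_mx p)) OO mulmx1 tr_pid_mx.
  by rewrite mul_pid_mx minnn (minn_idPr pn) pid_mx_1.
clearbody E L.
have GL : U *m U^T = L *m L^T.
  by rewrite UE trmx_mul mulmxA -(mulmxA L) EE mulmx1.
have L0 : \det L != 0.
  by apply: contra g0 => /eqP L0; rewrite GL det_mulmx L0 mul0r.
have Lu : L \in unitmx by rewrite unitmxE unitfE.
have G0 : 0 < \det (U *m U^T).
  by rewrite GL det_mulmx det_tr -expr2 lt0r sqr_ge0 andbT sqrf_eq0.
have QE : rowproj U = E^T *m E.
  rewrite /rowproj GL UE trmx_mul.
  have Ltu : L^T \in unitmx by rewrite unitmx_tr.
  have -> : invmx (L *m L^T) = invmx L^T *m invmx L.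
    by rewrite -[LHS]mul1mx -(mulVmx Ltu) -[X in invmx _ *m X]mul1mx -(mulVmx Lu)
      !mulmxA -(mulmxA _ L) (mulmxK _) // unitmx_mul Lu.
  by rewrite !mulmxA (mulmxK Ltu) -(mulmxA _ (invmx L)) (mulVmx Lu) mulmx1.
pose D : 'M[R]_n := diag_mx (\row_k d k).
pose K := E *m D *m E^T.
have Ks : K^T = K by rewrite /K !trmx_mul trmxK tr_diag_mx mulmxA.
have q1 y : qform (1%:M + K) y = \sum_k (1 + d k) * (y *m E) 0 k ^+ 2.
  have -> : 1%:M + K = E *m (diag_mx (\row_k (1 + d k))) *m E^T.
    have -> : diag_mx (\row_k (1 + d k)) = 1%:M + D.
      by apply/matrixP => i j; rewrite !mxE -mulrnDl.
    by rewrite mulmxDr mulmxDl mulmx1 EE.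
  rewrite /qform !mulmxA -mulmxA -trmx_mul mxE; apply: eq_bigr => k _.
  by rewrite mul_mx_diag !mxE; ring.
have q2 (y : 'rV[R]_p) : sqnorm y = \sum_k (y *m E) 0 k ^+ 2.
  by rewrite -sqnormE /sqnorm trmx_mul mulmxA -(mulmxA y) EE mulmx1.
have Kge (y : 'rV[R]_p) : sqnorm y / 2 <= qform (1%:M + K) y.
  rewrite q1 q2 mulr_suml; apply: ler_sum => k _; rewrite mulrC.
  apply: ler_wpM2r; first exact: sqr_ge0.
  by have := d2 k; rewrite ler_norml => /andP[]; lra.
have [B0 BK] := ln_det_perturb Ks Kge.
have WE : W = m *: (L *m (1%:M + K) *m L^T).
  rewrite /W {1 2}UE trmx_mul.
  have -> : diag_mx (\row_k (m * (1 + d k))) = m *: (1%:M + D).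
    by apply/matrixP => i j; rewrite !mxE -mulrnDl mulrnAr.
  rewrite -!scalemxAr -!scalemxAl; congr (_ *: _).
  by rewrite !mulmxA; congr (_ *m _); rewrite -!mulmxA; congr (_ *m _);
    rewrite mulmxDl mul1mx mulmxDr EE /K mulmxA.
have detW : \det W = m ^+ p * (\det (U *m U^T) * \det (1%:M + K)).
  by rewrite WE detZ !det_mulmx GL det_mulmx !det_tr; ring.
have W0 : 0 < \det W by rewrite detW !mulr_gt0 // exprn_gt0.
split => //.
have trK : \tr K = \sum_k d k * rowproj U k k.
  rewrite /K -mulmxA mxtrace_mulC -mulmxA QE /mxtrace; apply: eq_bigr => k _.
  by rewrite mul_diag_mx !mxE.
have lnW : ln (\det W) = p%:R * ln m + ln (\det (U *m U^T)) + ln (\det (1%:M + K)).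
  rewrite detW lnM ?posrE ?exprn_gt0 ?mulr_gt0 // lnM ?posrE // lnXn //.
  by rewrite mulr_natl addrA.
rewrite lnW -trK opprD addrACA subrr add0r.
apply: le_trans BK _; rewrite ler_pM2l //.
have -> : \sum_a sqnorm (row a K) = \sum_k \sum_l d k * d l * rowproj U k l ^+ 2.
  transitivity (\tr (K *m K^T)).
    apply: eq_bigr => a _; rewrite sqnormE mxE; apply: eq_bigr => b _.
    by rewrite !mxE expr2.
  transitivity (\tr ((D *m rowproj U) *m (D *m rowproj U))).
    by rewrite QE Ks /K -!mulmxA mxtrace_mulC !mulmxA.
  apply: eq_bigr => k _; rewrite mxE; apply: eq_bigr => l _.
  have mulD (a b : 'I_n) : (D *m rowproj U) a b = d a * rowproj U a b.
    by rewrite /D mul_diag_mx mxE [X in X * _]mxE.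
  by rewrite !mulD (rowprojC U l k); ring.
(* Bound [d k * d l] by the half-sum of the squares. A row of a projection has squared norm equal to
   its diagonal entry, which is at most [1]. *)
have H : \sum_k \sum_l d k * d l * rowproj U k l ^+ 2 <=
    \sum_k \sum_l (d k ^+ 2 / 2 * rowproj U k l ^+ 2 + d l ^+ 2 / 2 * rowproj U l k ^+ 2).
  apply: ler_sum => k _; apply: ler_sum => l _.
  have -> : rowproj U l k = rowproj U k l by exact: rowprojC.
  rewrite -mulrDl; apply: ler_wpM2r; first exact: sqr_ge0.
  by have := sqr_ge0 (d k - d l); lra.
apply: le_trans H _.
under eq_bigr do rewrite big_split /=.
rewrite big_split /= [X in _ + X]exchange_big /= -big_split /=.
apply: ler_sum => k _.
rewrite -!mulr_sumr -rowproj_diag // -mulrDl.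
have -> : d k ^+ 2 / 2 + d k ^+ 2 / 2 = d k ^+ 2 by field.
by rewrite ler_piMr ?sqr_ge0 //; have /andP[] := rowproj_diag01 k g0.
Qed.

End row_projection.

(** * Diagonalisation of real symmetric matrices *)

Section real_spectral.
Context (R : realType).

Lemma char_poly_similar n (S B : 'M[R]_n) : S \in unitmx ->
  char_poly (invmx S *m B *m S) = char_poly B.
Proof.
move=> Su; rewrite /char_poly /char_poly_mx.
have -> : 'X%:M - map_mx (@polyC R) (invmx S *m B *m S) =
    map_mx (@polyC R) (invmx S) *m ('X%:M - map_mx (@polyC R) B) *m map_mx (@polyC R) S.
  rewrite mulmxBr mulmxBl -!map_mxM; congr (_ - _).
  by rewrite scalar_mxC -mulmxA -map_mxM mulVmx // map_mx1 mulmx1.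
rewrite !det_mulmx mulrAC -det_mulmx -map_mxM mulVmx // map_mx1 det1 mul1r //.
Qed.

(** The factorisation of the characteristic polynomial provides a real eigenvalue at every stage. A
    reflection carrying an eigenvector to a multiple of the first basis vector makes the symmetric
    matrix block diagonal, and cancelling one linear factor hands the factorisation on to the
    remaining block. *)
Lemma real_spectral n (B : 'M[R]_n) (lam : 'I_n -> R) : B^T = B ->
  char_poly B = \prod_(k < n) ('X - (lam k)%:P) ->
  exists O : 'M[R]_n, O^T *m O = 1%:M /\ B = O *m diag_mx (\row_k lam k) *m O^T.
Proof.
elim: n B lam => [|n IH] B lam Bs chB.
  by exists 1%:M; rewrite trmx1 mulmx1; split => //; apply/matrixP => -[].
have /eigenvalueP[v vB v0] : eigenvalue B (lam 0).
  by rewrite eigenvalue_root_char chB big_ord_recl rootM root_XsubC eqxx.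
have [Q [QQ Qv]] := householder v.
have QQt : Q *m Q^T = 1%:M by exact: mulmx1C.
set s := Num.sqrt (sqnorm v) in Qv.
have s0 : s != 0 by rewrite gt_eqF // sqrtr_gt0 sqnorm_gt0.
have [B1 B1D] : exists B1 : 'M[R]_(1 + n), B1 = Q^T *m B *m Q by eexists.
have B1s : B1^T = B1 by rewrite B1D !trmx_mul trmxK Bs mulmxA.
have eB1 : delta_mx 0 0 *m (Q^T *m B *m Q) = lam 0 *: (delta_mx 0 0 : 'rV[R]_n.+1).
  have -> : delta_mx 0 0 = s^-1 *: (v *m Q) by rewrite Qv scalerA mulVf // scale1r.
  rewrite -!scalemxAl !mulmxA -(mulmxA v) QQt mulmx1 vB -scalemxAl !scalerA.
  by congr (_ *: _); rewrite mulrC.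
have B1r j : B1 0 j = if j == 0 then lam 0 else 0.
  have := congr1 (fun M : 'rV[R]_n.+1 => M 0 j) eB1; rewrite -B1D -rowE mxE => ->.
  by rewrite !mxE eqxx eq_sym; case: eqP; rewrite ?mulr1 ?mulr0.
pose B' := drsubmx B1.
have B1E : B1 = block_mx (lam 0)%:M 0 0 B'.
  rewrite -[LHS]submxK; congr block_mx.
  - rewrite [LHS]mx11_scalar; congr (_%:M); rewrite !mxE.
    have -> : lshift n (0 : 'I_1) = 0 by exact: val_inj.
    by rewrite B1r eqxx.
  - apply/rowP => j; rewrite !mxE.
    have -> : lshift n (0 : 'I_1) = 0 by exact: val_inj.
    by rewrite B1r.
  - apply/colP => j; rewrite !mxE -B1s mxE.
    have -> : lshift n (0 : 'I_1) = 0 by exact: val_inj.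
    by rewrite B1r.
have B's : B'^T = B' by rewrite /B' trmx_drsub B1s.
have chB1 : char_poly B1 = char_poly B.
  have Qu : Q \in unitmx by have [] := mulmx1_unit QQt.
  rewrite B1D; have -> : Q^T = invmx Q by rewrite -[LHS]mulmx1 -(mulmxV Qu) mulmxA QQ mul1mx.
  exact: char_poly_similar.
have chB' : char_poly B' = \prod_(k < n) ('X - (lam (lift 0 k))%:P).
  have : char_poly B1 = ('X - (lam 0)%:P) * char_poly B'.
    rewrite /char_poly /char_poly_mx B1E (map_block_mx (@polyC R)) scalar_mx_block.
    rewrite opp_block_mx add_block_mx !map_mx0 !subr0 det_ublock; congr (_ * _).
    by rewrite map_scalar_mx det_mx11 !mxE eqxx !mulr1n.
  rewrite chB1 chB big_ord_recl => /mulfI H; apply/esym/H.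
  by rewrite polyXsubC_eq0.
have [ O' [OO' BO']] := IH B' (fun k => lam (lift 0 k)) B's chB'.
pose C : 'M[R]_(1 + n) := block_mx 1%:M 0 0 O'.
have CC : C^T *m C = 1%:M.
  rewrite /C tr_block_mx mulmx_block !trmx0 !mul0mx !mulmx0 !addr0 add0r OO' trmx1 mulmx1.
  by rewrite -scalar_mx_block.
have B1C : B1 = C *m (diag_mx (\row_k lam k) : 'M[R]_(1 + n)) *m C^T.
  have -> : (diag_mx (\row_k lam k) : 'M[R]_(1 + n)) =
      block_mx (lam 0)%:M 0 0 (diag_mx (\row_k lam (lift 0 k))).
    have rE : \row_k lam k = row_mx (lam 0)%:M (\row_k lam (lift 0 k)) :> 'rV[R]_(1 + n).
      apply/rowP => k; rewrite mxE; have [k' ->|->] := unliftP 0 k.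
        by rewrite -rshift1 row_mxEr mxE rshift1.
      have -> : (0 : 'I_n.+1) = lshift n (0 : 'I_1) by exact: val_inj.
      by rewrite row_mxEl mxE eqxx.
    transitivity (diag_mx (row_mx ((lam 0)%:M : 'rV[R]_1) (\row_k lam (lift 0 k)))).
      by rewrite -rE.
    rewrite diag_mx_row; congr (block_mx _ _ _ _).
    by apply/matrixP => i j; rewrite !ord1 !mxE !eqxx.
  rewrite /C tr_block_mx !mulmx_block !trmx0 !trmx1.
  rewrite !(mul0mx, mulmx0, mul1mx, mulmx1, addr0, add0r) -BO'.
  exact: B1E.
exists (Q *m (C : 'M[R]_n.+1)); split.
  by rewrite trmx_mul mulmxA -(mulmxA _ Q^T) QQ mulmx1; exact: CC.
rewrite trmx_mul !mulmxA -(mulmxA Q) -(mulmxA Q).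
have -> : (C : 'M[R]_n.+1) *m diag_mx (\row_k lam k) *m (C : 'M[R]_n.+1)^T = B1 by rewrite B1C.
by rewrite B1D !mulmxA QQt mul1mx -mulmxA QQt mulmx1.
Qed.

(** [A^T *m A], the matrix that occurs in the Gram matrix of the rows of [Y], is conjugate to
    [A *m A^T] by [A], so both have the same characteristic polynomial. *)
Lemma gram_spectral n (A : 'M[R]_n) (lam : 'I_n -> R) : A \in unitmx ->
  char_poly (A *m A^T) = \prod_(k < n) ('X - (lam k)%:P) ->
  exists O : 'M[R]_n, O^T *m O = 1%:M /\ A^T *m A = O *m diag_mx (\row_k lam k) *m O^T.
Proof.
move=> Au ch; apply: real_spectral; first by rewrite trmx_mul trmxK.
rewrite -ch -[RHS](char_poly_similar _ Au); congr char_poly.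
by rewrite mulmxA (mulVmx Au) mul1mx.
Qed.

End real_spectral.

(** * Moments on the sphere *)

Section same_law.
Context d (T : measurableType d) (R : realType) (P : probability T R).

Lemma Ex_same_law d1 (E1 : measurableType d1) (X Y : {mfun T >-> E1}) (g : E1 -> R) :
  (forall B, measurable B -> P (X @^-1` B) = P (Y @^-1` B)) ->
  measurable_fun setT g -> bounded_rv (fun w => g (X w)) ->
  bounded_rv (fun w => g (Y w)) ->
  Ex P (fun w => g (X w)) = Ex P (fun w => g (Y w)).
Proof.
move=> XY mg bX bY; rewrite !Ex_comp //.
by congr fine; apply: eq_measure_integral => A mA _; exact: XY.
Qed.

End same_law.

Section rotations.
Context (R : realType) (n : nat).

Definition rot (O : 'M[R]_n) (x : n.-tuple R) : n.-tuple R := unvec (O *m vec x).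

Lemma rotE O x i : tnth (rot O x) i = \sum_k O i k * tnth x k.
Proof. by rewrite /rot tnth_mktuple mxE; apply: eq_bigr => k _; rewrite mxE. Qed.

Lemma measurable_rot O : measurable_fun setT (rot O).
Proof.
apply/measurable_fun_tnthP => i.
have -> : (fun x => tnth x i) \o rot O = fun x => \sum_k O i k * tnth x k.
  by apply/funext => x /=; rewrite rotE.
by apply: measurable_sum => k; apply: measurable_funM => //; exact: measurable_tnth.
Qed.

Definition plane_rot (a b : 'I_n) (c s : R) : 'M[R]_n :=
  1%:M + ((c - 1) *: (delta_mx a a + delta_mx b b) +
          s *: (delta_mx b a - delta_mx a b)).

Lemma plane_rot_orthogonal a b c s : a != b -> c ^+ 2 + s ^+ 2 = 1 ->
  (plane_rot a b c s)^T *m plane_rot a b c s = 1%:M.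
Proof.
move=> ab cs; have ba : b != a by rewrite eq_sym.
(* [D] projects onto the plane of the coordinates [a] and [b], and [J] is the quarter turn in that
   plane: [J *m J = - D]. *)
rewrite /plane_rot; set D := delta_mx a a + _; set J := delta_mx b a - _.
have Dt : D^T = D by rewrite /D linearD /= !trmx_delta.
have Jt : J^T = - J by rewrite /J linearB /= !trmx_delta opprB.
have DD : D *m D = D.
  by rewrite /D mulmxDl !mulmxDr !mul_delta_mx !mul_delta_mx_0 // addr0 add0r.
have DJ : D *m J = J.
  rewrite /D /J mulmxDl !mulmxBr !mul_delta_mx !mul_delta_mx_0 //.
  by rewrite sub0r subr0 addrC.
have JD : J *m D = J.
  rewrite /D /J mulmxBl !mulmxDr !mul_delta_mx !mul_delta_mx_0 //.
  by rewrite addr0 add0r.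
have JJ : J *m J = - D.
  rewrite /D /J mulmxBl !mulmxBr !mul_delta_mx !mul_delta_mx_0 //.
  by rewrite sub0r subr0 opprD addrC.
have -> : (1%:M + ((c - 1) *: D + s *: J))^T = 1%:M + ((c - 1) *: D - s *: J).
  move: D J Dt Jt {DD DJ JD JJ} => D J Dt Jt; apply/matrixP => i j.
  have E1 : D j i = D i j by rewrite -[in LHS]Dt mxE.
  have E2 : J j i = - J i j by have := congr1 (fun M : 'M[R]_n => M i j) Jt; rewrite !mxE.
  by rewrite !mxE E1 E2 eq_sym; ring.
rewrite !(mulmxDl, mulmxDr, mulNmx, mulmxN, mul1mx, mulmx1) -!scalemxAl -!scalemxAr.
rewrite DD DJ JD JJ.
move: D J {Dt Jt DD DJ JD JJ} => D J.
apply/matrixP => i j; rewrite !mxE.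
suff : (c ^+ 2 + s ^+ 2 - 1) * D i j = 0 by move=> H; rewrite -[RHS]addr0 -H; ring.
by rewrite cs subrr mul0r.
Qed.

Lemma plane_rotE a b c s x i : a != b -> tnth (rot (plane_rot a b c s) x) i =
  if i == a then c * tnth x a - s * tnth x b
  else if i == b then s * tnth x a + c * tnth x b else tnth x i.
Proof.
move=> ab; have dE (k l : 'I_n) : \sum_j (delta_mx k l : 'M[R]_n) i j * tnth x j =
    (i == k)%:R * tnth x l.
  rewrite (bigD1 l) //= big1 ?addr0 ?mxE ?eqxx ?andbT // => j jl.
  by rewrite mxE (negbTE jl) andbF mul0r.
rewrite rotE.
transitivity (tnth x i + ((c - 1) * (\sum_j (delta_mx a a : 'M[R]_n) i j * tnth x j +
   \sum_j (delta_mx b b : 'M[R]_n) i j * tnth x j) +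
   s * (\sum_j (delta_mx b a : 'M[R]_n) i j * tnth x j -
    \sum_j (delta_mx a b : 'M[R]_n) i j * tnth x j))).
  have -> : tnth x i = \sum_j (i == j)%:R * tnth x j.
    rewrite (bigD1 i) //= big1 ?addr0 ?eqxx ?mul1r // => j ji.
    by rewrite eq_sym (negbTE ji) mul0r.
  rewrite -sumrB -big_split /= !mulr_sumr -!big_split /=.
  apply: eq_bigr => j _; rewrite /plane_rot.
  move: (delta_mx a a) (delta_mx b b) (delta_mx b a) (delta_mx a b) => D1 D2 D3 D4.
  by rewrite !mxE; ring.
rewrite !dE; have [->|ia] := eqVneq i a.
  by rewrite (negbTE ab) /= mulr1n mulr0n; ring.
by have [->|ib] := eqVneq i b; rewrite /= ?mulr1n mulr0n; ring.
Qed.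

End rotations.

Section sphere_moments.
Context d (T : measurableType d) (R : realType) (P : probability T R) (n : nat).
Context (u : {RV P >-> n.-tuple R}).
Hypothesis u_sphere : forall w, \sum_(k < n) tnth (u w) k ^+ 2 = 1.
Hypothesis u_rot : forall O : 'M[R]_n, O^T *m O = 1%:M ->
  forall B, measurable B -> P ((fun w => rot O (u w)) @^-1` B) = P (u @^-1` B).

Lemma Ex_rot (O : 'M[R]_n) (g : n.-tuple R -> R) : O^T *m O = 1%:M ->
  measurable_fun setT g -> bounded_rv (fun w => g (u w)) ->
  bounded_rv (fun w => g (rot O (u w))) ->
  Ex P (fun w => g (rot O (u w))) = Ex P (fun w => g (u w)).
Proof.
move=> OO mg bg bgO.
have [X XE] := mfun_of (measurableT_comp (measurable_rot O) (measurable_funPT u)).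
have XE' : (fun w => g (rot O (u w))) = fun w => g (X w) by rewrite XE.
rewrite XE' in bgO *; apply: Ex_same_law => // B mB.
by rewrite XE; exact: u_rot.
Qed.

Let x k w := tnth (u w) k.

Lemma sphere_coord_le1 k w : `|x k w| <= 1.
Proof.
have : x k w ^+ 2 <= 1.
  by rewrite -(u_sphere w) (bigD1 k) //= lerDl sumr_ge0 // => l _; exact: sqr_ge0.
by move=> H; rewrite ler_norml; apply/andP; split; nra.
Qed.

Lemma brv_coord k : bounded_rv (x k).
Proof.
split; last by exists 1 => w; exact: sphere_coord_le1.
exact: (measurableT_comp (measurable_tnth k)).
Qed.

Context (m : nat).

Definition tail_sq (y : n.-tuple R) : R := \sum_(k < n | (m <= k)%N) tnth y k ^+ 2.

Definition tail_dev w : R := tail_sq (u w) - (n - m)%:R / n%:R.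
Let D := tail_dev.

Lemma measurable_tail_sq : measurable_fun setT tail_sq.
Proof.
have -> : tail_sq = fun y => \sum_(k < n) (if (m <= k)%N then tnth y k ^+ 2 else 0).
  by apply/funext => y; rewrite /tail_sq big_mkcond.
apply: measurable_sum => k; case: (boolP (m <= k)%N) => // _.
by apply: measurable_funX; exact: measurable_tnth.
Qed.

Lemma brv_tail_sq : bounded_rv (fun w => tail_sq (u w)).
Proof.
apply: (@eq_brv _ _ _ _ (fun w => \sum_(k < n | (m <= k)%N) x k w ^+ 2)) => //.
by apply: brv_sum => k; apply: brvX; exact: brv_coord.
Qed.

Lemma brv_tail_dev : bounded_rv D.
Proof. by apply: brvB; [exact: brv_tail_sq|exact: brv_cst]. Qed.

Lemma tail_sq_rot (a b : 'I_n) (c s : R) y : (a < m <= b)%N -> c ^+ 2 + s ^+ 2 = 1 ->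
  tail_sq (rot (plane_rot a b c s) y) = tail_sq y +
    (s ^+ 2 * (tnth y a ^+ 2 - tnth y b ^+ 2) + 2 * (c * s) * (tnth y a * tnth y b)).
Proof.
move=> /andP[am mb] cs.
have ab : a != b by rewrite -val_eqE neq_ltn (leq_trans am mb).
rewrite /tail_sq (bigD1 b) //= [in RHS](bigD1 b) //= plane_rotE // eqxx.
rewrite eq_sym (negbTE ab).
have -> : \sum_(k < n | (m <= k)%N && (k != b)) tnth (rot (plane_rot a b c s) y) k ^+ 2 =
    \sum_(k < n | (m <= k)%N && (k != b)) tnth y k ^+ 2.
  apply: eq_bigr => k /andP[mk kb]; rewrite plane_rotE // (negbTE kb).
  by rewrite -val_eqE gtn_eqF // (leq_trans am).
move: (\sum_(k < n | _) _) => r.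
suff : (c ^+ 2 + s ^+ 2 - 1) * tnth y b ^+ 2 = 0.
  by move=> H; rewrite -[RHS]addr0 -H; ring.
by rewrite cs subrr mul0r.
Qed.

Let alpha a b w := x a w ^+ 2 - x b w ^+ 2.
Let beta a b w := (x a w * x b w) ^+ 2.

(** [s] is the squared sine of the angle. Averaging over opposite angles leaves only even powers of
    the square root, so the left side is a polynomial in [s]. It is constant on the unit interval,
    hence its other coefficients vanish; the identities below state this for the linear one. *)
Lemma Ex_tail_rot (a b : 'I_n) (s : R) k : (a < m <= b)%N -> 0 <= s <= 1 ->
  Ex P (fun w => ((D w + (s * alpha a b w + 2 * Num.sqrt (s * (1 - s)) * (x a w * x b w))) ^+ k +
   (D w + (s * alpha a b w - 2 * Num.sqrt (s * (1 - s)) * (x a w * x b w))) ^+ k) / 2)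
  = Ex P (fun w => D w ^+ k).
Proof.
move=> amb /andP[s0 s1].
have ab : a != b by have /andP[am mb] := amb; rewrite -val_eqE neq_ltn (leq_trans am mb).
pose c := Num.sqrt (1 - s).
have cE : c ^+ 2 = 1 - s by rewrite sqr_sqrtr // subr_ge0.
have H (t : R) : t ^+ 2 = s -> 
    Ex P (fun w => (D w + (s * alpha a b w + 2 * (c * t) * (x a w * x b w))) ^+ k) =
    Ex P (fun w => D w ^+ k).
  move=> tE; have cs : c ^+ 2 + t ^+ 2 = 1 by rewrite cE tE subrK.
  pose g y := (tail_sq y - (n - m)%:R / n%:R) ^+ k.
  have mg : measurable_fun setT g.
    by apply: measurable_funX; apply: measurable_funB => //; exact: measurable_tail_sq.
  have gE w : g (rot (plane_rot a b c t) (u w)) =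
      (D w + (s * alpha a b w + 2 * (c * t) * (x a w * x b w))) ^+ k.
    by rewrite /g tail_sq_rot // tE /D /tail_dev addrAC.
  rewrite -(@Ex_rot (plane_rot a b c t) g) //.
  - by apply: eq_Ex => w; rewrite gE.
  - exact: plane_rot_orthogonal.
  - by apply: brvX; exact: brv_tail_dev.
  - apply: (eq_brv gE); apply: brvX; apply: brvD; first exact: brv_tail_dev.
    by apply: brvD; apply: brvZ; [apply: brvB; apply: brvX|apply: brvM]; exact: brv_coord.
have sq : Num.sqrt (s * (1 - s)) = c * Num.sqrt s by rewrite sqrtrM // mulrC.
have H1 := H (Num.sqrt s) (sqr_sqrtr s0).
have H2 := H (- Num.sqrt s); rewrite sqrrN sqr_sqrtr // in H2.
have bT t : bounded_rv (fun w => (D w + (s * alpha a b w + 2 * (c * t) * (x a w * x b w))) ^+ k).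
  apply: brvX; apply: brvD; first exact: brv_tail_dev.
  by apply: brvD; apply: brvZ; [apply: brvB; apply: brvX|apply: brvM]; exact: brv_coord.
have -> : Ex P (fun w => D w ^+ k) = 2^-1 * (Ex P (fun w => D w ^+ k) + Ex P (fun w => D w ^+ k)).
  by field.
rewrite -{1}H1 -(H2 erefl) -ExD // -ExZ; last by apply: brvD.
apply: eq_Ex => w; rewrite sq mulrC; congr (_ * (_ ^+ _ + _ ^+ _)); ring.
Qed.

Let bx k : bounded_rv (x k). Proof. exact: brv_coord. Qed.
Let bD : bounded_rv D. Proof. exact: brv_tail_dev. Qed.
Let ba a b : bounded_rv (alpha a b).
Proof. by apply: brvB; exact: brvX. Qed.
Let bb a b : bounded_rv (beta a b).
Proof. by apply: brvX; exact: brvM. Qed.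

Lemma tail_identity1 (a b : 'I_n) : (a < m <= b)%N -> Ex P (alpha a b) = 0.
Proof.
move=> amb; have s1 : 0 <= (1 : R) <= 1 by lra.
have := Ex_tail_rot 1 amb s1.
rewrite (@eq_Ex _ _ _ _ _ (fun w => D w + alpha a b w)); last by move=> w; field.
have -> : Ex P (fun w => D w ^+ 1) = Ex P D by apply: eq_Ex => w; rewrite expr1.
by rewrite ExD //; lra.
Qed.

Lemma tail_identity2 (a b : 'I_n) : (a < m <= b)%N ->
  Ex P (fun w => 2 * (D w * alpha a b w) + 4 * beta a b w) = 0.
Proof.
move=> amb.
pose e1 := Ex P (fun w => 2 * (D w * alpha a b w) + 4 * beta a b w).
pose e2 := Ex P (fun w => alpha a b w ^+ 2 - 4 * beta a b w).
have b1 : bounded_rv (fun w => 2 * (D w * alpha a b w) + 4 * beta a b w).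
  by apply: brvD; apply: brvZ => //; exact: brvM.
have b2 : bounded_rv (fun w => alpha a b w ^+ 2 - 4 * beta a b w).
  by apply: brvB; [exact: brvX|exact: brvZ].
have H (s : R) : 0 <= s <= 1 -> s * e1 + s ^+ 2 * e2 = 0.
  move=> s01; have := Ex_tail_rot 2 amb s01.
  rewrite (@eq_Ex _ _ _ _ _ (fun w => D w ^+ 2 +
     (s * (2 * (D w * alpha a b w) + 4 * beta a b w) +
      s ^+ 2 * (alpha a b w ^+ 2 - 4 * beta a b w)))).
    rewrite ExD ?ExD ?ExZ //; try exact: brvX; try exact: brvZ.
      by rewrite -/e1 -/e2; lra.
    by apply: brvD; exact: brvZ.
  move=> w; rewrite /beta.
  have q2 : Num.sqrt (s * (1 - s)) ^+ 2 = s * (1 - s).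
    by rewrite sqr_sqrtr //; have /andP[? ?] := s01; rewrite mulr_ge0 // subr_ge0.
  move: (Num.sqrt _) q2 => q q2.
  transitivity ((D w + s * alpha a b w) ^+ 2 + 4 * q ^+ 2 * (x a w * x b w) ^+ 2); first by field.
  by rewrite q2; ring.
have h1 : 0 <= (1 : R) <= 1 by lra.
have h2 : 0 <= (1 / 2 : R) <= 1 by lra.
by have := H _ h1; have := H _ h2; rewrite -/e1; lra.
Qed.

Lemma tail_identity4 (a b : 'I_n) : (a < m <= b)%N ->
  Ex P (fun w => 4 * (D w ^+ 3 * alpha a b w) + 24 * (D w ^+ 2 * beta a b w)) = 0.
Proof.
move=> amb.
pose f1 w := 4 * (D w ^+ 3 * alpha a b w) + 24 * (D w ^+ 2 * beta a b w).
pose f2 w := 6 * (D w ^+ 2 * alpha a b w ^+ 2) +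
  24 * (beta a b w * (2 * (D w * alpha a b w) - D w ^+ 2)) + 16 * beta a b w ^+ 2.
pose f3 w := 4 * (D w * alpha a b w ^+ 3) +
  24 * (beta a b w * (alpha a b w ^+ 2 - 2 * (D w * alpha a b w))) - 32 * beta a b w ^+ 2.
pose f4 w := alpha a b w ^+ 4 - 24 * (beta a b w * alpha a b w ^+ 2) + 16 * beta a b w ^+ 2.
have b1 : bounded_rv f1.
  by apply: brvD; apply: brvZ; apply: brvM => //; apply: brvX.
have b2 : bounded_rv f2.
  apply: brvD; last by apply: brvZ; exact: brvX.
  apply: brvD; first by apply: brvZ; apply: brvM; apply: brvX.
  apply: brvZ; apply: brvM => //; apply: brvB; last exact: brvX.
  by apply: brvZ; exact: brvM.
have b3 : bounded_rv f3.
  apply: brvB; last by apply: brvZ; exact: brvX.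
  apply: brvD; first by apply: brvZ; apply: brvM => //; apply: brvX.
  apply: brvZ; apply: brvM => //; apply: brvB; first exact: brvX.
  by apply: brvZ; exact: brvM.
have b4 : bounded_rv f4.
  apply: brvD; last by apply: brvZ; exact: brvX.
  apply: brvB; first exact: brvX.
  by apply: brvZ; apply: brvM => //; exact: brvX.
have H (s : R) : 0 <= s <= 1 ->
    s * Ex P f1 + (s ^+ 2 * Ex P f2 + (s ^+ 3 * Ex P f3 + s ^+ 4 * Ex P f4)) = 0.
  move=> s01; have := Ex_tail_rot 4 amb s01.
  rewrite (@eq_Ex _ _ _ _ _ (fun w => D w ^+ 4 +
     (s * f1 w + (s ^+ 2 * f2 w + (s ^+ 3 * f3 w + s ^+ 4 * f4 w))))).
    have bZ4 : bounded_rv (fun w => s ^+ 4 * f4 w) by exact: brvZ.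
    have bZ3 : bounded_rv (fun w => s ^+ 3 * f3 w) by exact: brvZ.
    have bZ2 : bounded_rv (fun w => s ^+ 2 * f2 w) by exact: brvZ.
    have bZ1 : bounded_rv (fun w => s * f1 w) by exact: brvZ.
    have bS3 := brvD bZ3 bZ4; have bS2 := brvD bZ2 bS3; have bS1 := brvD bZ1 bS2.
    rewrite (ExD _ (brvX 4 bD) bS1) (ExD _ bZ1 bS2) (ExD _ bZ2 bS3) (ExD _ bZ3 bZ4).
    by rewrite !ExZ //; lra.
  move=> w; rewrite /f1 /f2 /f3 /f4 /beta.
  have q2 : Num.sqrt (s * (1 - s)) ^+ 2 = s * (1 - s).
    by rewrite sqr_sqrtr //; have /andP[? ?] := s01; rewrite mulr_ge0 // subr_ge0.
  move: (Num.sqrt _) q2 => q q2.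
  transitivity ((D w + s * alpha a b w) ^+ 4 +
    24 * (D w + s * alpha a b w) ^+ 2 * q ^+ 2 * (x a w * x b w) ^+ 2 +
    16 * (q ^+ 2) ^+ 2 * (x a w * x b w) ^+ 4); first by field.
  by rewrite q2; ring.
(* A quartic without constant term that vanishes at four nonzero points is zero. *)
have h1 : 0 <= (1 : R) <= 1 by lra.
have h2 : 0 <= (1 / 2 : R) <= 1 by lra.
have h3 : 0 <= (1 / 4 : R) <= 1 by lra.
have h4 : 0 <= (3 / 4 : R) <= 1 by lra.
have := H _ h1; have := H _ h2; have := H _ h3; have := H _ h4.
rewrite -/(Ex P f1); move: (Ex P f1) (Ex P f2) (Ex P f3) (Ex P f4) => e1 e2 e3 e4.
lra.
Qed.

Hypotheses (n0 : (0 < n)%N) (mn : (m <= n)%N).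
Let S w := tail_sq (u w).

Let sum_lo (c : R) : \sum_(k < n | (k < m)%N) c = m%:R * c.
Proof.
rewrite -(big_mkord (fun k => (k < m)%N) (fun=> c)).
by rewrite -(big_nat_widen 0 m n predT) // sumr_const_nat subn0 mulr_natl.
Qed.

Let sum_hi (c : R) : \sum_(k < n | (m <= k)%N) c = (n - m)%:R * c.
Proof.
rewrite -(big_mkord (fun k => (m <= k)%N) (fun=> c)).
by rewrite -(big_nat_widenl m 0 n predT) // sumr_const_nat mulr_natl.
Qed.

Let head_sq w : \sum_(k < n | (k < m)%N) x k w ^+ 2 = 1 - S w.
Proof.
have E : \sum_(k < n | (k < m)%N) x k w ^+ 2 + S w = 1.
  rewrite -[RHS](u_sphere w) [RHS](bigID (fun k : 'I_n => (k < m)%N)) /=.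
  by congr (_ + _); apply: eq_bigl => k; rewrite -leqNgt.
by rewrite -E addrK.
Qed.

Let nR : (n%:R : R) != 0. Proof. by rewrite pnatr_eq0 -lt0n. Qed.

Let DE w : n%:R * D w = n%:R * S w - (n - m)%:R.
Proof. by rewrite /D /tail_dev /S; field. Qed.

Let nm : ((n - m)%:R : R) = n%:R - m%:R. Proof. by rewrite natrB. Qed.

Let sum_alpha w : \sum_(a < n | (a < m)%N) \sum_(b < n | (m <= b)%N) alpha a b w = - (n%:R * D w).
Proof.
rewrite /alpha.
under eq_bigr do rewrite sumrB sum_hi.
by rewrite sumrB sum_lo -mulr_sumr head_sq DE -/(tail_sq (u w)) -/(S w) nm; ring.
Qed.

Let sum_beta w : \sum_(a < n | (a < m)%N) \sum_(b < n | (m <= b)%N) beta a b w = (1 - S w) * S w.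
Proof.
rewrite -head_sq /S /tail_sq mulr_suml; apply: eq_bigr => a _.
by rewrite mulr_sumr; apply: eq_bigr => b _; rewrite /beta exprMn.
Qed.

Lemma Ex_tail_sum (f : 'I_n -> 'I_n -> T -> R) : (forall a b, bounded_rv (f a b)) ->
  (forall a b : 'I_n, (a < m <= b)%N -> Ex P (f a b) = 0) ->
  Ex P (fun w => \sum_(a < n | (a < m)%N) \sum_(b < n | (m <= b)%N) f a b w) = 0.
Proof.
move=> bf f0; rewrite Ex_sum; last by move=> a; exact: brv_sum.
rewrite big1 // => a am; rewrite Ex_sum // big1 // => b mb.
by apply: f0; rewrite am mb.
Qed.

Lemma Ex_tail_dev : Ex P D = 0.
Proof.
have := Ex_tail_sum ba tail_identity1.
rewrite (eq_Ex _ sum_alpha).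
rewrite (@eq_Ex _ _ _ _ _ (fun w => - n%:R * D w)); last by move=> w; rewrite mulNr.
by rewrite ExZ // => /eqP; rewrite mulf_eq0 oppr_eq0 (negbTE nR) /= => /eqP.
Qed.

Let mu : R := (n - m)%:R / n%:R.
Let SE w : S w = D w + mu. Proof. by rewrite /D /tail_dev subrK. Qed.
Let bS : bounded_rv S. Proof. exact: brv_tail_sq. Qed.

(** Summed over all pairs [a < m <= b], [alpha] becomes [- n * D] and [beta] becomes [(1 - S) * S]
    with [S = D + mu], which turns the identity into a linear equation for the second moment. *)
Lemma Ex_tail_dev2 : Ex P (fun w => D w ^+ 2) = 2 * mu * (1 - mu) / (n%:R + 2).
Proof.
have := @Ex_tail_sum (fun a b w => 2 * (D w * alpha a b w) + 4 * beta a b w) _ tail_identity2.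
have E w : \sum_(a < n | (a < m)%N) \sum_(b < n | (m <= b)%N)
    (2 * (D w * alpha a b w) + 4 * beta a b w) =
   (- 2 * n%:R - 4) * D w ^+ 2 + (4 * (1 - 2 * mu) * D w + 4 * mu * (1 - mu)).
  under eq_bigr do rewrite big_split /= -!mulr_sumr.
  rewrite big_split /= -!mulr_sumr sum_beta sum_alpha SE; ring.
rewrite (eq_Ex _ E) => H.
have bD2 : bounded_rv (fun w => D w ^+ 2) by exact: brvX.
have {}H : (- 2 * n%:R - 4) * Ex P (fun w => D w ^+ 2) + 4 * mu * (1 - mu) = 0.
  rewrite -H.
    rewrite ExD ?ExD ?ExZ ?Ex_cst //; try exact: brvZ; try exact: brv_cst.
      by rewrite Ex_tail_dev; ring.
    by apply: brvD; [exact: brvZ|exact: brv_cst].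
  by move=> a b; apply: brvD; apply: brvZ => //; exact: brvM.
have n2 : (n%:R + 2 : R) != 0 by rewrite gt_eqF // ltr_wpDl.
by apply: (mulIf n2); rewrite mulfVK //; lra.
Qed.

(** The same summation expresses the fourth moment as [6 / n] times the mean of
    [D ^+ 2 * ((1 - S) * S)]; it remains to use [(1 - S) * S <= 1/4] and the second moment. *)
Lemma Ex_tail_dev4 : Ex P (fun w => D w ^+ 4) <= 3 / (4 * n%:R ^+ 2).
Proof.
have H := @Ex_tail_sum (fun a b w => 4 * (D w ^+ 3 * alpha a b w) + 24 * (D w ^+ 2 * beta a b w)) _ tail_identity4.
have E w : \sum_(a < n | (a < m)%N) \sum_(b < n | (m <= b)%N)
    (4 * (D w ^+ 3 * alpha a b w) + 24 * (D w ^+ 2 * beta a b w)) =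
   - 4 * n%:R * D w ^+ 4 + 24 * (D w ^+ 2 * ((1 - S w) * S w)).
  under eq_bigr do rewrite big_split /= -!mulr_sumr.
  rewrite big_split /= -!mulr_sumr sum_beta sum_alpha; ring.
rewrite (eq_Ex _ E) in H.
have bD4 : bounded_rv (fun w => D w ^+ 4) by exact: brvX.
have bD2 : bounded_rv (fun w => D w ^+ 2) by exact: brvX.
have bDS : bounded_rv (fun w => D w ^+ 2 * ((1 - S w) * S w)).
  by apply: brvM => //; apply: brvM => //; apply: brvB => //; exact: brv_cst.
have {}H : - 4 * n%:R * Ex P (fun w => D w ^+ 4) + 24 * Ex P (fun w => D w ^+ 2 * ((1 - S w) * S w)) = 0.
  rewrite -H; first by rewrite ExD ?ExZ //; exact: brvZ.
  by move=> a b; apply: brvD; apply: brvZ; apply: brvM => //; exact: brvX.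
have B1 : Ex P (fun w => D w ^+ 2 * ((1 - S w) * S w)) <= 4^-1 * Ex P (fun w => D w ^+ 2).
  rewrite -ExZ //; apply: Ex_le => //; first exact: brvZ.
  move=> w; rewrite mulrC; apply: ler_wpM2r; first exact: sqr_ge0.
  by have := sqr_ge0 (S w - 1 / 2); lra.
have B2 : Ex P (fun w => D w ^+ 2) <= 2^-1 / n%:R.
  rewrite Ex_tail_dev2.
  have q : 2 * mu * (1 - mu) <= 2^-1 by have := sqr_ge0 (mu - 1 / 2); lra.
  have nn : 0 < (n%:R : R) by rewrite ltr0n.
  apply: (@le_trans _ _ (2^-1 / (n%:R + 2))).
    by apply: ler_wpM2r => //; rewrite invr_ge0; lra.
  by apply: ler_wpM2l => //; rewrite lef_pV2 ?posrE; lra.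
have nn : 0 < (n%:R : R) by rewrite ltr0n.
have -> : 3 / (4 * n%:R ^+ 2) = (6 / n%:R) * (4^-1 * (2^-1 / n%:R)) :> R by field.
have -> : Ex P (fun w => D w ^+ 4) = (6 / n%:R) * Ex P (fun w => D w ^+ 2 * ((1 - S w) * S w)).
  apply: (mulfI nR); move: H; set Y := Ex P (fun w => D w ^+ 2 * _) => H.
  have -> : n%:R * (6 / n%:R * Y) = 6 * Y by field.
  by lra.
apply: ler_wpM2l; first by rewrite divr_ge0 // ltW.
by lra.
Qed.

End sphere_moments.

(** Written as [x] times a negative power of [x ^+ 2], inversion inherits the measurability of real
    powers, and the value at [0] agrees. *)
Lemma measurable_inv (R : realType) : measurable_fun setT (@GRing.inv R).
Proof.
have -> : @GRing.inv R = fun x => x * ((x ^+ 2) `^ (-1)).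
  apply/funext => x; rewrite powR_inv1 ?sqr_ge0 // expr2.
  by have [->|x0] := eqVneq x 0; [rewrite invr0 mul0r|field].
apply: measurable_funM => //; apply: (measurableT_comp (measurable_powR _)).
exact: exprn_measurable.
Qed.

(** * Measurability of matrix operations *)

Section gram_measurable.
Context d (T : measurableType d) (R : realType).

Definition mx_measurable a b (F : T -> 'M[R]_(a, b)) :=
  forall i j, measurable_fun setT (fun z => F z i j).

Lemma mx_measurable_tr a b (F : T -> 'M[R]_(a, b)) :
  mx_measurable F -> mx_measurable (fun z => (F z)^T).
Proof.
by move=> mF i j; rewrite (_ : (fun z => _) = fun z => F z j i) //; apply/funext => z; rewrite mxE.
Qed.

Lemma mx_measurable_mul a b c (F : T -> 'M[R]_(a, b)) (G : T -> 'M[R]_(b, c)) :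
  mx_measurable F -> mx_measurable G -> mx_measurable (fun z => F z *m G z).
Proof.
move=> mF mG i j; rewrite (_ : (fun z => _) = fun z => \sum_k F z i k * G z k j).
  by apply: measurable_sum => k; exact: measurable_funM.
by apply/funext => z; rewrite mxE.
Qed.

Lemma measurable_det a (F : T -> 'M[R]_a) :
  mx_measurable F -> measurable_fun setT (fun z => \det (F z)).
Proof.
move=> mF; apply: measurable_sum => s; apply: measurable_funM => //.
by apply: measurable_prod => i _.
Qed.

Lemma mx_measurable_inv a (F : T -> 'M[R]_a) :
  mx_measurable F -> mx_measurable (fun z => invmx (F z)).
Proof.
move=> mF i j; have mdet := measurable_det mF.
have madj : measurable_fun setT (fun z => (\adj (F z)) i j).
  rewrite (_ : (fun z => _) = fun z => (-1) ^+ (j + i) * \det (row' j (col' i (F z)))).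
    apply: measurable_funM => //; apply: measurable_det => k l.
    by rewrite (_ : (fun z => _) = fun z => F z (lift j k) (lift i l)) //;
      apply/funext => z; rewrite !mxE.
  by apply/funext => z; rewrite mxE.
(* [invmx] returns a singular matrix unchanged, hence the first branch. *)
rewrite (_ : (fun z => _) = fun z => if \det (F z) == 0 then F z i j
    else (\det (F z))^-1 * (\adj (F z)) i j).
  apply: measurable_fun_if => //.
  - by apply: measurable_fun_eqr.
  - by apply: measurable_funTS; exact: mF.
  - apply: measurable_funTS; apply: measurable_funM => //.
    by apply: measurableT_comp mdet; exact: measurable_inv.
apply/funext => z; rewrite /invmx unitmxE unitfE.
by case: eqP => //= _; rewrite mxE.
Qed.

Lemma measurable_gram n (F : nat -> T -> 'rV[R]_n) j :
  (forall k, mx_measurable (F k)) -> measurable_fun setT (fun z => gram (fun k => F k z) j).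
Proof.
move=> mF; apply: measurable_det.
have mS : mx_measurable (fun z => stack (fun k => F k z) j).
  move=> a k; rewrite (_ : (fun z => _) = fun z => F (j - a.+1)%N z 0 k); first exact: mF.
  by apply/funext => z; rewrite -(stackE (fun k => F k z) a) mxE.
by apply: mx_measurable_mul => //; exact: mx_measurable_tr.
Qed.

End gram_measurable.

Section row_vectors.
Context (R : realType) (n : nat).

Definition rvec (y : n.-tuple R) : 'rV[R]_n := \row_k tnth y k.

Lemma rvecE y : rvec y = (vec y)^T.
Proof. by apply/rowP => k; rewrite !mxE. Qed.

Lemma rvec_rot O y : rvec (rot O y) = rvec y *m O^T.
Proof.
apply/rowP => k; rewrite [LHS]mxE rotE [RHS]mxE.
by apply: eq_bigr => l _; rewrite !mxE mulrC.
Qed.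

Lemma sqnorm_rvec y : sqnorm (rvec y) = \sum_(k < n) tnth y k ^+ 2.
Proof. by rewrite sqnormE; apply: eq_bigr => k _; rewrite mxE. Qed.

Definition umx p (e : p.-tuple (n.-tuple R)) : 'M[R]_(p, n) :=
  \matrix_(i, k) tnth (tnth e i) k.

Lemma row_umx p (e : p.-tuple (n.-tuple R)) i : row i (umx e) = rvec (tnth e i).
Proof. by apply/rowP => k; rewrite !mxE. Qed.

Definition rows (y0 : n.-tuple R) p (e : p.-tuple (n.-tuple R)) k := rvec (nth y0 e k).

Lemma gram_umx y0 p (e : p.-tuple (n.-tuple R)) :
  gram (rows y0 e) p = \det (umx e *m (umx e)^T).
Proof.
rewrite /gram; have -> : stack (rows y0 e) p = row_perm (perm (@rev_ord_inj p)) (umx e).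
  apply/row_matrixP => a; rewrite stackE; apply/rowP => k.
  by rewrite !mxE permE (tnth_nth y0 e).
move: (perm _) => s.
rewrite row_permE trmx_mul mulmxA -(mulmxA (perm_mx s)) !det_mulmx det_tr det_perm.
by rewrite mulrAC -expr2 sqrr_sign mul1r.
Qed.

End row_vectors.

Section taylor_log.
Context (R : realType).

(** The remainder vanishes at [0] and has derivative [y ^+ 2 / (1 + y)], which lies between [0] and
    [3 * y ^+ 2] as soon as [y >= - 2^-1]. *)
Lemma ln1D_taylor2 (z : R) : `|z| <= 2^-1 ->
  `|ln (1 + z) - z + z ^+ 2 / 2| <= `|z| ^+ 3.
Proof.
rewrite ler_norml => /andP[zl zr].
pose f (y : R) := ln (1 + y) - y + y ^+ 2 / 2.
have df (y : R) : -1 < y -> is_derive y 1 f (y ^+ 2 / (1 + y)).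
  move=> y1; have y0 : 0 < 1 + y by lra.
  have d1 : is_derive y 1 (@ln R \o (fun t : R => 1 + t)) ((1 + y)^-1 * 1).
    apply: is_derive1_comp; first exact: is_derive1_ln.
    have -> : (fun t : R => 1 + t) = cst 1 + @id R by [].
    by apply: is_derive_eq; rewrite add0r.
  have -> : f = (@ln R \o (fun t : R => 1 + t)) - @id R + 2^-1 *: (@id R * @id R).
    by apply/funext => t; rewrite /f expr2 mulrC.
  have dM := is_deriveZ 2^-1 (is_deriveM (is_derive_id y 1) (is_derive_id y 1)).
  apply: (is_derive_eq (is_deriveD (is_deriveB d1 (is_derive_id y 1)) dM)).
  by rewrite /GRing.scale /=; field; rewrite gt_eqF.
have f0 : f 0 = 0 by rewrite /f addr0 ln1; ring.
pose g (y : R) := y ^+ 3 - f y.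
have dg (y : R) : -1 < y -> is_derive y 1 g (3 * y ^+ 2 - y ^+ 2 / (1 + y)).
  move=> y1; have d1 := df y y1.
  have -> : g = @id R * (@id R * @id R) - f.
    by apply/funext => t; rewrite /g !exprS expr0 mulr1.
  apply: is_derive_eq.
  have -> : (@id R * @id R) y = y * y by [].
  rewrite /GRing.scale /=; field.
  by rewrite gt_eqF //; lra.
have g0 : g 0 = 0 by rewrite /g f0; ring.
have inv2 (y : R) : - 2^-1 <= y -> 0 <= (1 + y)^-1 <= 2.
  move=> y2; have y0 : 0 < 1 + y by lra.
  rewrite invr_ge0 (ltW y0) /= -[leRHS]invrK lef_pV2 ?posrE ?invr_gt0 //; lra.
rewrite -/(f z); have [z0|z0] := leP 0 z.
  have h1 : f 0 <= f z.
    apply: (deriv_mono z0 (df := fun y => y ^+ 2 / (1 + y))) => y /andP[y0 _].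
      by apply: df; lra.
    by rewrite mulr_ge0 ?sqr_ge0 // invr_ge0; lra.
  have h2 : g 0 <= g z.
    apply: (deriv_mono z0 (df := fun y => 3 * y ^+ 2 - y ^+ 2 / (1 + y))) => y /andP[y0 _].
      by apply: dg; lra.
    have /andP[_ i2] : 0 <= (1 + y)^-1 <= 2 by apply: inv2; lra.
    by have := ler_wpM2l (sqr_ge0 y) i2; have := sqr_ge0 y; lra.
  rewrite (ger0_norm z0) ger0_norm; first by rewrite g0 /g in h2; lra.
  by rewrite -f0.
have zle := ltW z0.
have h1 : f z <= f 0.
  apply: (deriv_mono zle (df := fun y => y ^+ 2 / (1 + y))) => y /andP[y0 y1].
    by apply: df; lra.
  by rewrite mulr_ge0 ?sqr_ge0 // invr_ge0; lra.
have h2 : g z <= g 0.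
  apply: (deriv_mono zle (df := fun y => 3 * y ^+ 2 - y ^+ 2 / (1 + y))) => y /andP[y0 y1].
    by apply: dg; lra.
  have /andP[_ i2] : 0 <= (1 + y)^-1 <= 2 by apply: inv2; lra.
  by have := ler_wpM2l (sqr_ge0 y) i2; have := sqr_ge0 y; lra.
rewrite f0 in h1; rewrite g0 /g in h2.
rewrite (ltr0_norm z0) (ler0_norm h1).
have -> : (- z) ^+ 3 = - (z ^+ 3) by ring.
by lra.
Qed.

End taylor_log.

(** * Distances to the span of the preceding vectors *)

Section sphere_family.
Context d (T : measurableType d) (R : realType) (P : probability T R).
Context (n p : nat) (n0 : (0 < n)%N) (pn : (p <= n)%N).
Context (u : 'I_p -> {RV P >-> n.-tuple R}).
Hypothesis u_sphere : forall i w, \sum_(k < n) tnth (u i w) k ^+ 2 = 1.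
Hypothesis u_rot : forall i (O : 'M[R]_n), O^T *m O = 1%:M ->
  forall B, measurable B -> P ((fun w => rot O (u i w)) @^-1` B) = P (u i @^-1` B).
Hypothesis u_ind : mutually_independent P u.

Notation family := (p.-tuple (n.-tuple R)).
Let y0 : n.-tuple R := [tuple 0 | _ < n].

Definition full (w : T) : family := [tuple u i w | i < p].

(** Entries from [j] on are overwritten by a fixed vector, so that [past j] has the same type for
    all [j] and yet depends only on the vectors before [j]. *)
Definition past (j : nat) (w : T) : family :=
  [tuple if (i < j)%N then u i w else y0 | i < p].

Lemma measurable_full : measurable_fun setT full.
Proof.
apply/measurable_fun_tnthP => i; rewrite (_ : _ \o _ = u i) //.
by apply/funext => w /=; rewrite tnth_mktuple.
Qed.

Lemma measurable_past j : measurable_fun setT (past j).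
Proof.
apply/measurable_fun_tnthP => i.
rewrite (_ : _ \o _ = if (i < j)%N then (u i : T -> _) else cst y0).
  by case: ifP.
by apply/funext => w /=; rewrite tnth_mktuple; case: ifP.
Qed.

Lemma nth_full (j : 'I_p) w : nth y0 (full w) j = u j w.
Proof. by rewrite -tnth_nth tnth_mktuple. Qed.

Lemma nth_past j (i : nat) w : (i < j)%N -> nth y0 (past j w) i = nth y0 (full w) i.
Proof.
move=> ij; have [ip|pi] := ltnP i p; last by rewrite !nth_default ?size_tuple.
by rewrite -!(tnth_nth y0 _ (Ordinal ip)) !tnth_mktuple /= ij.
Qed.

Lemma family_law (u' : 'I_p -> {RV P >-> n.-tuple R}) :
  mutually_independent P u' ->
  (forall i B, measurable B -> P (u' i @^-1` B) = P (u i @^-1` B)) ->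
  forall A, measurable A ->
  P ((fun w => [tuple u' i w | i < p]) @^-1` A) = P (full @^-1` A).
Proof.
move=> u'_ind u'u A mA.
have mF' : measurable_fun setT (fun w => [tuple u' i w | i < p]).
  apply/measurable_fun_tnthP => i; rewrite (_ : _ \o _ = u' i) //.
  by apply/funext => w /=; rewrite tnth_mktuple.
have [F FE] := mfun_of measurable_full; have [F' F'E] := mfun_of mF'.
rewrite -FE -F'E.
apply: (@tuple_measure_ext _ _ _ _ (distribution P F') (distribution P F)) => //.
  by apply: le_lt_trans (probability_le1 _ _) _ => //; exact: ltry.
move=> B mB.
have rE (v : 'I_p -> {RV P >-> n.-tuple R}) :
    (fun w => [tuple v i w | i < p]) @^-1` rectangle B =
    \bigcap_(i in [set` [set: 'I_p]%SET]) (v i @^-1` B i).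
  apply/seteqP; split => w /=.
    by move=> Bw i _ /=; have := Bw i; rewrite tnth_mktuple.
  by move=> Bw i; rewrite tnth_mktuple; apply: Bw; rewrite /= inE.
transitivity (P (F' @^-1` rectangle B)); first by [].
transitivity (P (F @^-1` rectangle B)); last by [].
rewrite FE F'E /full !rE u'_ind // u_ind //.
by apply: eq_bigr => i _; exact: u'u.
Qed.

Lemma indep_past (j : 'I_p) : indep P (past j) (u j).
Proof.
move=> A C mA mC.
have [U UE] := mfun_of (measurable_past j).
have muC : measurable (u j @^-1` C).
  by rewrite -[_ @^-1` _]setTI; exact: measurable_funPT.
have r0 : 0 <= fine (P (u j @^-1` C)) by rewrite fine_ge0.
have PC_fin : P (u j @^-1` C) \is a fin_num by rewrite fin_num_measure.
rewrite -UE muleC.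
transitivity (pushforward (mrestr P muC) U A); first by [].
transitivity (mscale (NngNum r0) (distribution P U) A); last first.
  by rewrite /mscale /= fineK.
apply: tuple_measure_ext => //.
  apply: (@le_lt_trans _ _ (1%:E)); last exact: ltry.
  have := probability_le1 P muC; congr (_ <= _)%E.
  by rewrite /= /pushforward /mrestr preimage_setT setTI.
move=> B mB.
transitivity (P ((past j @^-1` rectangle B) `&` (u j @^-1` C))); first by rewrite -UE.
transitivity ((NngNum r0)%:num%:E * P (U @^-1` rectangle B))%E; last by [].
rewrite /= fineK // UE.
(* The padding entries are constant: a rectangle that misses [y0] at one of them gives the empty
   event, otherwise only the constraints below [j] remain. *)
have [By0|nBy0] := pselect (forall i : 'I_p, (j <= i)%N -> B i y0); last first.
  have -> : past j @^-1` rectangle B = set0.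
    apply/seteqP; split => // w /= Bw; apply: nBy0 => i ji.
    by have := Bw i; rewrite tnth_mktuple ltnNge ji.
  by rewrite set0I measure0 mule0.
pose J : {set 'I_p} := finset (fun i : 'I_p => (i < j)%N).
have jJ : j \notin J by rewrite inE ltnn.
(* One family of sets serves both [J] and [j |: J], so mutual independence applies to the two events
   and the quotient of the products is the factor of [j]. *)
pose B' (i : 'I_p) := if (i < j)%N then B i else C.
have mB' i : measurable (B' i) by rewrite /B'; case: ifP.
have E1 : past j @^-1` rectangle B = \bigcap_(i in [set` J]) (u i @^-1` B' i).
  apply/seteqP; split => w /= Bw i.
    rewrite /= inE => ij; have := Bw i; rewrite tnth_mktuple ij.
    by rewrite /B' ij.
  rewrite tnth_mktuple; case: ifP => ij; last by apply: By0; rewrite leqNgt ij.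
  by have := Bw i; rewrite /= inE /B' ij; apply.
have E2 : (past j @^-1` rectangle B) `&` (u j @^-1` C) =
    \bigcap_(i in [set` (j |: J)%SET]) (u i @^-1` B' i).
  rewrite E1; apply/seteqP; split => w /=.
    move=> [Bw Cw] i /=; rewrite in_setU1 => /orP[/eqP ->|]; last exact: Bw.
    by rewrite /B' ltnn.
  move=> Bw; split; first by move=> i iJ; apply: Bw; rewrite /= in_setU1 iJ orbT.
  by have := Bw j; rewrite /= in_setU1 eqxx /B' ltnn; apply.
rewrite E2 E1 !u_ind // big_setU1 //=; congr (_ * _)%E.
by rewrite /B' ltnn.
Qed.

(** Squared distance from [y] to the span of the first [j] rows, as a quotient of Gram determinants.
    The degenerate value is [tail_sq j y] so that in all cases [ratio j e] is [tail_sq j] after a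
    rotation; its bounds and its law then admit no exception. *)
Definition ratio (j : nat) (e : family) (y : n.-tuple R) : R :=
  if gram (rows y0 e) j == 0 then tail_sq j y
  else gram (fun k => if k == j then rvec y else rows y0 e k) j.+1 / gram (rows y0 e) j.

Lemma ratio_rot j e : exists O : 'M[R]_n, O^T *m O = 1%:M /\
  forall y, ratio j e y = tail_sq j (rot O y).
Proof.
rewrite /ratio; case: eqP => [_|/eqP g0].
  exists 1%:M; rewrite trmx1 mulmx1; split => // y; congr (tail_sq j _).
  apply: eq_from_tnth => k; rewrite rotE (bigD1 k) //= big1 ?addr0 ?mxE ?eqxx ?mul1r //.
  by move=> l lk; rewrite mxE eq_sym (negbTE lk) mul0r.
have [ O [OO OU]] := gram_step g0.
exists O^T; rewrite trmxK; split; first exact: mulmx1C.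
move=> y; pose f k := if k == j then rvec y else rows y0 e k.
have -> : gram (fun k => if k == j then rvec y else rows y0 e k) j.+1 =
    \det (col_mx (rvec y) (stack (rows y0 e) j) *m (col_mx (rvec y) (stack (rows y0 e) j))^T).
  have Ef : stack f j.+1 = col_mx (rvec y) (stack (rows y0 e) j).
    have Es : stack f j = stack (rows y0 e) j.
      by apply: eq_stack => k kj; rewrite /f ltn_eqF.
    by rewrite /= Es /f eqxx.
  by rewrite /gram -/f Ef.
rewrite OU mulrAC mulfV // mul1r; apply: eq_bigr => k _.
by congr (_ ^+ 2); have := rvec_rot O^T y => /rowP/(_ k); rewrite trmxK => <-; rewrite mxE.
Qed.

Lemma ratio01 j e (y : n.-tuple R) : \sum_(k < n) tnth y k ^+ 2 = 1 ->
  0 <= ratio j e y <= 1.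
Proof.
move=> y1; have [ O [OO ->]] := ratio_rot j e.
rewrite sumr_ge0 /=; last by move=> k _; rewrite sqr_ge0.
have : \sum_(k < n) tnth (rot O y) k ^+ 2 = 1.
  by rewrite -sqnorm_rvec rvec_rot sqnorm_orthogonal ?trmxK // sqnorm_rvec.
move=> <-; rewrite [leRHS](bigID (fun k : 'I_n => (j <= k)%N)) /= lerDl sumr_ge0 // => k _.
exact: sqr_ge0.
Qed.

Lemma measurable_rows k : mx_measurable (fun e : family => rows y0 e k).
Proof.
move=> a b; rewrite (_ : (fun e => _) = fun e : family => tnth (nth y0 e k) b); last first.
  by apply/funext => e; rewrite mxE.
have [kp|pk] := ltnP k p; last first.
  rewrite (_ : (fun e => _) = cst (tnth y0 b)) //.
  by apply/funext => e; rewrite nth_default // size_tuple.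
rewrite (_ : (fun e => _) = fun e : family => tnth (tnth e (Ordinal kp)) b).
  apply: (measurableT_comp (measurable_tnth b)); exact: measurable_tnth.
by apply/funext => e; rewrite (tnth_nth y0).
Qed.

Lemma measurable_ratio j : measurable_fun setT (fun z : family * n.-tuple R => ratio j z.1 z.2).
Proof.
have mrows k : mx_measurable (fun z : family * n.-tuple R => rows y0 z.1 k).
  move=> a b; apply: (measurableT_comp (@measurable_rows k a b)); exact: measurable_fst.
have mg : measurable_fun setT (fun z : family * n.-tuple R => gram (rows y0 z.1) j).
  exact: (measurable_gram j mrows).
apply: measurable_fun_if => //.
- exact: measurable_fun_eqr.
- apply: measurable_funTS; apply: (measurableT_comp (@measurable_tail_sq R n j)).
  exact: measurable_snd.
- apply: measurable_funTS; apply: measurable_funM.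
    apply: (@measurable_gram _ _ R n (fun k (z : family * n.-tuple R) =>
      if k == j then rvec z.2 else rows y0 z.1 k) j.+1) => k.
    case: (k == j) => // a b.
    rewrite (_ : (fun z => _) = fun z : family * n.-tuple R => tnth z.2 b).
      apply: (measurableT_comp (measurable_tnth b)); exact: measurable_snd.
    by apply/funext => z; rewrite mxE.
  exact: (measurableT_comp (@measurable_inv R) mg).
Qed.

Definition distsq (j : nat) (w : T) : R := ratio j (full w) (nth y0 (full w) j).

Lemma eq_ratio j (e e' : family) y : (forall k, (k < j)%N -> nth y0 e k = nth y0 e' k) ->
  ratio j e y = ratio j e' y.
Proof.
move=> ee; rewrite /ratio.
have -> : gram (rows y0 e) j = gram (rows y0 e') j.
  by apply: eq_gram => k kj; rewrite /rows ee.
case: ifP => // _; congr (_ / _); apply: eq_gram => k; rewrite ltnS leq_eqVlt.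
by case: eqP => // _ /= kj; rewrite /rows ee.
Qed.

Lemma distsqE (j : 'I_p) w : distsq j w = ratio j (past j w) (u j w).
Proof.
rewrite /distsq nth_full; apply: eq_ratio => k kj; rewrite nth_past //.
Qed.

Lemma distsq01 (j : 'I_p) w : 0 <= distsq j w <= 1.
Proof. by rewrite distsqE; apply: ratio01; exact: u_sphere. Qed.

Lemma measurable_distsq j : measurable_fun setT (distsq j).
Proof.
have [jp|pj] := ltnP j p.
  rewrite (_ : distsq j = fun w => ratio j (full w) (u (Ordinal jp) w)); last first.
    by apply/funext => w; rewrite /distsq -[j in nth _ _ j]/(val (Ordinal jp)) nth_full.
  have mF : measurable_fun setT (fun w => (full w, u (Ordinal jp) w)).
    by apply/measurable_fun_pairP; split => //; exact: measurable_full.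
  exact: (measurableT_comp (measurable_ratio j) mF).
rewrite (_ : distsq j = fun w => ratio j (full w) y0); last first.
  by apply/funext => w; rewrite /distsq nth_default // size_tuple.
have mF : measurable_fun setT (fun w => (full w, y0)).
  by apply/measurable_fun_pairP; split; [exact: measurable_full|exact: measurable_cst].
exact: (measurableT_comp (measurable_ratio j) mF).
Qed.

(* Given the past, a rotation turns the squared distance of u_j to the span of
   its predecessors into the sum of its last n - j squared coordinates, whose law
   does not depend on the past. *)
Lemma distsq_law (j : 'I_p) (B : set family) (C : set R) : measurable B -> measurable C ->
  P ((past j @^-1` B) `&` (distsq j @^-1` C)) =
  (P (past j @^-1` B) * P ((fun w => tail_sq j (u j w)) @^-1` C))%E.
Proof.
move=> mB mC.
have [U UE] := mfun_of (measurable_past j).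
have UX : indep P U (u j) by rewrite UE; exact: indep_past.
have mR : measurable [set z : family * n.-tuple R | C (ratio j z.1 z.2)].
  by rewrite -[X in measurable X]setTI; exact: (measurable_ratio j).
have mt : measurable (tail_sq j @^-1` C : set (n.-tuple R)).
  by rewrite -[_ @^-1` _]setTI; exact: measurable_tail_sq.
have sec e : P (u j @^-1` [set y | [set z : family * n.-tuple R | C (ratio j z.1 z.2)] (e, y)])
    = P ((fun w => tail_sq j (u j w)) @^-1` C).
  have [ O [OO rO]] := ratio_rot j e.
  transitivity (P ((fun w => rot O (u j w)) @^-1` (tail_sq j @^-1` C))); last exact: u_rot.
  by congr (P _); apply/seteqP; split => w /=; rewrite rO.
have := indep_const_section UX mR sec mB; rewrite UE => <-.
by congr (P (_ `&` _)); apply/seteqP; split => w /=; rewrite distsqE.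
Qed.

Lemma distsq_marginal (j : 'I_p) C : measurable C ->
  P (distsq j @^-1` C) = P ((fun w => tail_sq j (u j w)) @^-1` C).
Proof.
move=> mC; have := distsq_law j measurableT mC.
by rewrite preimage_setT setTI probability_setT mul1e.
Qed.

Lemma indep_distsq (j : 'I_p) : indep P (past j) (distsq j).
Proof. by move=> A B mA mB; rewrite distsq_law // distsq_marginal. Qed.

(** The common random element is [past j]: earlier distances involve only earlier rows and can be
    recomputed from it. *)
Lemma sequentially_indep_distsq (h : nat -> R -> R) : (forall j, measurable_fun setT (h j)) ->
  sequentially_indep P p (fun j w => h j (distsq j w)).
Proof.
move=> mh j jp; have [U UE] := mfun_of (measurable_past j).
exists _, family, U, (fun i e => h i (ratio i e (nth y0 e i))); split.
  rewrite UE; apply: (indep_comp (@measurable_id _ _ setT) (mh j)).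
  exact: (indep_distsq (Ordinal jp)).
move=> i ij; have ip : (i < p)%N by apply: ltn_trans jp.
split.
  have mF : measurable_fun setT (fun e : family => (e, nth y0 e i)).
    have mN : measurable_fun setT (fun e : family => nth y0 e i).
      rewrite (_ : (fun e => _) = fun e : family => tnth e (Ordinal ip)).
        exact: measurable_tnth.
      by apply/funext => e; rewrite (tnth_nth y0).
    by apply/measurable_fun_pairP; split; [exact: measurable_id|exact: mN].
  exact: (measurableT_comp (mh i) (measurableT_comp (measurable_ratio i) mF)).
move=> w; congr (h i _); rewrite /distsq UE nth_past //.
by apply: eq_ratio => k ki; rewrite nth_past // (ltn_trans ki).
Qed.

Lemma Ex_distsq (j : 'I_p) (g : R -> R) : measurable_fun setT g ->
  bounded_rv (fun w => g (distsq j w)) -> bounded_rv (fun w => g (tail_sq j (u j w))) ->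
  Ex P (fun w => g (distsq j w)) = Ex P (fun w => g (tail_sq j (u j w))).
Proof.
move=> mg b1 b2.
have [X XE] := mfun_of (measurable_distsq j).
have mt : measurable_fun setT (fun w => tail_sq j (u j w)).
  exact: (measurableT_comp (@measurable_tail_sq R n j)).
have [Y YE] := mfun_of mt.
have := @Ex_same_law _ _ _ P _ _ X Y g; rewrite XE YE; apply => //.
exact: distsq_marginal.
Qed.

(** Positivity of the earlier distances keeps every intermediate Gram determinant nonzero, so the
    quotients telescope and the default branch of [ratio] is never taken. *)
Lemma gram_distsq w : (forall j, (j < p)%N -> 0 < distsq j w) ->
  \det (umx (full w) *m (umx (full w))^T) = \prod_(0 <= j < p) distsq j w.
Proof.
move=> d0; rewrite -(gram_umx y0).
suff H j : (j <= p)%N -> gram (rows y0 (full w)) j = \prod_(0 <= i < j) distsq i w.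
  exact: H.
elim: j => [|j IH] jp; first by rewrite big_nil /gram det_mx00.
have Gj := IH (ltnW jp).
have Gj0 : gram (rows y0 (full w)) j != 0.
  rewrite Gj gt_eqF //; rewrite big_nat_cond prodr_gt0 // => i /andP[/andP[_ ij] _].
  by apply: d0; exact: ltn_trans jp.
rewrite big_nat_recr //= -Gj /distsq /ratio (negbTE Gj0) mulrC divfK //.
by apply: eq_gram => k _; case: eqP => // ->.
Qed.

End sphere_family.

Section variance_of_sum.
Context d (T : measurableType d) (R : realType) (P : probability T R).

Lemma Ex_sum_sqr N (xi : nat -> T -> R) : (forall i, bounded_rv (xi i)) ->
  sequentially_indep P N xi -> (forall i, (i < N)%N -> Ex P (xi i) = 0) ->
  Ex P (fun w => (\sum_(0 <= i < N) xi i w) ^+ 2) =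
  \sum_(0 <= i < N) Ex P (fun w => xi i w ^+ 2).
Proof.
move=> bxi SI xi0.
transitivity (Ex P (fun w => \sum_(0 <= i < N) xi i w * \sum_(0 <= j < N) xi j w)).
  by apply: eq_Ex => w; rewrite expr2 mulr_suml.
rewrite Ex_sum; last by move=> i; apply: brvM => //; exact: brv_sum.
rewrite big_nat_cond [RHS]big_nat_cond; apply: eq_bigr => i /andP[/andP[_ iN] _].
have loo := sequentially_indep_loo (fun i => brv_meas (bxi i)) SI iN.
have E w : xi i w * \sum_(0 <= j < N) xi j w =
    xi i w ^+ 2 + xi i w * \sum_(0 <= j < N | j != i) xi j w.
  by rewrite (bigD1_seq i) ?mem_index_iota ?iota_uniq //= mulrDr expr2.
rewrite (eq_Ex _ E) ExD; [|exact: brvX|by apply: brvM => //; exact: brv_sum].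
by rewrite indep_Ex_mul // ?xi0 ?mul0r ?addr0 //; exact: brv_sum.
Qed.

Lemma Ex_abs_le (f : T -> R) e : bounded_rv f -> 0 < e ->
  Ex P (fun w => `|f w|) <= (e + Ex P (fun w => f w ^+ 2) / e) / 2.
Proof.
move=> bf e0.
have bf2 : bounded_rv (fun w => f w ^+ 2) by exact: brvX.
have -> : (e + Ex P (fun w => f w ^+ 2) / e) / 2 =
    Ex P (fun w => 2^-1 * (e + e^-1 * f w ^+ 2)).
  rewrite ExZ; last by apply: brvD; [exact: brv_cst|exact: brvZ].
  by rewrite ExD ?Ex_cst ?ExZ //; [ring|exact: brv_cst|exact: brvZ].
apply: Ex_le; first exact: brv_norm.
  by apply: brvZ; apply: brvD; [exact: brv_cst|exact: brvZ].
by move=> w; have := abs_le (f w) e0; rewrite [_^-1 * (_ + _)]mulrC [e^-1 * _]mulrC.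
Qed.

Lemma Ex_cube_le (f : T -> R) e : bounded_rv f -> 0 < e ->
  Ex P (fun w => `|f w| ^+ 3) <=
  (e * Ex P (fun w => f w ^+ 2) + Ex P (fun w => f w ^+ 4) / e) / 2.
Proof.
move=> bf e0.
have bf2 k : bounded_rv (fun w => f w ^+ k) by exact: brvX.
have -> : (e * Ex P (fun w => f w ^+ 2) + Ex P (fun w => f w ^+ 4) / e) / 2 =
    Ex P (fun w => 2^-1 * (e * f w ^+ 2 + e^-1 * f w ^+ 4)).
  rewrite ExZ; last by apply: brvD; exact: brvZ.
  by rewrite ExD ?ExZ //; [ring|exact: brvZ|exact: brvZ].
apply: Ex_le; first by apply: brvX; exact: brv_norm.
  by apply: brvZ; apply: brvD; exact: brvZ.
by move=> w; have := cube_le (f w) e0; rewrite [_^-1 * (_ + _)]mulrC [e^-1 * _]mulrC.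
Qed.

End variance_of_sum.

(** * Exchangeability of the diagonal of the projection *)

Section projection_diagonal.
Context d (T : measurableType d) (R : realType) (P : probability T R).
Context (n p : nat).
Context (u : 'I_p -> {RV P >-> n.-tuple R}).
Hypothesis u_rot : forall i (O : 'M[R]_n), O^T *m O = 1%:M ->
  forall B, measurable B -> P ((fun w => rot O (u i w)) @^-1` B) = P (u i @^-1` B).
Hypothesis u_ind : mutually_independent P u.

Notation family := (p.-tuple (n.-tuple R)).

(* Set to 0 on degenerate families so as to be bounded everywhere. *)
Definition proj_diag (a : 'I_n) (e : family) : R :=
  if \det (umx e *m (umx e)^T) == 0 then 0 else rowproj (umx e) a a.

Lemma proj_diag01 a e : 0 <= proj_diag a e <= 1.
Proof.
rewrite /proj_diag; case: eqP => [_|/eqP g0]; first by rewrite lexx ler01.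
exact: rowproj_diag01.
Qed.

Lemma measurable_proj_diag a : measurable_fun setT (proj_diag a).
Proof.
have mU : mx_measurable (fun e : family => umx e).
  move=> i j; rewrite (_ : (fun e => _) = fun e : family => tnth (tnth e i) j).
    apply: (measurableT_comp (measurable_tnth j)); exact: measurable_tnth.
  by apply/funext => e; rewrite mxE.
have mUt := mx_measurable_tr mU; have mG := mx_measurable_mul mU mUt.
apply: measurable_fun_if => //.
- by apply: measurable_fun_eqr => //; exact: measurable_det.
- apply: measurable_funTS.
  exact: (mx_measurable_mul (mx_measurable_mul mUt (mx_measurable_inv mG)) mU).
Qed.

Let q a w := proj_diag a (full u w).

Lemma brv_proj_diag a : bounded_rv (q a).
Proof.
split; first exact: (measurableT_comp (measurable_proj_diag a) (measurable_full u)).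
by exists 1 => w; have /andP[q0 q1] := proj_diag01 a (full u w); rewrite ger0_norm.
Qed.

(** A permutation matrix is orthogonal: applying it to every vector preserves the joint law, while
    it conjugates the projection and so permutes its diagonal. *)
Lemma Ex_proj_diag_perm (s : 'S_n) a b :
  Ex P (fun w => q (s a) w * q (s b) w) = Ex P (fun w => q a w * q b w).
Proof.
pose S : 'M[R]_n := perm_mx s.
have SS : S *m S^T = 1%:M by rewrite /S tr_perm_mx -perm_mxM mulgV perm_mx1.
have SSt : S^T *m S = 1%:M by exact: mulmx1C.
have mu' i : measurable_fun setT (fun w => rot S (u i w)).
  exact: (measurableT_comp (measurable_rot S) (measurable_funPT (u i))).
pose u' i : {RV P >-> n.-tuple R} := mfun_Sub (mem_set (mu' i)).
have u'E i w : u' i w = rot S (u i w) by [].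
have u'_ind : mutually_independent P u'.
  move=> J B mB.
  have mrB i : measurable (rot S @^-1` B i).
    by rewrite -[_ @^-1` _]setTI; exact: measurable_rot.
  exact: (u_ind J mrB).
have u'u i B : measurable B -> P (u' i @^-1` B) = P (u i @^-1` B).
  by move=> mB; exact: u_rot.
pose F w : family := [tuple u' i w | i < p].
have mF : measurable_fun setT F.
  apply/measurable_fun_tnthP => i; rewrite (_ : _ \o _ = u' i) //.
  by apply/funext => w /=; rewrite tnth_mktuple.
have umxF w : umx (F w) = umx (full u w) *m S^T.
  apply/row_matrixP => i; rewrite row_mul !row_umx !tnth_mktuple u'E.
  exact: rvec_rot.
have qF c w : proj_diag c (F w) = q (s c) w.
  rewrite /q /proj_diag umxF trmx_mul trmxK.
  have -> : umx (full u w) *m S^T *m (S *m (umx (full u w))^T) =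
      umx (full u w) *m (umx (full u w))^T.
    by rewrite mulmxA -(mulmxA _ S^T) SSt mulmx1.
  case: ifP => // _; rewrite rowproj_orthogonal ?trmxK //.
  move: (rowproj _) => Q.
  have SE (M : 'M[R]_n) i j : (S *m M) i j = M (s i) j by rewrite /S -row_permE mxE.
  have SEt (M : 'M[R]_n) i j : (M *m S^T) i j = M i (s j).
    have -> : M *m S^T = (S *m M^T)^T by rewrite trmx_mul trmxK.
    by rewrite [LHS]mxE SE mxE.
  by rewrite SEt SE.
have [X XE] := mfun_of mF; have [Y YE] := mfun_of (measurable_full u).
pose g e := proj_diag a e * proj_diag b e.
have mg : measurable_fun setT g by apply: measurable_funM; exact: measurable_proj_diag.
transitivity (Ex P (fun w => g (X w))).
  by apply: eq_Ex => w; rewrite /g XE !qF.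
have bg (Z : {mfun T >-> family}) : bounded_rv (fun w => g (Z w)).
  split; first exact: (measurableT_comp mg (measurable_funPT Z)).
  exists 1 => w; have /andP[a0 a1] := proj_diag01 a (Z w).
  have /andP[b0 b1] := proj_diag01 b (Z w).
  by rewrite ger0_norm ?mulr_ge0 // mulr_ile1.
transitivity (Ex P (fun w => g (Y w))); last by rewrite YE.
apply: Ex_same_law => // B mB; rewrite XE YE.
exact: (family_law u_ind u'_ind u'u).
Qed.

(** By exchangeability the mixed moments have a common value [al >= 0] off the diagonal. As the
    [c k] sum to zero, [al] survives only on the diagonal, where it enters with a negative sign. *)
Lemma Ex_weighted_diag (c : 'I_n -> R) : \sum_k c k = 0 ->
  Ex P (fun w => (\sum_k c k * q k w) ^+ 2) <= \sum_k c k ^+ 2.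
Proof.
move=> c0.
pose f a b := Ex P (fun w => q a w * q b w).
have fC a b : f a b = f b a by apply: eq_Ex => w; rewrite mulrC.
have q01 a w : 0 <= q a w <= 1 by exact: proj_diag01.
have bq := brv_proj_diag.
have f1 a b : 0 <= f a b <= 1.
  apply/andP; split.
    apply: Ex_ge0 => w; have /andP[? _] := q01 a w; have /andP[? _] := q01 b w.
    exact: mulr_ge0.
  rewrite -[leRHS](Ex_cst P 1); apply: Ex_le; [exact: brvM|exact: brv_cst|].
  move=> w; have /andP[? ?] := q01 a w; have /andP[? ?] := q01 b w.
  exact: mulr_ile1.
have f_move a b c' : b != a -> b != c' -> f a b = f c' b.
  move=> ba bc; rewrite /f -(Ex_proj_diag_perm (tperm a c') a b) tpermL tpermD //.
    by rewrite eq_sym.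
  by rewrite eq_sym.
(* [f_move] changes one index, symmetry of [f] gives access to the other. With fewer than two
   indices there is no off-diagonal pair and [0] serves. *)
have [al [al0 fal]] : exists al : R, 0 <= al /\ forall a b, a != b -> f a b = al.
  have [[a0 [b0 ab0]]|no] := pselect (exists a b : 'I_n, a != b); last first.
    by exists 0; split => // a b ab; exfalso; apply: no; exists a, b.
  exists (f a0 b0); split; first by have /andP[] := f1 a0 b0.
  move=> a b ab; have [ab0'|ab0'] := eqVneq a b0.
    rewrite ab0' in ab *; rewrite fC.
    by rewrite (f_move b b0 a0) // eq_sym.
  rewrite fC (f_move b a b0) // [LHS]fC.
  by rewrite (f_move a b0 a0) // eq_sym.
have -> : Ex P (fun w => (\sum_k c k * q k w) ^+ 2) = \sum_a \sum_b c a * c b * f a b.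
  transitivity (Ex P (fun w => \sum_a \sum_b c a * c b * (q a w * q b w))).
    apply: eq_Ex => w; rewrite expr2 mulr_suml; apply: eq_bigr => a _.
    by rewrite mulr_sumr; apply: eq_bigr => b _; ring.
  rewrite Ex_sum; last by move=> a; apply: brv_sum => b; apply: brvZ; exact: brvM.
  apply: eq_bigr => a _; rewrite Ex_sum; last by move=> b; apply: brvZ; exact: brvM.
  by apply: eq_bigr => b _; rewrite ExZ //; exact: brvM.
have -> : \sum_a \sum_b c a * c b * f a b = \sum_a c a ^+ 2 * (f a a - al).
  have -> : \sum_a c a ^+ 2 * (f a a - al) =
      \sum_a (c a ^+ 2 * (f a a - al) + c a * (\sum_b c b) * al).
    by apply: eq_bigr => a _; rewrite c0 mulr0 mul0r addr0.
  apply: eq_bigr => a _; rewrite (bigD1 a) //= [in RHS](bigD1 a) //=.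
  have -> : \sum_(b < n | b != a) c a * c b * f a b = c a * al * \sum_(b < n | b != a) c b.
    rewrite mulr_sumr; apply: eq_bigr => b ba; rewrite fal 1?eq_sym //; ring.
  by move: (\sum_(b < n | _) _) => r; ring.
apply: ler_sum => a _; rewrite ler_piMr ?sqr_ge0 //.
by have /andP[_] := f1 a a; lra.
Qed.

End projection_diagonal.

(** * Expansion of the log-determinant *)

Lemma ln_prod_nat (R : realType) (f : nat -> R) k : (forall j, (j < k)%N -> 0 < f j) ->
  ln (\prod_(0 <= j < k) f j) = \sum_(0 <= j < k) ln (f j).
Proof.
elim: k => [|k IH] f0; first by rewrite !big_nil ln1.
rewrite !big_nat_recr //= lnM ?posrE ?f0 // ?IH // => [j jk|]; first by apply: f0; exact: ltnW.
by rewrite big_nat_cond prodr_gt0 // => j /andP[/andP[_ jk] _]; apply: f0; exact: ltnW.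
Qed.

Section logdet_expansion.
Context d (T : measurableType d) (R : realType) (P : probability T R).
Context (n p : nat) (n0 : (0 < n)%N) (pn : (p <= n)%N).
Context (u : 'I_p -> {RV P >-> n.-tuple R}).
Hypothesis u_sphere : forall i w, \sum_(k < n) tnth (u i w) k ^+ 2 = 1.
Hypothesis u_rot : forall i (O : 'M[R]_n), O^T *m O = 1%:M ->
  forall B, measurable B -> P ((fun w => rot O (u i w)) @^-1` B) = P (u i @^-1` B).
Hypothesis u_ind : mutually_independent P u.

Definition distsq_mean (j : nat) : R := (n - j)%:R / n%:R.

(** The variance of [reldev], that is of the squared distance divided by its mean and not of the
    squared distance itself. *)
Definition distsq_var (j : nat) : R := 2 * j%:R / ((n%:R + 2) * (n - j)%:R).

(** Extended by [0] from [p] on, so as to be a bounded variable for every natural number [j]. *)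
Definition reldev (j : nat) (w : T) : R :=
  if (j < p)%N then (distsq u j w - distsq_mean j) / distsq_mean j else 0.

Let nR : 0 < (n%:R : R). Proof. by rewrite ltr0n. Qed.

Lemma distsq_mean_gt0 j : (j < p)%N -> 0 < distsq_mean j.
Proof. by move=> jp; rewrite divr_gt0 // ltr0n subn_gt0 (leq_trans jp). Qed.

Lemma distsq_reldev j w : (j < p)%N -> distsq u j w = distsq_mean j * (1 + reldev j w).
Proof.
move=> jp; have m0 := distsq_mean_gt0 jp; rewrite /reldev jp; field.
by rewrite gt_eqF.
Qed.

Lemma brv_distsq j : (j < p)%N -> bounded_rv (distsq u j).
Proof.
move=> jp; split; first exact: measurable_distsq.
exists 1 => w; have /andP[d0 d1] := distsq01 u_sphere (Ordinal jp) w.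
by rewrite ger0_norm.
Qed.

Lemma brv_reldev j : bounded_rv (reldev j).
Proof.
rewrite /reldev; case: (boolP (j < p)%N) => jp; last exact: brv_cst.
apply: brvM; last exact: brv_cst.
by apply: brvB; [exact: brv_distsq|exact: brv_cst].
Qed.

Lemma sequentially_indep_reldev (h : nat -> R -> R) : (forall j, measurable_fun setT (h j)) ->
  sequentially_indep P p (fun j w => h j (reldev j w)).
Proof.
move=> mh.
pose h' j x := h j (if (j < p)%N then (x - distsq_mean j) / distsq_mean j else 0).
have mh' j : measurable_fun setT (h' j).
  rewrite /h'; case: (boolP (j < p)%N) => jp; last exact: measurable_cst.
  apply: (measurableT_comp (mh j)); apply: measurable_funM => //.
  exact: measurable_funB.
exact: (sequentially_indep_distsq u_rot u_ind mh').
Qed.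

Lemma Ex_reldev_pow (j : 'I_p) k :
  Ex P (fun w => reldev j w ^+ k) =
  (distsq_mean j)^-1 ^+ k * Ex P (fun w => tail_dev (u j) j w ^+ k).
Proof.
have bt : bounded_rv (tail_dev (u j) j) by exact: (brv_tail_dev (u_sphere j)).
rewrite -ExZ; last exact: brvX.
pose g x := ((x - distsq_mean j) / distsq_mean j) ^+ k.
have mg : measurable_fun setT g.
  by apply: measurable_funX; apply: measurable_funM => //; exact: measurable_funB.
have E1 : (fun w => reldev j w ^+ k) = fun w => g (distsq u j w).
  by apply/funext => w; rewrite /reldev ltn_ord.
have E2 : (fun w => (distsq_mean j)^-1 ^+ k * tail_dev (u j) j w ^+ k) =
    fun w => g (tail_sq j (u j w)).
  by apply/funext => w; rewrite /g /tail_dev -exprMn mulrC.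
rewrite E1 E2; apply: Ex_distsq => //; rewrite -?E1 -?E2.
- by apply: brvX; exact: brv_reldev.
- by apply: brvZ; exact: brvX.
Qed.

Lemma Ex_reldev j : (j < p)%N -> Ex P (reldev j) = 0.
Proof.
move=> jp; have jn : (j <= n)%N by rewrite (leq_trans _ pn) // ltnW.
have := Ex_reldev_pow (Ordinal jp) 1; rewrite /=.
have -> : Ex P (fun w => reldev j w ^+ 1) = Ex P (reldev j) by apply: eq_Ex => w; rewrite expr1.
have -> : Ex P (fun w => tail_dev (u (Ordinal jp)) j w ^+ 1) = Ex P (tail_dev (u (Ordinal jp)) j).
  by apply: eq_Ex => w; rewrite expr1.
by rewrite (Ex_tail_dev (u_sphere (Ordinal jp)) (@u_rot (Ordinal jp)) n0 jn) mulr0.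
Qed.

Lemma Ex_reldev2 j : (j < p)%N -> Ex P (fun w => reldev j w ^+ 2) = distsq_var j.
Proof.
move=> jp; have jn : (j <= n)%N by rewrite (leq_trans _ pn) // ltnW.
have m0 := distsq_mean_gt0 jp.
rewrite (Ex_reldev_pow (Ordinal jp) 2) /=.
rewrite (Ex_tail_dev2 (u_sphere (Ordinal jp)) (@u_rot (Ordinal jp)) n0 jn).
rewrite /distsq_mean in m0 *; rewrite /distsq_var natrB //.
have : (n%:R - j%:R : R) != 0 by rewrite -natrB // pnatr_eq0 -lt0n subn_gt0 (leq_trans jp).
have : (n%:R + 2 : R) != 0 by rewrite gt_eqF // addr_gt0.
have : (n%:R : R) != 0 by rewrite gt_eqF.
move: (n%:R : R) (j%:R : R) => x y x0 x2 xy.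
by field; rewrite x0 x2 xy.
Qed.

Lemma Ex_reldev4 j : (j < p)%N ->
  Ex P (fun w => reldev j w ^+ 4) <= (distsq_mean j)^-1 ^+ 4 * (3 / (4 * n%:R ^+ 2)).
Proof.
move=> jp; have jn : (j <= n)%N by rewrite (leq_trans _ pn) // ltnW.
have m0 := distsq_mean_gt0 jp.
rewrite (Ex_reldev_pow (Ordinal jp) 4) /=; apply: ler_wpM2l.
  by rewrite exprn_ge0 // invr_ge0 ltW.
exact: (Ex_tail_dev4 (u_sphere (Ordinal jp)) (@u_rot (Ordinal jp)) n0 jn).
Qed.

(** The subtracted half-sum is the mean of the quadratic terms in the expansion of the
    logarithms. *)
Definition logdet_center (m : R) : R :=
  p%:R * ln m + \sum_(0 <= j < p) ln (distsq_mean j) - (\sum_(0 <= j < p) distsq_var j) / 2.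

(** No logarithm is integrated: the estimate is pointwise, on the event where the fourth powers are
    small, and only [Y] is averaged. [Y] adds up the cubic Taylor remainders, the fluctuation of the
    quadratic terms, the linear effect of the weights and the constant [2 * D] for their quadratic
    effect. The parameter [e] is that of the arithmetic-geometric inequalities. *)
Lemma logdet_expansion (m e : R) (c : 'I_n -> R) : 0 < m -> 0 < e ->
  (forall k, `|c k| <= 2^-1) -> \sum_k c k = 0 ->
  let K := \sum_(0 <= j < p) Ex P (fun w => reldev j w ^+ 4) in
  let V := \sum_(0 <= j < p) distsq_var j in
  let D := \sum_k c k ^+ 2 in
  exists Y : T -> R, [/\ bounded_rv Y, forall w, 0 <= Y w,
    Ex P Y <= (e * V + K / e) / 2 + (e + K / e) / 4 + ((e + D / e) / 2 + 2 * D) &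
    forall w, \sum_(0 <= j < p) reldev j w ^+ 4 < 16^-1 ->
      `|ln (\det (umx (full u w) *m diag_mx (\row_k (m * (1 + c k))) *m (umx (full u w))^T))
        - logdet_center m - \sum_(0 <= j < p) reldev j w| <= Y w].
Proof.
move=> m0 e0 c2 csum K V D.
pose Y1 w := \sum_(0 <= j < p) `|reldev j w| ^+ 3.
pose h j (x : R) := if (j < p)%N then x ^+ 2 - distsq_var j else 0.
pose S2 w := \sum_(0 <= j < p) h j (reldev j w).
pose Q w := \sum_k c k * proj_diag k (full u w).
have bZ := brv_reldev.
have bY1 : bounded_rv Y1 by apply: brv_sum => j; apply: brvX; exact: brv_norm.
have bh j : bounded_rv (fun w => h j (reldev j w)).
  rewrite /h; case: (boolP (j < p)%N) => _; last exact: brv_cst.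
  by apply: brvB; [exact: brvX|exact: brv_cst].
have bS2 : bounded_rv S2 by exact: brv_sum.
have bQ : bounded_rv Q by apply: brv_sum => k; apply: brvZ; exact: brv_proj_diag.
have D0 : 0 <= D by apply: sumr_ge0 => k _; exact: sqr_ge0.
exists (fun w => Y1 w + (2^-1 * `|S2 w| + (`|Q w| + 2 * D))); split.
- apply: brvD => //; apply: brvD; first by apply: brvZ; exact: brv_norm.
  by apply: brvD; [exact: brv_norm|exact: brv_cst].
- move=> w; rewrite !addr_ge0 ?mulr_ge0 //.
  by apply: sumr_ge0 => j _; rewrite exprn_ge0.
- have b1 : bounded_rv (fun w => 2^-1 * `|S2 w|) by apply: brvZ; exact: brv_norm.
  have b2 : bounded_rv (fun w => `|Q w|) by exact: brv_norm.
  have b3 : bounded_rv (fun w => `|Q w| + 2 * D) by apply: brvD => //; exact: brv_cst.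
  have b4 := brvD b1 b3.
  rewrite (ExD P bY1 b4) (ExD P b1 b3) (ExD P b2 (brv_cst T (2 * D))) Ex_cst.
  rewrite (ExZ P 2^-1 (brv_norm bS2)).
  have E1 : Ex P Y1 <= (e * V + K / e) / 2.
    rewrite Ex_sum; last by move=> j; apply: brvX; exact: brv_norm.
    have -> : (e * V + K / e) / 2 = \sum_(0 <= j < p)
        (e * distsq_var j + Ex P (fun w => reldev j w ^+ 4) / e) / 2.
      by rewrite -mulr_suml big_split /= -mulr_sumr -mulr_suml.
    rewrite big_nat_cond [leRHS]big_nat_cond; apply: ler_sum => j /andP[/andP[_ jp] _].
    by have := Ex_cube_le P (bZ j) e0; rewrite Ex_reldev2.
  (* The centred squares inherit sequential independence, so the second moment of their sum is a sum
     of variances, at most the sum [K] of fourth moments. *)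
  have E2 : Ex P (fun w => `|S2 w|) <= (e + K / e) / 2.
    apply: le_trans (Ex_abs_le P bS2 e0) _.
    apply: ler_wpM2r => //; rewrite lerD2l; apply: ler_wpM2r; first by rewrite invr_ge0 ltW.
    have mh j : measurable_fun setT (h j).
      rewrite /h; case: (boolP (j < p)%N) => _ //.
      by apply: measurable_funB => //; exact: exprn_measurable.
    have SI := sequentially_indep_reldev mh.
    have EhE j : (j < p)%N -> Ex P (fun w => h j (reldev j w)) = 0.
      move=> jp; rewrite /h jp ExB; [|exact: brvX|exact: brv_cst].
      by rewrite Ex_reldev2 // Ex_cst subrr.
    rewrite (Ex_sum_sqr bh SI EhE) big_nat_cond [leRHS]big_nat_cond.
    apply: ler_sum => j /andP[/andP[_ jp] _].
    rewrite /h jp.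
    have -> : Ex P (fun w => (reldev j w ^+ 2 - distsq_var j) ^+ 2) =
        Ex P (fun w => reldev j w ^+ 4) - distsq_var j ^+ 2.
      have -> : Ex P (fun w => (reldev j w ^+ 2 - distsq_var j) ^+ 2) =
          Ex P (fun w => reldev j w ^+ 4 +
            ((- 2 * distsq_var j) * reldev j w ^+ 2 + distsq_var j ^+ 2)).
        by apply: eq_Ex => w; ring.
      have bq : bounded_rv (fun w => - 2 * distsq_var j * reldev j w ^+ 2).
        by apply: brvZ; exact: brvX.
      have bq2 := brvD bq (brv_cst T (distsq_var j ^+ 2)).
      rewrite (ExD P (brvX 4 (bZ j)) bq2) (ExD P bq (brv_cst T _)) Ex_cst.
      by rewrite (ExZ P _ (brvX 2 (bZ j))) Ex_reldev2 //; ring.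
    by rewrite gerBl sqr_ge0.
  have E3 : Ex P (fun w => `|Q w|) <= (e + D / e) / 2.
    apply: le_trans (Ex_abs_le P bQ e0) _.
    apply: ler_wpM2r => //; rewrite lerD2l; apply: ler_wpM2r; first by rewrite invr_ge0 ltW.
    exact: (Ex_weighted_diag u_rot u_ind csum).
  lra.
move=> w Zs.
(* Each fourth power is below [16^-1 = 2^-1 ^+ 4]. The deviations are then in the range of the
   Taylor estimate and all distances are positive. *)
have Z2 j : (j < p)%N -> `|reldev j w| <= 2^-1.
  move=> jp; have : reldev j w ^+ 4 < 16^-1.
    apply: le_lt_trans Zs; rewrite (bigD1_seq j) ?mem_index_iota ?iota_uniq //= lerDl.
    by apply: sumr_ge0 => i _; rewrite -[4%N]/(2 * 2)%N exprM sqr_ge0.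
  move=> H; rewrite leNgt; apply/negP => Z1.
  have : 2^-1 ^+ 4 < `|reldev j w| ^+ 4 by rewrite ltrXn2r // ?nnegrE ?invr_ge0.
  rewrite -normrX ger0_norm; last by rewrite -[4%N]/(2 * 2)%N exprM sqr_ge0.
  have -> : (2^-1 : R) ^+ 4 = 16^-1 by field.
  lra.
have Zpos j : (j < p)%N -> 0 < 1 + reldev j w.
  by move=> /Z2; rewrite ler_norml => /andP[]; lra.
have d0 j : (j < p)%N -> 0 < distsq u j w.
  by move=> jp; rewrite distsq_reldev // mulr_gt0 ?distsq_mean_gt0 ?Zpos.
have detE := gram_distsq d0.
have G0 : 0 < \det (umx (full u w) *m (umx (full u w))^T).
  rewrite detE big_nat_cond prodr_gt0 // => j /andP[/andP[_ jp] _]; exact: d0.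
have G0' : \det (umx (full u w) *m (umx (full u w))^T) != 0 by rewrite gt_eqF.
have [_ _ LW] := ln_det_weighted G0' m0 c2.
have QE : Q w = \sum_k c k * rowproj (umx (full u w)) k k.
  by apply: eq_bigr => k _; rewrite /proj_diag (negbTE G0').
rewrite -QE detE ln_prod_nat // in LW.
have lnE : \sum_(0 <= j < p) ln (distsq u j w) =
    \sum_(0 <= j < p) ln (distsq_mean j) + \sum_(0 <= j < p) ln (1 + reldev j w).
  rewrite -big_split /= big_nat_cond [RHS]big_nat_cond.
  apply: eq_bigr => j /andP[/andP[_ jp] _].
  by rewrite distsq_reldev // lnM // posrE ?distsq_mean_gt0 ?Zpos.
rewrite lnE in LW.
have TL : `|\sum_(0 <= j < p) ln (1 + reldev j w) - \sum_(0 <= j < p) reldev j w +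
    (\sum_(0 <= j < p) reldev j w ^+ 2) / 2| <= Y1 w.
  have -> : \sum_(0 <= j < p) ln (1 + reldev j w) - \sum_(0 <= j < p) reldev j w +
      (\sum_(0 <= j < p) reldev j w ^+ 2) / 2 = \sum_(0 <= j < p)
     (ln (1 + reldev j w) - reldev j w + reldev j w ^+ 2 / 2).
    by rewrite big_split /= sumrB mulr_suml.
  apply: le_trans (ler_norm_sum _ _ _) _.
  rewrite big_nat_cond [leRHS]big_nat_cond; apply: ler_sum => j /andP[/andP[_ jp] _].
  exact: ln1D_taylor2 (Z2 j jp).
have SE : S2 w = \sum_(0 <= j < p) reldev j w ^+ 2 - V.
  rewrite /S2 /V -sumrB big_nat_cond [RHS]big_nat_cond.
  by apply: eq_bigr => j /andP[/andP[_ jp] _]; rewrite /h jp.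
rewrite /logdet_center -/V.
move: LW TL SE.
set s1 := \sum_(0 <= j < p) ln (1 + _); set s2 := \sum_(0 <= j < p) reldev j w.
set s3 := \sum_(0 <= j < p) _ ^+ 2; set s4 := \sum_(0 <= j < p) ln (distsq_mean j).
set L := ln (\det _); set q := Q w; set s := S2 w => LW TL SE.
have -> : L - (p%:R * ln m + s4 - V / 2) - s2 =
   (s1 - s2 + s3 / 2) + (- (2^-1 * s) + (q + (L - (p%:R * ln m + (s4 + s1) + q)))).
  by rewrite SE; field.
apply: le_trans (ler_normD _ _) _; apply: lerD => //.
apply: le_trans (ler_normD _ _) _; apply: lerD.
  by rewrite normrN normrM ger0_norm.
by apply: le_trans (ler_normD _ _) _; rewrite lerD2l.
Qed.

End logdet_expansion.

(** * The weights *)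

Section iid_law_facts.
Context d (T : measurableType d) (R : realType) (P : probability T R).

Lemma iid_lawS n (A : set (n.+1.-tuple T)) :
  iid_law P n.+1 A = (P \x iid_law P n)%E (@cons_pair _ T n @^-1` A).
Proof. by []. Qed.

Lemma iid_law_rectangle n (B : 'I_n -> set T) : (forall i, measurable (B i)) ->
  iid_law P n (rectangle B) = (\prod_(i < n) P (B i))%E.
Proof.
elim: n B => [|n IH] B mB.
  rewrite big_ord0 /= diracE mem_set //.
  by move=> [].
rewrite iid_lawS.
have -> : @cons_pair _ T n @^-1` rectangle B =
    B ord0 `*` rectangle (fun i => B (lift ord0 i)).
  apply/seteqP; split => -[w W] /=.
    move=> BW; split; first by have := BW ord0; rewrite tnth0.
    by move=> i /=; have := BW (lift ord0 i); rewrite tnthS.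
  move=> [Bw BW] i; have [j ->|->] := unliftP ord0 i; last by rewrite tnth0.
  by rewrite tnthS; exact: BW.
have mr : measurable (rectangle (fun i => B (lift ord0 i))).
  by apply: measurable_rectangle => i; exact: mB.
transitivity (P (B ord0) * iid_law P n (rectangle (fun i => B (lift ord0 i))))%E.
  exact: product_measure1E.
by rewrite IH // big_ord_recl.
Qed.

Definition tperm_tuple n (s : 'S_n) (W : n.-tuple T) : n.-tuple T :=
  [tuple tnth W (s k) | k < n].

Lemma measurable_tperm_tuple n (s : 'S_n) : measurable_fun setT (@tperm_tuple n s).
Proof.
apply/measurable_fun_tnthP => i; rewrite (_ : _ \o _ = fun W => tnth W (s i)).
  exact: measurable_tnth.
by apply/funext => W /=; rewrite tnth_mktuple.
Qed.

Lemma iid_law_perm n (s : 'S_n) (A : set (n.-tuple T)) : measurable A ->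
  iid_law P n (tperm_tuple s @^-1` A) = iid_law P n A.
Proof.
move=> mA; have [X XE] := mfun_of (measurable_tperm_tuple s).
rewrite -XE.
apply: (@tuple_measure_ext _ _ _ _ (distribution (iid_law P n) X) (iid_law P n)) => //.
  by apply: le_lt_trans (probability_le1 _ _) _ => //; exact: ltry.
move=> B mB; transitivity (iid_law P n (X @^-1` rectangle B)); first by [].
have -> : X @^-1` rectangle B = rectangle (fun i => B ((s^-1)%g i)).
  rewrite XE; apply/seteqP; split => W /= BW i.
    by have := BW ((s^-1)%g i); rewrite tnth_mktuple permKV.
  by rewrite tnth_mktuple; have := BW (s i); rewrite permK.
rewrite [RHS]iid_law_rectangle // iid_law_rectangle // (reindex_inj (@perm_inj _ s)).
by apply: eq_bigr => i _; rewrite permK.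
Qed.

(** Fubini in the first coordinate. Both nonsingularity statements on Gaussian samples below are
    inductions through this lemma. *)
Lemma iid_law_null n (A : set (n.+1.-tuple T)) (N : set T) : measurable A ->
  measurable N -> P N = 0%E ->
  (forall w, ~ N w -> iid_law P n [set W : n.-tuple T | A [tuple of w :: W]] = 0%E) ->
  iid_law P n.+1 A = 0%E.
Proof.
move=> mA mN PN0 sec; rewrite iid_lawS.
have mcA : measurable (@cons_pair _ T n @^-1` A).
  by rewrite -[_ @^-1` _]setTI; exact: measurable_cons_pair.
rewrite /product_measure1 -(integral0 P setT); apply: ae_eq_integral => //.
  exact: measurable_fun_xsection.
exists N; split=> // w /= nsec; apply: contrapT => Nw; apply: nsec => _.
rewrite /= -(sec w Nw); congr (iid_law P n _).
by apply/seteqP; split => W; rewrite /xsection /= inE.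
Qed.

End iid_law_facts.

Lemma measurable_level d (T : measurableType d) (R : realType) (f : T -> R) (c : R) :
  measurable_fun setT f -> measurable [set x | f x = c].
Proof.
by move=> mf; have := mf measurableT _ (measurable_set1 c); rewrite setTI.
Qed.

Section gaussian_nondegenerate.
Context (R : realType).

Lemma std_normal_set1 (a : R) : std_normal R [set a] = 0%E.
Proof.
rewrite /std_normal /distribution /pushforward /=.
have /null_content_dominatesP H := @normal_prob_dominates R 0 1.
have E : (@idTR R) @^-1` [set a] = [set a] by [].
rewrite E; apply: (H [set a]); first exact: measurable_set1.
exact: (lebesgue_measure_set1 a).
Qed.

Lemma measurable_lin n (v : 'I_n -> R) :
  measurable_fun setT (fun w : n.-tuple R => \sum_k v k * tnth w k).
Proof.
by apply: measurable_sum => k; apply: measurable_funM => //; exact: measurable_tnth.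
Qed.

(** If some coefficient besides the first is nonzero, every section is again a hyperplane; otherwise
    the first coordinate is confined to a single point, which has probability zero. *)
Lemma std_gaussian_hyperplane n (v : 'I_n -> R) (a : R) : (exists k, v k != 0) ->
  std_gaussian R n [set w | \sum_k v k * tnth w k = a] = 0%E.
Proof.
elim: n v a => [|n IH] v a [k vk]; first by case: k vk.
have mA : measurable [set w : n.+1.-tuple R | \sum_k v k * tnth w k = a].
  by apply: measurable_level; exact: measurable_lin.
have secE w0 (W : n.-tuple R) : \sum_j v j * tnth [tuple of w0 :: W] j =
    v ord0 * w0 + \sum_j v (lift ord0 j) * tnth W j.
  rewrite big_ord_recl tnth0; congr (_ + _); apply: eq_bigr => j _.
  by rewrite tnthS.
have [[j vj]|no] := pselect (exists j, v (lift ord0 j) != 0).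
  apply: (@iid_law_null _ _ _ _ _ _ set0) => // w0 _.
  rewrite -[RHS](IH (fun j => v (lift ord0 j)) (a - v ord0 * w0)); last by exists j.
  congr (std_gaussian R n _); apply/seteqP; split => W /=; rewrite secE.
    by move=> H; lra.
  by move=> H; lra.
have v0 j : v (lift ord0 j) = 0.
  by apply/eqP/negPn/negP => vj; apply: no; exists j.
have v00 : v ord0 != 0.
  by move: vk; have [j ->|->] := unliftP ord0 k; rewrite ?v0 ?eqxx.
apply: (@iid_law_null _ _ _ _ _ _ [set a / v ord0]) => //.
  exact: std_normal_set1.
move=> w0 /= w0a; rewrite (_ : [set W | _] = set0) ?measure0 //.
apply/seteqP; split => // W /=; rewrite secE big1 => [|j _]; last by rewrite v0 mul0r.
by rewrite addr0 => H; apply: w0a; rewrite -H; field.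
Qed.

Definition psd n (B : 'M[R]_n) := B^T = B /\ forall x : 'rV[R]_n, 0 <= qform B x.

(** With [y = x *m B], the form at [x + t *: y] is [2 * t * sqnorm y + t ^+ 2 * qform B y], which is
    negative for small negative [t] unless [y = 0]. *)
Lemma psd_qform0 n (B : 'M[R]_n) (x : 'rV[R]_n) : psd B -> qform B x = 0 -> x *m B = 0.
Proof.
move=> [Bs B0] x0; set y := x *m B.
have Q0 := B0 y.
have H (t : R) : 0 <= 2 * t * sqnorm y + t ^+ 2 * qform B y.
  have -> : 2 * t * sqnorm y + t ^+ 2 * qform B y = qform B (x + t *: y).
    pose b (e f : 'rV[R]_n) := (e *m B *m f^T) 0 0.
    have bD e f g : b (e + f) g = b e g + b f g by rewrite /b !mulmxDl mxE.
    have bZ k e f : b (k *: e) f = k * b e f by rewrite /b -!scalemxAl mxE.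
    have bC e f : b e f = b f e.
      have E : f *m B *m e^T = (e *m B *m f^T)^T by rewrite !trmx_mul trmxK Bs mulmxA.
      by rewrite /b E [RHS]mxE.
    have bxy : b x y = sqnorm y by [].
    have bxx : b x x = 0 by exact: x0.
    rewrite -[RHS]/(b (x + t *: y) (x + t *: y)) bD bZ.
    rewrite (bC x (x + t *: y)) (bC y (x + t *: y)) !bD !bZ bxx (bC y x) bxy.
    by have -> : qform B y = b y y by []; ring.
  exact: B0.
apply/eqP; rewrite -sqnorm_eq0 eq_le sqnorm_ge0 andbT leNgt; apply/negP => y0.
have q1 : 0 < qform B y + 1 by lra.
have := H (- (sqnorm y / (qform B y + 1))).
have -> : 2 * - (sqnorm y / (qform B y + 1)) * sqnorm y +
   (- (sqnorm y / (qform B y + 1))) ^+ 2 * qform B y =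
   - (sqnorm y ^+ 2 / (qform B y + 1)) * ((qform B y + 2) / (qform B y + 1)).
  by field; rewrite gt_eqF.
have p1 : 0 < sqnorm y ^+ 2 / (qform B y + 1) by rewrite divr_gt0 // exprn_gt0.
have p2 : 0 < (qform B y + 2) / (qform B y + 1) by rewrite divr_gt0 //; lra.
by have := mulr_gt0 p1 p2; lra.
Qed.

Lemma psd_det0 n (B : 'M[R]_n) : \rank (kermx B) = 0%N -> \det B != 0.
Proof.
move=> /eqP; rewrite mxrank_ker subn_eq0 => rB.
by rewrite -unitfE -unitmxE -row_free_unit /row_free eqn_leq rank_leq_row.
Qed.

Definition outer n (w : n.-tuple R) : 'M[R]_n := vec w *m (vec w)^T.

Lemma qform_outer n (w : n.-tuple R) x : qform (outer w) x = (\sum_k x 0 k * tnth w k) ^+ 2.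
Proof.
rewrite /qform /outer !mulmxA -mulmxA -trmx_mul.
have -> : (x *m vec w) = (\sum_k x 0 k * tnth w k)%:M.
  by rewrite [LHS]mx11_scalar; congr (_%:M); rewrite mxE; apply: eq_bigr => k _; rewrite mxE.
by rewrite tr_scalar_mx -scalar_mxM mxE eqxx mulr1n expr2.
Qed.

Lemma outer_sym n (w : n.-tuple R) : (outer w)^T = outer w.
Proof. by rewrite /outer trmx_mul trmxK. Qed.

Lemma qformD n (A B : 'M[R]_n) x : qform (A + B) x = qform A x + qform B x.
Proof. by rewrite /qform mulmxDr mulmxDl mxE. Qed.

Lemma qformZ n (c : R) (A : 'M[R]_n) x : qform (c *: A) x = c * qform A x.
Proof. by rewrite /qform -scalemxAr -scalemxAl mxE. Qed.

Lemma qform_sum n (I : finType) (Q : pred I) (F : I -> 'M[R]_n) x :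
  qform (\sum_(i | Q i) F i) x = \sum_(i | Q i) qform (F i) x.
Proof.
apply: (big_morph (fun A => qform A x)) => [A B|]; first exact: qformD.
by rewrite /qform mulmx0 mul0mx mxE.
Qed.

Lemma psd_add_outer n (B : 'M[R]_n) (c : R) w : 0 <= c -> psd B -> psd (B + c *: outer w).
Proof.
move=> c0 [Bs B0]; split.
  by rewrite linearD /= linearZ /= Bs outer_sym.
by move=> x; rewrite qformD qformZ qform_outer addr_ge0 // mulr_ge0 // sqr_ge0.
Qed.

Lemma mx_measurable_outer_sum i n (c : 'I_n -> R) (B : 'M[R]_i) :
  mx_measurable (fun W : n.-tuple (i.-tuple R) => B + \sum_l c l *: outer (tnth W l)).
Proof.
move=> a b; rewrite (_ : (fun W => _) = fun W : n.-tuple (i.-tuple R) =>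
  B a b + \sum_l c l * (tnth (tnth W l) a * tnth (tnth W l) b)).
  apply: measurable_funD => //; apply: measurable_sum => l; apply: measurable_funM => //.
  have m1 (j : 'I_i) : measurable_fun setT (fun W : n.-tuple (i.-tuple R) => tnth (tnth W l) j).
    apply: (measurableT_comp (measurable_tnth j)); exact: measurable_tnth.
  exact: measurable_funM.
apply/funext => W; rewrite mxE summxE; congr (_ + _); apply: eq_bigr => l _.
by rewrite mxE; congr (_ * _); rewrite mxE big_ord1 !mxE.
Qed.

(* Each new vector almost surely avoids a hyperplane containing the kernel's
   orthogonal complement, so it lowers the dimension of the kernel by one. *)
Lemma gaussian_sum_nonsingular i n (c : 'I_n -> R) (B : 'M[R]_i) : psd B ->
  (forall k, 0 <= c k) -> (\rank (kermx B) <= \sum_(k < n) (0 < c k)%R)%N ->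
  iid_law (std_gaussian R i) n
    [set W | \det (B + \sum_l c l *: outer (tnth W l)) = 0] = 0%E.
Proof.
have mD n' (c' : 'I_n' -> R) (B' : 'M[R]_i) : measurable
    [set W : n'.-tuple (i.-tuple R) | \det (B' + \sum_l c' l *: outer (tnth W l)) = 0].
  by apply: measurable_level; exact: (measurable_det (mx_measurable_outer_sum c' B')).
elim: n c B => [|n IH] c B pB c0 rB.
  rewrite (_ : [set W | _] = set0) ?measure0 //; apply/seteqP; split => // W /=.
  rewrite big_ord0 addr0 => d0; move: rB; rewrite big_ord0 leqn0 => /eqP/psd_det0.
  by rewrite d0 eqxx.
have secE w (W : n.-tuple (i.-tuple R)) :
    B + \sum_l c l *: outer (tnth [tuple of w :: W] l) =
    (B + c ord0 *: outer w) + \sum_l c (lift ord0 l) *: outer (tnth W l).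
  rewrite big_ord_recl tnth0 addrA; congr (_ + _); apply: eq_bigr => l _.
  by rewrite tnthS.
(* The first vector is absorbed into the initial matrix, which is why the statement allows an
   arbitrary semidefinite [B]. *)
have step w : (\rank (kermx (B + c ord0 *: outer w)) <= \sum_(k < n) (0 < c (lift ord0 k))%R)%N ->
    iid_law (std_gaussian R i) n [set W : n.-tuple (i.-tuple R) | [set W' : n.+1.-tuple (i.-tuple R) |
      \det (B + \sum_l c l *: outer (tnth W' l)) = 0] [tuple of w :: W]] = 0%E.
  move=> rw; have pB' : psd (B + c ord0 *: outer w) by exact: psd_add_outer.
  rewrite -[RHS](IH (fun k => c (lift ord0 k)) _ pB' (fun k => c0 _) rw).
  by congr (iid_law _ _ _); apply/seteqP; split => W /=; rewrite secE.
rewrite big_ord_recl in rB.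
have [c00|c00] := boolP (0 < c ord0); last first.
  apply: (@iid_law_null _ _ _ _ _ _ set0) => // w _; apply: step.
  have -> : c ord0 = 0 by apply/eqP; rewrite eq_le c0 andbT leNgt.
  by rewrite scale0r addr0 (leq_trans rB) // (negbTE c00).
have kerS w : (kermx (B + c ord0 *: outer w) <= kermx B)%MS.
  apply/rV_subP => x /sub_kermxP xB'; apply/sub_kermxP; apply: psd_qform0 => //.
  have : qform (B + c ord0 *: outer w) x = 0 by rewrite /qform xB' mul0mx mxE.
  rewrite qformD qformZ qform_outer => /eqP.
  have [_ B0] := pB; rewrite paddr_eq0 //; first by move=> /andP[/eqP].
  by rewrite mulr_ge0 ?sqr_ge0.
have [k0|k0] := eqVneq (\rank (kermx B)) 0%N.
  apply: (@iid_law_null _ _ _ _ _ _ set0) => // w _; apply: step.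
  by have := mxrankS (kerS w); rewrite k0 leqn0 => /eqP ->.
have kn0 : kermx B != 0 by rewrite -mxrank_eq0.
pose v := nz_row (kermx B).
have v0 : v != 0 by rewrite nz_row_eq0.
have vk : (v <= kermx B)%MS by exact: nz_row_sub.
apply: (@iid_law_null _ _ _ _ _ _ [set w | \sum_k v 0 k * tnth w k = 0]) => //.
- by apply: measurable_level; exact: (measurable_lin (fun k => v 0 k)).
- apply: std_gaussian_hyperplane; apply: contrapT => no; move/eqP: v0; apply.
  apply/rowP => k; rewrite mxE; apply/eqP/negPn/negP => vk0; apply: no.
  by exists k.
move=> w /= vw; apply: step.
rewrite c00 in rB; rewrite -ltnS; apply: leq_trans rB.
apply: rank_ltmx; rewrite /ltmx kerS /=.
(* If the kernel did not shrink, [v] would stay in it, forcing the pairing of [v] and [w] to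
   vanish. *)
apply/negP => kS; have /sub_kermxP vB' := submx_trans vk kS.
have : qform (B + c ord0 *: outer w) v = 0 by rewrite /qform vB' mul0mx mxE.
rewrite qformD qformZ qform_outer => /eqP.
have [_ B0] := pB; rewrite paddr_eq0 //; last by rewrite mulr_ge0 ?sqr_ge0.
by rewrite mulf_eq0 (gt_eqF c00) /= sqrf_eq0 => /andP[_ /eqP].
Qed.

End gaussian_nondegenerate.

Section weight_analysis.
Context (R : realType) (n i : nat) (lam : 'I_n -> R) (C : R).
Hypotheses (C1 : 1 <= C) (lamC : forall k, C^-1 <= lam k <= C) (i_n : (i < n)%N).

Notation sample := (n.-tuple (i.-tuple R)).
Notation P := (iid_law (std_gaussian R i) n).

Let C0 : 0 < C. Proof. by apply: lt_le_trans C1. Qed.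
Let lam0 k : 0 < lam k.
Proof. by have /andP[+ _] := lamC k; apply: lt_le_trans; rewrite invr_gt0. Qed.

Definition weight_rv (k : 'I_n) (W : sample) : R := (1 + lam k * quad_form lam k W)^-1.

Lemma leave_one_outE k (W : sample) :
  leave_one_out lam k W = 0 + \sum_l (if l == k then 0 else lam l) *: outer (tnth W l).
Proof.
rewrite add0r /leave_one_out big_mkcond; apply: eq_bigr => l _.
by case: eqP; rewrite ?scale0r.
Qed.

Let psd0 : psd (0 : 'M[R]_i).
Proof.
by split; [rewrite trmx0|move=> x; rewrite /qform mulmx0 mul0mx mxE].
Qed.

Lemma psd_outer_sum (m : nat) (c : 'I_m -> R) (W : m.-tuple (i.-tuple R)) :
  (forall l, 0 <= c l) -> psd (\sum_l c l *: outer (tnth W l)).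
Proof.
move=> c0; apply: (big_ind (@psd R i)) => //.
- move=> A B [As A0] [Bs B0]; split; first by rewrite linearD /= As Bs.
  by move=> x; rewrite qformD addr_ge0.
- by move=> l _; rewrite -[_ *: _]add0r; exact: psd_add_outer.
Qed.

Lemma psd_loo k (W : sample) : psd (leave_one_out lam k W).
Proof.
rewrite leave_one_outE add0r; apply: psd_outer_sum => l.
by case: ifP => // _; exact: ltW.
Qed.

Lemma psd_unit_posdef m (B : 'M[R]_m) : psd B -> B \in unitmx -> posdef B.
Proof.
move=> pB Bu; split; first by case: pB.
move=> x x0; rewrite lt0r; have [_ -> //] := pB; rewrite andbT.
apply: contra x0 => /eqP /(psd_qform0 pB) xB.
by rewrite -(mulmxK Bu x) xB mul0mx.
Qed.

Definition rv_of (w : i.-tuple R) : 'rV[R]_i := (vec w)^T.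

Lemma quad_formE k (W : sample) :
  quad_form lam k W = qform (invmx (leave_one_out lam k W)) (rv_of (tnth W k)).
Proof. by rewrite /quad_form /qform /rv_of trmxK. Qed.

Lemma quad_form_ge0 k (W : sample) : 0 <= quad_form lam k W.
Proof.
rewrite quad_formE; have pA := psd_loo k W.
have [Au|nu] := boolP (leave_one_out lam k W \in unitmx).
  have pd := posdef_inv (psd_unit_posdef pA Au).
  have [->|x0] := eqVneq (rv_of (tnth W k)) 0.
    by rewrite /qform !mul0mx mxE.
  by case: pd => _ /(_ _ x0)/ltW.
(* On a singular matrix [invmx] returns the matrix itself, which is still positive semidefinite; the
   weights are therefore bounded on all samples. *)
by rewrite /invmx (negbTE nu); case: pA.
Qed.

Lemma weight_rv01 k W : 0 <= weight_rv k W <= 1.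
Proof.
have q0 : 0 <= lam k * quad_form lam k W by rewrite mulr_ge0 ?quad_form_ge0 // ltW.
by rewrite /weight_rv invr_ge0 invf_le1; lra.
Qed.

Lemma mx_measurable_loo k : mx_measurable (fun W : sample => leave_one_out lam k W).
Proof.
have := mx_measurable_outer_sum (fun l => if l == k then 0 else lam l) (0 : 'M[R]_i).
by congr mx_measurable; apply/funext => W; rewrite leave_one_outE.
Qed.

Lemma measurable_weight_rv k : measurable_fun setT (weight_rv k).
Proof.
apply: (measurableT_comp (@measurable_inv R)); apply: measurable_funD => //.
apply: measurable_funM => //.
have mw : mx_measurable (fun W : sample => vec (tnth W k)).
  move=> a b; rewrite (_ : (fun W => _) = fun W : sample => tnth (tnth W k) a).
    apply: (measurableT_comp (measurable_tnth a)); exact: measurable_tnth.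
  by apply/funext => W; rewrite mxE.
exact: (mx_measurable_mul (mx_measurable_mul (mx_measurable_tr mw)
  (mx_measurable_inv (mx_measurable_loo k))) mw).
Qed.

Lemma brv_weight_rv k : bounded_rv (weight_rv k).
Proof.
split; first exact: measurable_weight_rv.
by exists 1 => W; have /andP[w0 w1] := weight_rv01 k W; rewrite ger0_norm.
Qed.

Lemma t_Ex k : t_ lam i k = Ex P (weight_rv k).
Proof. by rewrite /t_ /Ex /Rintegral unlock. Qed.

Lemma t_01 k : 0 <= t_ lam i k <= 1.
Proof.
rewrite t_Ex; apply/andP; split.
  by apply: Ex_ge0 => W; have /andP[] := weight_rv01 k W.
rewrite -[leRHS](Ex_cst P 1); apply: Ex_le; [exact: brv_weight_rv|exact: brv_cst|].
by move=> W; have /andP[] := weight_rv01 k W.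
Qed.

Lemma loo_det0_null k : P [set W | \det (leave_one_out lam k W) = 0] = 0%E.
Proof.
have -> : [set W : sample | \det (leave_one_out lam k W) = 0] =
    [set W : sample | \det (0 + \sum_l (if l == k then 0 else lam l) *: outer (tnth W l)) = 0].
  by apply/seteqP; split => W /=; rewrite leave_one_outE.
apply: gaussian_sum_nonsingular => //.
  by move=> l; case: ifP => // _; exact: ltW.
(* The kernel of the zero matrix has dimension at most [i], and the [n - 1 >= i] vectors other than
   the k-th have positive coefficients. *)
apply: (leq_trans (rank_leq_row _)).
rewrite (bigD1 k) //= eqxx ltxx add0n.
rewrite (eq_bigr (fun=> 1%N)) => [|l lk]; last by rewrite (negbTE lk) lam0.
by rewrite sum1_card cardC1 card_ord -ltnS (ltn_predK i_n).
Qed.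

Definition degenerate : set sample :=
  \bigcup_(k in [set: 'I_n]) [set W | \det (leave_one_out lam k W) = 0].

Lemma measurable_degenerate : measurable degenerate.
Proof.
apply: fin_bigcup_measurable => // k _; apply: measurable_level.
exact: (measurable_det (mx_measurable_loo k)).
Qed.

Lemma degenerate_null : P degenerate = 0%E.
Proof.
have -> : degenerate = \big[setU/set0]_(k < n) [set W | \det (leave_one_out lam k W) = 0].
  rewrite -bigcup_seq; apply/seteqP; split => W [k _ dk]; exists k => //=.
  exact: mem_index_enum.
apply: measure_negligible.
  by apply: bigsetU_measurable => k _; apply: measurable_level;
    exact: (measurable_det (mx_measurable_loo k)).
apply: (big_ind (negligible P)) => [|A B|k _]; [exact: negligible_set0|exact: negligibleU|].
apply/negligibleP; last exact: loo_det0_null.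
by apply: measurable_level; exact: (measurable_det (mx_measurable_loo k)).
Qed.

Lemma nondegenerate_unit W k : ~ degenerate W -> posdef (leave_one_out lam k W).
Proof.
move=> nd; apply: psd_unit_posdef; first exact: psd_loo.
by rewrite unitmxE unitfE; apply/eqP => d0; apply: nd; exists k.
Qed.

Lemma qform_rank_one_le m (B : 'M[R]_m) (x w : 'rV[R]_m) (c : R) :
  (forall y : 'rV[R]_m, c * ((y *m w^T) 0 0) ^+ 2 <= qform B y) -> B \in unitmx ->
  0 < c -> c * ((x *m invmx B *m w^T) 0 0) ^+ 2 <= qform (invmx B) x.
Proof.
move=> H Bu c0; apply: le_trans (H _) _; rewrite /qform (mulmxKV Bu).
have e : (x *m (x *m invmx B)^T)^T = x *m invmx B *m x^T.
  by rewrite trmx_mul trmxK.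
by rewrite -e [leRHS]mxE.
Qed.

(* By the Sherman-Morrison formula the k-th weight is
   1 - tr (S^-1 lam_k w_k w_k^T), where S is the full weighted sum; the traces
   add up to tr 1 = i. *)
Lemma sum_weight_rv W : ~ degenerate W -> \sum_k weight_rv k W = n%:R - i%:R.
Proof.
move=> nd; pose S := \sum_l lam l *: outer (tnth W l).
have SE k : S = leave_one_out lam k W + lam k *: outer (tnth W k).
  by rewrite /S (bigD1 k) //= addrC.
have n_gt0 : (0 < n)%N by apply: leq_ltn_trans i_n.
have pS : posdef S.
  have psS : psd S by apply: psd_outer_sum => l; exact: ltW.
  split; first by case: psS.
  move=> x x0; rewrite (SE (Ordinal n_gt0)) qformD ltr_pwDl //.
    by case: (nondegenerate_unit (Ordinal n_gt0) nd) => _; apply.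
  by rewrite qformZ qform_outer mulr_ge0 ?sqr_ge0 // ltW.
have Su := posdef_unit pS.
have wE' k : weight_rv k W = 1 - \tr (invmx S *m (lam k *: outer (tnth W k))).
  have pA := nondegenerate_unit k nd; have Au := posdef_unit pA.
  set A := leave_one_out lam k W in pA Au.
  set w := rv_of (tnth W k).
  have oE : outer (tnth W k) = w^T *m w by rewrite /w /rv_of trmxK.
  pose x := w *m invmx A; pose q := quad_form lam k W.
  have qE : x *m w^T = q%:M by rewrite [LHS]mx11_scalar; congr (_%:M); rewrite /q quad_formE.
  have q0 : 0 <= lam k * q by rewrite mulr_ge0 ?quad_form_ge0 // ltW.
  have xS : x *m S = (1 + lam k * q) *: w.
    rewrite (SE k) -/A mulmxDr (mulmxKV Au) oE -scalemxAr mulmxA qE mul_scalar_mx.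
    by rewrite scalerA scalerDl scale1r.
  have wS : w *m invmx S = (1 + lam k * q)^-1 *: x.
    rewrite -[w](scalerK (_ : 1 + lam k * q != 0)); last by rewrite gt_eqF //; lra.
    by rewrite -xS -scalemxAl (mulmxK Su).
  have trE : \tr (w *m invmx S *m w^T) = (1 + lam k * q)^-1 * q.
    by rewrite wS -scalemxAl mxtraceZ qE mxtrace_scalar mulr1n.
  rewrite -scalemxAr mxtraceZ oE mulmxA mxtrace_mulC mulmxA trE /weight_rv -/q.
  by field; rewrite gt_eqF //; lra.
under eq_bigr do rewrite wE'.
rewrite sumrB -(raddf_sum (@mxtrace R i)) -mulmx_sumr -/S (mulVmx Su) /= mxtrace1.
by rewrite sumr_const card_ord.
Qed.

Lemma sum_t : \sum_k t_ lam i k = n%:R - i%:R.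
Proof.
under eq_bigr do rewrite t_Ex.
rewrite -Ex_sum; last by move=> k; exact: brv_weight_rv.
rewrite -[RHS](Ex_cst P); apply: Ex_ae_eq.
- by apply: brv_sum => k; exact: brv_weight_rv.
- exact: brv_cst.
exists degenerate; split; [exact: measurable_degenerate|exact: degenerate_null|].
by move=> W; exact: sum_weight_rv.
Qed.

(** The forms [q1] and [q2] are unbounded, but [q <= C * (1 + c * q)] since [c >= C^-1], so the
    denominators absorb them. The change of [c] contributes [C] and the change of [q] contributes
    [C ^+ 3]. *)
Let dist_le (c1 c2 q1 q2 de : R) : C^-1 <= c1 <= C -> C^-1 <= c2 <= C -> 0 <= q1 -> 0 <= q2 ->
  c1 - c2 = de -> `|q1 - q2| <= `|de| * C * (q1 + q2) / 2 ->
  `|(1 + c1 * q1)^-1 - (1 + c2 * q2)^-1| <= (C + C ^+ 3) * `|de|.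
Proof.
move=> /andP[c1l c1u] /andP[c2l c2u] q10 q20 cd qd.
have Ci0 : 0 < C^-1 by rewrite invr_gt0.
have p1 : 0 <= c1 * q1 by rewrite mulr_ge0 //; lra.
have p2 : 0 <= c2 * q2 by rewrite mulr_ge0 //; lra.
set A := 1 + c1 * q1; set B := 1 + c2 * q2.
have A1 : 1 <= A by rewrite /A; lra.
have B1 : 1 <= B by rewrite /B; lra.
have AB0 : 0 < A * B by rewrite mulr_gt0 //; lra.
have -> : A^-1 - B^-1 = (c2 * q2 - c1 * q1) / (A * B).
  by rewrite /A /B; field; apply/andP; split; rewrite gt_eqF //; lra.
rewrite normrM (gtr0_norm (_ : 0 < (A * B)^-1)) ?invr_gt0 // ler_pdivrMr //.
have qA (c q : R) : C^-1 <= c -> 0 <= q -> q <= C * (1 + c * q).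
  move=> cC q0; have : C * (C^-1 * q) <= C * (c * q).
    by apply: ler_wpM2l; [lra|exact: ler_wpM2r].
  by rewrite mulVKf ?gt_eqF //; lra.
have q1A : q1 <= C * (A * B).
  apply: le_trans (qA _ _ c1l q10) _; apply: ler_wpM2l; first lra.
  by rewrite -/A ler_peMr //; lra.
have q2B : q2 <= C * (A * B).
  apply: le_trans (qA _ _ c2l q20) _; apply: ler_wpM2l; first lra.
  by rewrite -/B ler_peMl //; lra.
have d0 := normr_ge0 de.
have -> : c2 * q2 - c1 * q1 = - (de * q1 + c2 * (q1 - q2)) by rewrite -cd; ring.
rewrite normrN; apply: le_trans (ler_normD _ _) _.
rewrite !normrM (ger0_norm q10) (ger0_norm (_ : 0 <= c2)); last lra.
have h1 : `|de| * q1 <= `|de| * (C * (A * B)) by exact: ler_wpM2l.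
have h2 : c2 * `|q1 - q2| <= C * (`|de| * C * (q1 + q2) / 2).
  by apply: ler_pM => //; lra.
have h3 : C * (`|de| * C * (q1 + q2) / 2) <= C * (`|de| * C * (C * (A * B))).
  apply: ler_wpM2l; first lra.
  rewrite -mulrA; apply: ler_wpM2l; last lra.
  by apply: mulr_ge0 => //; lra.
have -> : (C + C ^+ 3) * `|de| * (A * B) =
  `|de| * (C * (A * B)) + C * (`|de| * C * (C * (A * B))) by ring.
by lra.
Qed.

(** After the exchange the vector in the quadratic form is the same and the matrix passes from [N]
    to [N' = N + de w_l w_l^T]. The resolvent identity writes the difference of the forms as [de]
    times two pairings with [w_l]. Both matrices dominate [C^-1 w_l w_l^T], so each squared pairing
    is at most [C] times the corresponding form. *)
Lemma weight_rv_swap k l W : ~ degenerate W ->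
  `|weight_rv k W - weight_rv l (tperm_tuple (tperm k l) W)| <= (C + C ^+ 3) * `|lam k - lam l|.
Proof.
move=> nd; have [->|kl] := eqVneq k l.
  rewrite tperm1 !subrr.
  have -> : tperm_tuple 1 W = W.
    by apply: eq_from_tnth => m; rewrite tnth_mktuple perm1.
  by rewrite subrr !normr0 mulr0.
have pN := nondegenerate_unit k nd.
set W' := tperm_tuple (tperm k l) W; set N := leave_one_out lam k W in pN.
set N' := leave_one_out lam l W'; set de := lam k - lam l.
have lk : l != k by rewrite eq_sym.
have tW' m : tnth W' m = tnth W (tperm k l m) by rewrite tnth_mktuple.
have NE : N = lam l *: outer (tnth W l) +
    \sum_(m < n | (m != k) && (m != l)) lam m *: outer (tnth W m).
  by rewrite /N /leave_one_out (bigD1 l).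
have N'E : N' = lam k *: outer (tnth W l) +
    \sum_(m < n | (m != k) && (m != l)) lam m *: outer (tnth W m).
  rewrite /N' /leave_one_out (bigD1 k) //= tW' tpermL; congr (_ + _).
  rewrite (eq_bigl (fun m => (m != k) && (m != l))); last by move=> m; rewrite andbC.
  apply: eq_bigr => m /andP[mk ml]; rewrite tW' tpermD // eq_sym //.
have NN' : N' = N + de *: outer (tnth W l).
  by rewrite N'E NE addrAC -scalerDl /de (addrC (lam l)) subrK.
set w := rv_of (tnth W k); set wl := rv_of (tnth W l).
have oE : outer (tnth W l) = wl^T *m wl by rewrite /wl /rv_of trmxK.
have qo y : qform (outer (tnth W l)) y = ((y *m wl^T) 0 0) ^+ 2.
  rewrite qform_outer; congr (_ ^+ 2); rewrite mxE; apply: eq_bigr => j _.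
  by rewrite /wl /rv_of trmxK mxE.
have rest y : 0 <= qform (\sum_(m < n | (m != k) && (m != l)) lam m *: outer (tnth W m)) y.
  rewrite qform_sum; apply: sumr_ge0 => m _.
  by rewrite qformZ qform_outer mulr_ge0 ?sqr_ge0 // ltW.
have Nge y : C^-1 * ((y *m wl^T) 0 0) ^+ 2 <= qform N y.
  rewrite NE qformD qformZ qo.
  have /andP[ll _] := lamC l.
  by have := ler_wpM2r (sqr_ge0 ((y *m wl^T) 0 0)) ll; have := rest y; lra.
have N'ge y : C^-1 * ((y *m wl^T) 0 0) ^+ 2 <= qform N' y.
  rewrite N'E qformD qformZ qo.
  have /andP[ll _] := lamC k.
  by have := ler_wpM2r (sqr_ge0 ((y *m wl^T) 0 0)) ll; have := rest y; lra.
(* [N'] is not among the matrices covered by the nondegeneracy of [W]. A null vector of [N'] is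
   orthogonal to [w_l], hence null for [N], which is excluded. *)
have pN' : posdef N'.
  split; first by have [] := psd_loo l W'.
  move=> x x0; have [_ N'0] := psd_loo l W'.
  rewrite lt0r N'0 andbT; apply/eqP => q0.
  have [_ /(_ x x0)] := pN.
  have := N'ge x; rewrite -/N' in q0; rewrite q0 => H.
  have Ci0 : 0 < C^-1 by rewrite invr_gt0.
  have a0 : ((x *m wl^T) 0 0) ^+ 2 = 0.
    apply/eqP; rewrite eq_le sqr_ge0 andbT -(pmulr_rle0 _ Ci0) //.
  have : qform N' x = 0 by [].
  by rewrite NN' qformD qformZ qo a0 mulr0 addr0 => ->; rewrite ltxx.
have Nu := posdef_unit pN; have N'u := posdef_unit pN'.
have q1E : quad_form lam k W = qform (invmx N) w by rewrite quad_formE.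
have q2E : quad_form lam l W' = qform (invmx N') w.
  by rewrite quad_formE -/N' tW' tpermR.
rewrite /weight_rv; apply: dist_le => //; try exact: quad_form_ge0.
have Ci0 : 0 < C^-1 by rewrite invr_gt0.
have a1 := qform_rank_one_le w Nge Nu Ci0.
have a2 := qform_rank_one_le w N'ge N'u Ci0.
rewrite q1E q2E.
set x := w *m invmx N in a1; set x' := w *m invmx N' in a2.
have xN : x *m N = w by rewrite /x mulmxKV.
have xN' : x' *m N' = w by rewrite /x' mulmxKV.
have [Ns _] := pN; have [N's _] := pN'.
have sub : qform (invmx N) w - qform (invmx N') w = de * ((x *m wl^T) 0 0 * (x' *m wl^T) 0 0).
  have e1 : qform (invmx N) w = (x *m N' *m x'^T) 0 0.
    rewrite /qform -/x -[in LHS]xN' trmx_mul N's mulmxA //.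
  have e2 : qform (invmx N') w = (x *m N *m x'^T) 0 0.
    have E : (x' *m w^T)^T = w *m x'^T by rewrite (trmx_mul x') (trmxK w).
    by rewrite xN -E [RHS]mxE.
  rewrite e1 e2 NN' mulmxDr mulmxDl -scalemxAr -scalemxAl oE.
  have dd (a b : 'M[R]_1) : (a + b) 0 0 = a 0 0 + b 0 0 by rewrite mxE.
  have dz (c : R) (a : 'M[R]_1) : (c *: a) 0 0 = c * a 0 0 by rewrite mxE.
  rewrite dd dz addrC addrA addNr add0r; congr (_ * _).
  have -> : x *m (wl^T *m wl) *m x'^T = (x *m wl^T) *m (x' *m wl^T)^T.
    by rewrite (trmx_mul x') (trmxK wl) !mulmxA.
  by rewrite [in LHS](mx11_scalar (x *m wl^T)) mul_scalar_mx dz; congr (_ * _); rewrite mxE.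
rewrite sub normrM -!mulrA ler_wpM2l //.
set a := (x *m wl^T) 0 0 in a1 *; set a' := (x' *m wl^T) 0 0 in a2 *.
rewrite normrM.
have am : `|a| * `|a'| <= (a ^+ 2 + a' ^+ 2) / 2.
  rewrite -(real_normK (num_real a)) -(real_normK (num_real a')).
  by have := sqr_ge0 (`|a| - `|a'|); lra.
have b1 : a ^+ 2 <= C * qform (invmx N) w.
  by rewrite mulrC -ler_pdivrMr // mulrC.
have b2 : a' ^+ 2 <= C * qform (invmx N') w.
  by rewrite mulrC -ler_pdivrMr // mulrC.
lra.
Qed.

Let brv_min d (T : measurableType d) (f : T -> R) (c : R) :
  bounded_rv f -> bounded_rv (fun W => Num.min (f W) c).
Proof.
move=> [mf [K HK]]; split; first exact: measurable_minr.
exists (K + `|c|) => W; have H1 := HK W; have H2 := normr_ge0 c; have H3 := normr_ge0 (f W).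
by rewrite /Num.min; case: (f W < c); lra.
Qed.

(* Exchanging w_k and w_l preserves the joint law and turns the k-th weight into
   the l-th one, up to a rank-one perturbation of size lam_k - lam_l. *)
Lemma t_lipschitz k l : `|t_ lam i k - t_ lam i l| <= (C + C ^+ 3) * `|lam k - lam l|.
Proof.
rewrite !t_Ex.
have [X XE] := mfun_of (measurable_tperm_tuple (T := i.-tuple R) (tperm k l)).
have [Y YE] := mfun_of (@measurable_id _ (sample : measurableType _) setT).
have bX : bounded_rv (fun W => weight_rv l (X W)).
  split; first exact: (measurableT_comp (measurable_weight_rv l) (measurable_funPT X)).
  by exists 1 => W; have /andP[w0 w1] := weight_rv01 l (X W); rewrite ger0_norm.
have -> : Ex P (weight_rv l) = Ex P (fun W => weight_rv l (X W)).
  have bY : bounded_rv (fun W => weight_rv l (Y W)) by rewrite YE; exact: brv_weight_rv.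
  transitivity (Ex P (fun W => weight_rv l (Y W))); first by rewrite YE.
  apply/esym; apply: Ex_same_law => //; last first.
  - exact: measurable_weight_rv.
  - by move=> B mB; rewrite XE YE; exact: iid_law_perm.
have bk := brv_weight_rv k.
rewrite -ExB //; apply: le_trans (Ex_norm _ (brvB bk bX)) _.
rewrite -[leRHS](Ex_cst P).
(* The pointwise bound may fail on degenerate samples; truncating at the bound alters the integrand
   only there. *)
have -> : Ex P (fun W => `|weight_rv k W - weight_rv l (X W)|) =
   Ex P (fun W => Num.min `|weight_rv k W - weight_rv l (X W)| ((C + C ^+ 3) * `|lam k - lam l|)).
  have bn := brv_norm (brvB bk bX).
  apply: Ex_ae_eq => //; first exact: brv_min.
  exists degenerate; split; [exact: measurable_degenerate|exact: degenerate_null|].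
  move=> W nd; rewrite min_l //; have -> : X W = tperm_tuple (tperm k l) W by rewrite XE.
  exact: weight_rv_swap.
have bn := brv_norm (brvB bk bX).
apply: Ex_le; [exact: brv_min|exact: brv_cst|by move=> W; rewrite ge_min lexx orbT].
Qed.

Let lbar : R := n%:R^-1 * \sum_k lam k.
Let spread : R := \sum_k (lam k - lbar) ^+ 2.

(** The double sum of [(lam k - lam l)] times [(t k - t l)] is [2 n] times the quantity to be
    bounded, and the Lipschitz estimate compares it with the double sum of squared differences,
    which is [2 n] times [spread]. The error is thus quadratic in the deviations. *)
Lemma weighted_mean_t :
  `|\sum_k lam k * t_ lam i k - lbar * (n%:R - i%:R)| <= (C + C ^+ 3) * spread.
Proof.
have n_gt0 : 0 < (n%:R : R) by rewrite ltr0n (leq_ltn_trans _ i_n).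
have n2 : 0 < 2 * n%:R :> R by rewrite mulr_gt0.
have lsum : \sum_k lam k = n%:R * lbar by rewrite /lbar mulrA mulfV ?gt_eqF // mul1r.
have pair (f g : 'I_n -> R) : \sum_k \sum_l (f k - f l) * (g k - g l) =
    2 * (n%:R * \sum_k f k * g k - (\sum_k f k) * \sum_k g k).
  transitivity (\sum_k (n%:R * (f k * g k) + \sum_l f l * g l -
      (f k * \sum_l g l + g k * \sum_l f l))).
    apply: eq_bigr => k _.
    have -> : n%:R * (f k * g k) = \sum_(l < n) f k * g k.
      by rewrite sumr_const card_ord mulr_natl.
    rewrite !mulr_sumr -!big_split /= -sumrB; apply: eq_bigr => l _; ring.
  rewrite sumrB !big_split /= -mulr_sumr sumr_const card_ord -!mulr_suml -mulr_natl.
  ring.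
have E1 := pair lam (fun k => t_ lam i k).
have E2 := pair lam lam.
rewrite sum_t lsum in E1; rewrite lsum in E2.
have spE : spread = \sum_k lam k * lam k - n%:R * lbar ^+ 2.
  rewrite /spread.
  transitivity (\sum_k (lam k * lam k - 2 * lbar * lam k + lbar ^+ 2)).
    by apply: eq_bigr => k _; ring.
  rewrite big_split sumrB /= -mulr_sumr lsum sumr_const card_ord -mulr_natl; ring.
have H : `|\sum_k \sum_l (lam k - lam l) * (t_ lam i k - t_ lam i l)| <=
    (C + C ^+ 3) * \sum_k \sum_l (lam k - lam l) * (lam k - lam l).
  apply: le_trans (ler_norm_sum _ _ _) _; rewrite mulr_sumr; apply: ler_sum => k _.
  apply: le_trans (ler_norm_sum _ _ _) _; rewrite mulr_sumr; apply: ler_sum => l _.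
  rewrite normrM -expr2 -(real_normK (num_real (lam k - lam l))) expr2 mulrCA.
  by apply: ler_wpM2l => //; exact: t_lipschitz.
rewrite E1 E2 in H.
rewrite -(ler_pM2l n2); apply: le_trans (_ : _ <= (C + C ^+ 3) * (2 * (n%:R * (\sum_k lam k * lam k) - n%:R * lbar * (n%:R * lbar)))) _.
  apply: le_trans H; rewrite -[X in X * _](gtr0_norm n2) -normrM le_eqVlt; apply/orP; left.
  by apply/eqP; congr (`|_|); ring.
by rewrite spE le_eqVlt; apply/orP; left; apply/eqP; ring.
Qed.

(** A bound of first order with a free [e] is enough here: the variance divides this sum by a square
    of order [n ^+ 2] and adds up at most [n] such quotients. *)
Lemma weighted_square_t e : 0 < e ->
  `|\sum_k lam k ^+ 2 * t_ lam i k - lbar ^+ 2 * (n%:R - i%:R)| <= C * (n%:R * e + spread / e).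
Proof.
move=> e0; have n_gt0 : 0 < (n%:R : R) by rewrite ltr0n (leq_ltn_trans _ i_n).
have lbC : 0 <= lbar <= C.
  have s0 : 0 <= \sum_k lam k <= n%:R * C.
    rewrite sumr_ge0 /=; last by move=> k _; exact: ltW.
    have -> : n%:R * C = \sum_(k < n) C by rewrite sumr_const card_ord mulr_natl.
    by apply: ler_sum => k _; have /andP[] := lamC k.
  have /andP[s1 s2] := s0; rewrite /lbar mulr_ge0 ?invr_ge0 ?(ltW n_gt0) //=.
  by rewrite mulrC ler_pdivrMr // mulrC.
rewrite -sum_t mulr_sumr -sumrB.
apply: le_trans (ler_norm_sum _ _ _) _.
have -> : C * (n%:R * e + spread / e) = \sum_k C * (e + (lam k - lbar) ^+ 2 / e).
  by rewrite -mulr_sumr big_split /= sumr_const card_ord mulr_natl -mulr_suml.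
apply: ler_sum => k _; rewrite -mulrBl normrM.
have /andP[t0 t1] := t_01 k; rewrite (ger0_norm t0).
apply: (@le_trans _ _ `|lam k ^+ 2 - lbar ^+ 2|); first by rewrite ler_piMr.
rewrite subr_sqr normrM mulrC.
have /andP[b0 b1] := lbC; have /andP[_ l1] := lamC k; have l0 := lam0 k.
rewrite (ger0_norm (_ : 0 <= lam k + lbar)); last lra.
have := abs_le (lam k - lbar) e0 => H.
apply: (@le_trans _ _ (2 * C * `|lam k - lbar|)).
  by apply: ler_wpM2r => //; lra.
have -> : C * (e + (lam k - lbar) ^+ 2 / e) = 2 * C * ((e + (lam k - lbar) ^+ 2 / e) / 2) by field; rewrite gt_eqF.
by apply: ler_wpM2l => //; lra.
Qed.

End weight_analysis.

(** * Normal approximation *)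

(** Outside [B] and where [Y < e], the variables [X] and [W] differ by less than [e], so the
    indicator lies between two ramps shifted by [e]. The exceptional points are paid for by
    [\1_B + Y / e], which is at least [1] there. *)
Lemma cdf_ramp_sandwich d (T : measurableType d) (R : realType) (P : probability T R)
    (X W Y : T -> R) (B : set T) (x e : R) :
  measurable_fun setT X -> bounded_rv W -> bounded_rv Y -> (forall w, 0 <= Y w) ->
  measurable B -> (forall w, ~ B w -> `|X w - W w| <= Y w) -> 0 < e ->
  Ex P (fun w => ramp (x - 2 * e) (x - e) (W w)) - (Pr P B + Ex P Y / e) <= Pr P [set w | X w <= x]
    <= Ex P (fun w => ramp (x + e) (x + 2 * e) (W w)) + (Pr P B + Ex P Y / e).
Proof.
move=> mX bW bY Y0 mB XW e0.
have mS : measurable [set w | X w <= x].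
  have -> : [set w | X w <= x] = X @^-1` `]-oo, x].
    by apply/seteqP; split => w /=; rewrite in_itv.
  by rewrite -[_ @^-1` _]setTI; exact: mX.
have bS : bounded_rv (\1_[set w | X w <= x] : T -> R) by exact: brv_indic.
have bB : bounded_rv (\1_B : T -> R) by exact: brv_indic.
have br a b : a < b -> bounded_rv (fun w => ramp a b (W w)).
  by move=> ab; have [mr Kr] := ramp_brv ab; apply: (brv_comp mr Kr); exact: brv_meas.
have bE : bounded_rv (fun w => \1_B w + e^-1 * Y w).
  by apply: brvD bB _; exact: brvZ.
have rE : Pr P B + Ex P Y / e = Ex P (fun w => \1_B w + e^-1 * Y w).
  by rewrite ExD //; [rewrite ExZ // Ex_indic // mulrC|exact: brvZ].
have i1 (A : set T) w : A w -> (\1_A w : R) = 1 by move=> Aw; rewrite indicE mem_set.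
have i0 (A : set T) w : 0 <= (\1_A w : R) by rewrite indicE ler0n.
have Ye w : 0 <= e^-1 * Y w by rewrite mulr_ge0 // invr_ge0 ltW.
have Ye1 w : e <= Y w -> 1 <= e^-1 * Y w by move=> h; rewrite mulrC ler_pdivlMr // mul1r.
have r1 a b w := ramp_le1 a b (W w); have r0 a b w := ramp_ge0 a b (W w).
have l1 : x - 2 * e < x - e by lra.
have l2 : x + e < x + 2 * e by lra.
rewrite rE -(Ex_indic P mS) lerBlDr; apply/andP; split.
- rewrite -ExD //; apply: Ex_le => [||w]; [exact: br|exact: brvD|].
  have := r1 (x - 2 * e) (x - e) w; have := i0 [set w | X w <= x] w; have := Ye w; have := i0 B w.
  have [Bw|/XW XWw] := pselect (B w); first by rewrite (i1 _ _ Bw); lra.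
  have [/Ye1|Yw] := leP e (Y w); first lra.
  have [Ww|Ww] := leP (x - e) (W w); first by rewrite (ramp_right l1 Ww); lra.
  rewrite (i1 [set w | X w <= x] w); first lra.
  by move: XWw; rewrite /= ler_norml => /andP[? ?]; lra.
- rewrite -ExD //; last exact: br.
  apply: Ex_le => [//||w]; first by apply: brvD => //; exact: br.
  have := r0 (x + e) (x + 2 * e) w; have := Ye w; have := i0 B w.
  have S1 : (\1_[set w | X w <= x] w : R) <= 1 by rewrite indicE lern1 leq_b1.
  have [Bw|/XW XWw] := pselect (B w); first by rewrite (i1 _ _ Bw); lra.
  have [/Ye1|Yw] := leP e (Y w); first lra.
  have [Xw|Xw] := leP (X w) x; last first.
    have -> : (\1_[set w | X w <= x] w : R) = 0.
      by rewrite indicE memNset //= => /(lt_le_trans Xw); rewrite ltxx.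
    lra.
  rewrite (ramp_left l2); first lra.
  by move: XWw; rewrite /= ler_norml => /andP[? ?]; lra.
Qed.

(** * From almost sure to everywhere on the sphere *)

Section sphere_normalization.
Context d (T : measurableType d) (R : realType) (P : probability T R).
Context (n p : nat) (n0 : (0 < n)%N) (u : 'I_p -> {RV P >-> n.-tuple R}).
Hypothesis u_ind : mutually_independent P u.
Hypothesis u_unif : forall i, uniform_on_sphere (distribution P (u i)).

Lemma prob_eq_off_null (A A' N : set T) : measurable A -> measurable A' -> measurable N ->
  P N = 0%E -> (forall w, ~ N w -> (A w <-> A' w)) -> P A = P A'.
Proof.
move=> mA mA' mN N0 AA'.
have le B B' : measurable B -> measurable B' -> (forall w, ~ N w -> B w -> B' w) ->
    (P B <= P B')%E.
  move=> mB mB' BB'; apply: (@le_trans _ _ (P (B' `|` N))).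
    apply: le_measure; rewrite ?inE //; first exact: measurableU.
    by move=> w Bw; have [Nw|/BB' /(_ Bw) B'w] := pselect (N w); [right|left].
  by rewrite -[leRHS]adde0 -N0; exact: measureU2.
by apply/eqP; rewrite eq_le !le //; move=> w /AA' [].
Qed.

Lemma uniform_rot i (O : 'M[R]_n) : O^T *m O = 1%:M -> forall B, measurable B ->
  P ((fun w => rot O (u i w)) @^-1` B) = P (u i @^-1` B).
Proof. by move=> OO B mB; have [_ /(_ O OO B mB)] := u_unif i. Qed.

(** Values off the sphere, taken with probability zero, are sent to a fixed unit vector, and the
    orthogonal matrix [Q] that diagonalises the problem is applied at the same time. The same map
    [g] acts on every vector separately, which preserves independence. *)
Lemma sphere_version (Q : 'M[R]_n) : Q^T *m Q = 1%:M ->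
  exists (v : 'I_p -> {RV P >-> n.-tuple R}) (N : set T),
  [/\ measurable N /\ P N = 0%E,
      forall i w, \sum_(k < n) tnth (v i w) k ^+ 2 = 1,
      forall i (O : 'M[R]_n), O^T *m O = 1%:M -> forall B, measurable B ->
        P ((fun w => rot O (v i w)) @^-1` B) = P (v i @^-1` B),
      mutually_independent P v &
      forall w, ~ N w -> forall i, v i w = rot Q (u i w)].
Proof.
move=> QQ.
pose sq (x : n.-tuple R) := \sum_(k < n) tnth x k ^+ 2.
have msq : measurable_fun setT sq.
  apply: measurable_sum => k; apply: measurable_funX; exact: measurable_tnth.
pose S := [set x : n.-tuple R | sq x = 1].
have mS : measurable S by exact: measurable_level.
pose e0 : n.-tuple R := [tuple ((k : nat) == 0%N)%:R | k < n].
have sqe0 : sq e0 = 1.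
  rewrite /sq (bigD1 (Ordinal n0)) //= tnth_mktuple eqxx expr1n big1 ?addr0 // => k k0.
  rewrite tnth_mktuple (_ : (k : nat) == 0%N = false) ?expr0n //.
  by apply: contraNF k0 => /eqP k0; apply/eqP/val_inj.
pose g x := if sq x == 1 then rot Q x else e0.
have mg : measurable_fun setT g.
  apply: measurable_fun_ifT; [|exact: measurable_rot|exact: measurable_cst].
  apply: (measurable_fun_bool true); rewrite setTI.
  have -> : (fun x => sq x == 1) @^-1` [set true] = S.
    by apply/seteqP; split => x /=; [move/eqP|move=> ->; rewrite eqxx].
  exact: mS.
have mgu i : measurable_fun setT (fun w => g (u i w)).
  exact: (measurableT_comp mg (measurable_funPT (u i))).
have [v vE] : exists v : 'I_p -> {RV P >-> n.-tuple R}, forall i w, v i w = g (u i w).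
  by exists (fun i => mfun_Sub (mem_set (mgu i))).
have sq_rot x : sq (rot Q x) = sq x.
  rewrite /sq -!sqnorm_rvec rvec_rot /sqnorm.
  by rewrite trmx_mul trmxK mulmxA -(mulmxA _ Q^T) QQ mulmx1.
pose N := \bigcup_(i in [set: 'I_p]) (u i @^-1` ~` S).
have mNi i : measurable (u i @^-1` ~` S).
  by rewrite -[_ @^-1` _]setTI; apply: (measurable_funPT (u i)) => //; exact: measurableC.
have mN : measurable N by exact: fin_bigcup_measurable.
have N0 : P N = 0%E.
  have NE : N = \big[setU/set0]_(i < p) (u i @^-1` ~` S).
    rewrite -bigcup_seq; apply/seteqP; split => w [i _ dk]; exists i => //=.
    exact: mem_index_enum.
  apply/negligibleP => //; rewrite NE.
  apply: (big_ind (negligible P)) => [|A B|i _]; [exact: negligible_set0|exact: negligibleU|].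
  apply/negligibleP => //; have [u1 _] := u_unif i.
  have H : P (u i @^-1` S) = 1%E := u1.
  have mSi : measurable (u i @^-1` S) by rewrite -[_ @^-1` _]setTI; exact: (measurable_funPT (u i)).
  have H0 : P (u i @^-1` ~` S) = 0%E by rewrite -preimage_setC probability_setC // H subee.
  exact: H0.
have vN w i : ~ N w -> v i w = rot Q (u i w).
  move=> Nw; rewrite vE /g; case: eqP => // Sw; exfalso; apply: Nw; by exists i.
exists v, N; split => //; last by move=> w Nw i; exact: vN.
- by move=> i w; rewrite vE -/(sq _) /g; case: eqP => // S1; rewrite sq_rot.
- have E i B : measurable B -> P (v i @^-1` B) = P (u i @^-1` B).
    move=> mB; rewrite -(uniform_rot i QQ mB); apply: (prob_eq_off_null _ _ mN N0).
    + by rewrite -[_ @^-1` _]setTI; exact: (measurable_funPT (v i)).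
    + rewrite -[_ @^-1` _]setTI.
      exact: (measurableT_comp (measurable_rot Q) (measurable_funPT (u i))).
    + by move=> w Nw /=; rewrite vN.
  move=> i O OO B mB.
  have mOB : measurable (rot O @^-1` B).
    by rewrite -[_ @^-1` _]setTI; exact: measurable_rot.
  by rewrite (E i _ mB) (E i _ mOB) -(uniform_rot i OO mB).
- move=> J B mB.
  have mgB i : measurable (g @^-1` B i) by rewrite -[_ @^-1` _]setTI; exact: mg.
  have vB i : v i @^-1` B i = u i @^-1` (g @^-1` B i).
    by apply/seteqP; split => w /=; rewrite vE.
  have -> : \bigcap_(i in [set` J]) (v i @^-1` B i) =
      \bigcap_(i in [set` J]) (u i @^-1` (g @^-1` B i)).
    by apply: eq_bigcapr => i _; exact: vB.
  by rewrite (u_ind J mgB); apply: eq_bigr => i _; rewrite vB.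
Qed.

Lemma Ymx_gram (A O : 'M[R]_n) (lam : 'I_n -> R) (v : 'I_p -> {RV P >-> n.-tuple R}) w :
  A^T *m A = O *m diag_mx (\row_k lam k) *m O^T ->
  (forall i, v i w = rot O^T (u i w)) ->
  Ymx A u w *m (Ymx A u w)^T =
  umx (full v w) *m diag_mx (\row_k lam k) *m (umx (full v w))^T.
Proof.
move=> AO vO.
have YE : Ymx A u w = umx (full u w) *m A^T.
  apply/row_matrixP => i; rewrite row_mul row_umx tnth_mktuple rowK trmx_mul.
  by congr (_ *m _); rewrite rvecE.
have UE : umx (full v w) = umx (full u w) *m O.
  by apply/row_matrixP => i; rewrite row_mul !row_umx !tnth_mktuple vO rvec_rot trmxK.
by rewrite YE UE !trmx_mul trmxK -!mulmxA (mulmxA A^T) AO !mulmxA.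
Qed.

End sphere_normalization.

(** [tau] depends only on [x], [e], [eta], [v0] and [v1], so one value serves all [n] and all
    probability spaces. *)
Lemma logdet_cdf_bound (R : realType) (x e eta v0 v1 : R) :
  0 < e -> 0 < eta -> 0 < v0 -> 0 <= v1 ->
  exists2 tau : R, 0 < tau & forall d (T : measurableType d) (P : probability T R) (n p : nat)
    (A : 'M[R]_n) (lam : 'I_n -> R) (u : 'I_p -> {RV P >-> n.-tuple R})
    (m : R) (c : 'I_n -> R) (mu' s2 : R),
  (0 < n)%N -> (p <= n)%N -> A \in unitmx ->
  char_poly (A *m A^T) = \prod_(k < n) ('X - (lam k)%:P) ->
  mutually_independent P u -> (forall i, uniform_on_sphere (distribution P (u i))) ->
  0 < m -> (forall k, lam k = m * (1 + c k)) -> (forall k, `|c k| <= 2^-1) ->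
  \sum_k c k = 0 -> \sum_k c k ^+ 2 <= tau ->
  v0 <= \sum_(0 <= j < p) distsq_var R n j <= v1 ->
  \sum_(0 <= j < p) (distsq_mean R n j)^-1 ^+ 4 * (3 / (4 * n%:R ^+ 2)) <= tau ->
  `|mu' - logdet_center n p m| <= tau ->
  `|s2 - \sum_(0 <= j < p) distsq_var R n j| <= tau ->
  Phi (x - 2 * e) - eta <= Pr P [set w | standardized_logdet A u mu' (Num.sqrt s2) w <= x]
    <= Phi (x + 2 * e) + eta.
Proof.
move=> e0 eta0 v00 v10.
have l1 : x - 2 * e < x - e by lra.
have l2 : x + e < x + 2 * e by lra.
have [c1 [K1 [/andP[c1l _] K10 clt1]]] := stein_clt l1.
have [c2 [K2 [/andP[_ c2u] K20 clt2]]] := stein_clt l2.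
(* Bounds the inverse of the square root of [s2], because [s2 >= v0 / 2] and [b <= 1 + b ^+ 2]. *)
pose G := 1 + 2 / v0.
have G0 : 0 < G by rewrite addr_gt0 // divr_gt0.
(* In the total error [A0 - 1] is the coefficient of [f] and [B] that of [tau]. Since
   [f * A0 = eta / 2] and [tau * B <= eta / 2], the total stays below [eta]. *)
pose A0 := K1 + K2 + G * (v1 + 1) / e + 1.
have Gv : 0 <= G * (v1 + 1) / e by rewrite divr_ge0 ?mulr_ge0 //; lra.
have A00 : 0 < A0 by rewrite /A0; lra.
pose f := eta / (2 * A0).
have f0 : 0 < f by rewrite divr_gt0 // mulr_gt0.
pose B := (K1 + K2) / (f * v0 ^+ 2) + 16 + (G * (2 / f + 3) + 2 / v0) / e.
have if0 : 0 < f^-1 by rewrite invr_gt0.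
have iv0 : 0 < v0^-1 by rewrite invr_gt0.
have B1 : 0 <= (K1 + K2) / (f * v0 ^+ 2).
  by apply: divr_ge0; [lra|rewrite ltW // mulr_gt0 // exprn_gt0].
have B2 : 0 <= (G * (2 / f + 3) + 2 / v0) / e.
  rewrite divr_ge0 ?(ltW e0) // addr_ge0 //; last lra.
  by rewrite mulr_ge0 //; lra.
have B0 : 0 < B by rewrite /B; lra.
pose tau := Num.min (v0 / 2) (eta / (2 * B)).
have tau0 : 0 < tau by rewrite lt_min !divr_gt0 // mulr_gt0.
have tau_v : tau <= v0 / 2 by rewrite /tau ge_min lexx.
have tau_B : tau * B <= eta / 2.
  have : tau <= eta / (2 * B) by rewrite /tau ge_min lexx orbT.
  move=> /(ler_wpM2r (ltW B0)) h; apply: le_trans h _.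
  by rewrite le_eqVlt; apply/orP; left; apply/eqP; field; rewrite gt_eqF.
have Bid t : (f * (G * (v1 + 1)) + t * (G * (2 / f + 3) + 2 / v0)) / e +
    (K1 + K2) * (f + t / v0 ^+ 2 / f) + 16 * t = eta / 2 - f + t * B.
  have -> : eta / 2 = A0 * f by rewrite /f; field; rewrite gt_eqF.
  by rewrite /A0 /B; field; rewrite !gt_eqF.
clearbody tau B f A0.
have EY_bound (V D k : R) : V <= v1 -> D <= tau -> k <= tau ->
    (f * V + k / f) / 2 + (f + k / f) / 4 + ((f + D / f) / 2 + 2 * D) <=
    f * (v1 + 1) + tau * (2 / f + 2).
  move=> Vv Dt kt.
  have h1 : f * V <= f * v1 by rewrite ler_pM2l.
  have h2 : k / f <= tau / f by rewrite ler_pM2r.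
  have h3 : D / f <= tau / f by rewrite ler_pM2r.
  have h4 : 0 < tau / f by rewrite divr_gt0.
  have h5 : 0 <= f * v1 by rewrite mulr_ge0 // ltW.
  have -> : tau * (2 / f + 2) = 2 * (tau / f) + 2 * tau by field; rewrite gt_eqF.
  lra.
have EY'_bound (i y b dr : R) : 0 <= i -> i <= G -> 0 <= y -> 0 <= b ->
    y <= f * (v1 + 1) + tau * (2 / f + 2) -> b <= tau -> dr <= 2 / v0 * tau ->
    i * (y + b) + dr <= f * (G * (v1 + 1)) + tau * (G * (2 / f + 3) + 2 / v0).
  move=> i0 iG y0 b0 yu bu du.
  have h : i * (y + b) <= G * (f * (v1 + 1) + tau * (2 / f + 3)) by apply: ler_pM => //; lra.
  lra.
have err_bound (pr y k V : R) : pr <= 16 * tau ->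
    y <= f * (G * (v1 + 1)) + tau * (G * (2 / f + 3) + 2 / v0) -> 0 <= k -> k <= tau -> v0 <= V ->
    pr + y / e + K1 * (f + k / V ^+ 2 / f) + K2 * (f + k / V ^+ 2 / f) <= eta /\
    0 <= k / V ^+ 2 / f.
  move=> pru yu k0 kt Vv.
  have h1 : y / e <= (f * (G * (v1 + 1)) + tau * (G * (2 / f + 3) + 2 / v0)) / e.
    by rewrite ler_pM2r // invr_gt0.
  have V0 : 0 <= (V ^+ 2)^-1 by rewrite invr_ge0 exprn_ge0 //; lra.
  have h2 : (K1 + K2) * (f + k / V ^+ 2 / f) <= (K1 + K2) * (f + tau / v0 ^+ 2 / f).
    apply: ler_wpM2l; first lra.
    rewrite lerD2l ler_pM2r //; apply: ler_pM => //.
    rewrite lef_pV2 ?posrE ?exprn_gt0 //; last by lra.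
    by rewrite lerXn2r // nnegrE; lra.
  split; last by rewrite !mulr_ge0 // ltW.
  have := Bid tau; rewrite mulrDl in h2; lra.
have fin_lo (ph c r E p X y : R) : ph <= c -> - (K1 * X) <= E - c -> E - r <= p ->
    r + K1 * X + K2 * y <= eta -> 0 <= K2 * y -> ph - eta <= p by lra.
have fin_up (ph c r E p X y : R) : c <= ph -> E - c <= K2 * X -> p <= E + r ->
    r + K1 * y + K2 * X <= eta -> 0 <= K1 * y -> p <= ph + eta by lra.
have G_bound b : b ^+ 2 <= 2 / v0 -> b <= G.
  by move=> b2; have := sqr_ge0 (b - 2^-1); rewrite /G; lra.
have s2_bound (s2 V : R) : v0 <= V -> `|s2 - V| <= tau -> v0 / 2 <= s2.
  by move=> Vv; rewrite ler_norml => /andP[h1 h2]; lra.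
have halfE (s : R) : (s + s) / 2 = s by field.
have v2 : 0 < v0 / 2 by rewrite divr_gt0.
exists tau => // d T P n p A lam u m c mu' s2 n0 pn Au charA u_ind u_unif m0 lamE c2' csum.
set D := \sum_k c k ^+ 2; set V := \sum_(0 <= j < p) distsq_var R n j.
set ka := \sum_(0 <= j < p) _ * _; set be := `|mu' - _|.
move=> Dtau /andP[V0 V1] katau betau stau.
have [Q [QQ AQ]] := gram_spectral Au charA.
have QQ' : (Q^T)^T *m Q^T = 1%:M by rewrite trmxK; exact: mulmx1C.
have [v [N [[mN N0] v_sphere v_rot v_ind vN]]] := sphere_version n0 u_ind u_unif QQ'.
have rowE : \row_k (m * (1 + c k)) = \row_k lam k by apply/rowP => k; rewrite !mxE lamE.
have LE w : (forall i, v i w = rot Q^T (u i w)) ->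
    logdet A u w = ln (\det (umx (full v w) *m diag_mx (\row_k (m * (1 + c k))) *m
      (umx (full v w))^T)).
  by move=> h; rewrite rowE -(Ymx_gram AQ h).
pose Z j w := reldev v j w.
have bZ j : bounded_rv (Z j) by exact: brv_reldev.
pose k4 := \sum_(0 <= j < p) Ex P (fun w => Z j w ^+ 4).
have k4ka : k4 <= ka.
  apply: ler_sum_nat => j /andP[_ jp]; exact: Ex_reldev4.
have k40 : 0 <= k4.
  apply: sumr_ge0 => j _; apply: Ex_ge0 => w; exact: exprn_even_ge0.
have D0 : 0 <= D by apply: sumr_ge0 => k _; exact: sqr_ge0.
have [Y [bY Y0 EY YL]] := logdet_expansion n0 pn v_sphere v_rot v_ind m0 f0 c2' csum.
pose s := Num.sqrt V; pose sg := Num.sqrt s2.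
have Vp : 0 < V by exact: lt_le_trans v00 V0.
have s0 : 0 < s by rewrite sqrtr_gt0.
have sE : s ^+ 2 = V by rewrite sqr_sqrtr ?ltW.
have s2V : v0 / 2 <= s2 by exact: s2_bound V0 stau.
have s2p : 0 < s2 by exact: lt_le_trans v2 s2V.
have sg0 : 0 < sg by rewrite sqrtr_gt0.
have sgE : sg ^+ 2 = s2 by rewrite sqr_sqrtr ?ltW.
have is2 : s2^-1 <= 2 / v0.
  by rewrite -[2 / v0]invf_div lef_pV2 ?posrE // divr_gt0.
have isg : sg^-1 <= G by apply: G_bound; rewrite exprVn sgE.
have isg0 : 0 < sg^-1 by rewrite invr_gt0.
(* The sum is normalised by its exact standard deviation [s], the statement by [sg]. The mismatch is
   [|V - s2| / (sg * (s + sg))], at most [tau / s2]. *)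
have drift : s * `|sg^-1 - s^-1| <= 2 / v0 * tau.
  have -> : s * `|sg^-1 - s^-1| = `|V - s2| / (sg * (s + sg)).
    rewrite -sE -sgE subr_sqr normrM (gtr0_norm (_ : 0 < s + sg)) ?addr_gt0 //.
    have -> : sg^-1 - s^-1 = (s - sg) / (sg * s) by field; rewrite !gt_eqF.
    rewrite normrM (gtr0_norm (_ : 0 < (sg * s)^-1)) ?invr_gt0 ?mulr_gt0 //.
    by field; rewrite !gt_eqF // addr_gt0.
  rewrite distrC in stau; rewrite [leRHS]mulrC; apply: ler_pM => //.
    by rewrite invr_ge0 mulr_ge0 ?addr_ge0 ?ltW.
  apply: le_trans is2; rewrite lef_pV2 ?posrE ?mulr_gt0 ?addr_gt0 // -sgE expr2.
  by rewrite ler_pM2l // lerDr ltW.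
pose S w := \sum_(0 <= j < p) Z j w.
have bS : bounded_rv S by exact: brv_sum.
have Zind (h : nat -> R -> R) (mh : forall j, measurable_fun setT (h j)) :
    sequentially_indep P p (fun j w => h j (Z j w)) by exact: sequentially_indep_reldev.
have EZ j : (j < p)%N -> Ex P (Z j) = 0 by exact: Ex_reldev.
have ES2 : Ex P (fun w => S w ^+ 2) = V.
  rewrite (Ex_sum_sqr bZ) //; last exact: (Zind (fun=> id)).
  by apply: eq_big_nat => j /andP[_ jp]; exact: Ex_reldev2.
have ES : Ex P (fun w => `|S w|) <= s.
  apply: le_trans (Ex_abs_le P bS s0) _; rewrite ES2 -sE.
  by rewrite expr2 mulfK ?gt_eqF // halfE.
pose W w := \sum_(0 <= j < p) s^-1 * Z j w.
have WE w : W w = s^-1 * S w by rewrite /W -mulr_sumr.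
have bxi j : bounded_rv (fun w => s^-1 * Z j w) by exact: brvZ.
have xi_ind : sequentially_indep P p (fun j w => s^-1 * Z j w).
  by apply: (Zind (fun _ z => s^-1 * z)) => j; exact: measurable_funM.
have Exi j : (j < p)%N -> Ex P (fun w => s^-1 * Z j w) = 0.
  by move=> jp; rewrite ExZ // EZ // mulr0.
have Exi2 : \sum_(0 <= j < p) Ex P (fun w => (s^-1 * Z j w) ^+ 2) = 1.
  have -> : \sum_(0 <= j < p) Ex P (fun w => (s^-1 * Z j w) ^+ 2) =
      \sum_(0 <= j < p) s^-1 ^+ 2 * distsq_var R n j.
    apply: eq_big_nat => j /andP[_ jp].
    under eq_Ex do rewrite exprMn.
    by rewrite ExZ; [congr (_ * _); exact: Ex_reldev2|exact: brvX].
  by rewrite -mulr_sumr -/V exprVn sE mulVf ?gt_eqF.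
have Exi4 : \sum_(0 <= j < p) Ex P (fun w => (s^-1 * Z j w) ^+ 4) = k4 / V ^+ 2.
  rewrite /k4 mulr_suml; apply: eq_bigr => j _.
  under eq_Ex do rewrite exprMn.
  by rewrite ExZ; [rewrite exprVn -sE -exprM mulrC|exact: brvX].
have /= := clt1 _ _ P _ _ _ bxi xi_ind Exi Exi2 f0; rewrite Exi4 -/W ler_norml => /andP[R1 _].
have /= := clt2 _ _ P _ _ _ bxi xi_ind Exi Exi2 f0; rewrite Exi4 -/W ler_norml => /andP[_ R2].
(* The expansion error, the error of the centre and the mismatch of scales. *)
pose Y' w := sg^-1 * (Y w + be) + `|sg^-1 - s^-1| * `|S w|.
have be0 : 0 <= be by exact: normr_ge0.
have bYb : bounded_rv (fun w => Y w + be) by apply: brvD => //; exact: brv_cst.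
have bY1 : bounded_rv (fun w => sg^-1 * (Y w + be)) by exact: brvZ.
have bY2 : bounded_rv (fun w => `|sg^-1 - s^-1| * `|S w|) by apply: brvZ; exact: brv_norm.
have bY' : bounded_rv Y' by exact: brvD.
have Y'0 w : 0 <= Y' w.
  by rewrite /Y' addr_ge0 // mulr_ge0 ?addr_ge0 // ltW.
have EYtau : Ex P Y <= f * (v1 + 1) + tau * (2 / f + 2).
  apply: le_trans EY _; apply: EY_bound => //; exact: le_trans k4ka katau.
have EY' : Ex P Y' <= f * (G * (v1 + 1)) + tau * (G * (2 / f + 3) + 2 / v0).
  rewrite /Y' ExD // ExZ // ExD //; last exact: brv_cst.
  rewrite Ex_cst ExZ; last exact: brv_norm.
  apply: EY'_bound => //; [exact: ltW|exact: Ex_ge0|].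
  by apply: le_trans drift; rewrite mulrC; exact: ler_wpM2r.
pose bad := [set w | 16^-1 <= \sum_(0 <= j < p) Z j w ^+ 4].
have bq : bounded_rv (fun w => \sum_(0 <= j < p) Z j w ^+ 4).
  by apply: brv_sum => j; exact: brvX.
have mbad : measurable bad.
  have -> : bad = (fun w => \sum_(0 <= j < p) Z j w ^+ 4) @^-1` `[16^-1, +oo[.
    by apply/seteqP; split => w /=; rewrite in_itv /= andbT.
  rewrite -[_ @^-1` _]setTI; have := brv_meas bq; exact.
(* Markov's inequality for the sum of fourth powers at the threshold [16^-1]. *)
have Pbad : Pr P (N `|` bad) <= 16 * tau.
  apply: le_trans (PrU_le P mN mbad) _.
  have -> : Pr P N = 0 by rewrite /Pr N0.
  rewrite add0r; apply: le_trans (markov_Ex P bq _ _) _ => //.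
    by move=> w; apply: sumr_ge0 => j _; exact: exprn_even_ge0.
  rewrite invrK mulrC ler_pM2l // Ex_sum; last by move=> j; exact: brvX.
  exact: le_trans k4ka katau.
have mNbad : measurable (N `|` bad) by exact: measurableU.
have XW w : ~ (N `|` bad) w ->
    `|standardized_logdet A u mu' (Num.sqrt s2) w - W w| <= Y' w.
  move=> nw; have nN : ~ N w by move=> Nw; apply: nw; left.
  have nb : \sum_(0 <= j < p) Z j w ^+ 4 < 16^-1.
    by rewrite ltNge; apply/negP => bw; apply: nw; right.
  have := YL w nb.
  rewrite -(LE w (fun i => vN w nN i)).
  rewrite /standardized_logdet -/sg WE -/(S w) /Y' => YLw.
  have -> : (logdet A u w - mu') / sg - s^-1 * S w =
     sg^-1 * ((logdet A u w - logdet_center n p m - S w) - (mu' - logdet_center n p m)) +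
     (sg^-1 - s^-1) * S w by ring.
  apply: le_trans (ler_normD _ _) _; apply: lerD; rewrite normrM //.
  rewrite (gtr0_norm isg0) ler_pM2l //; apply: le_trans (ler_normB _ _) _.
  by rewrite lerD2r.
have mX : measurable_fun setT (standardized_logdet A u mu' (Num.sqrt s2)).
  exact: measurable_standardized_logdet.
have bW : bounded_rv W by exact: brv_sum.
have /andP[lo up] := cdf_ramp_sandwich P x mX bW bY' Y'0 mNbad XW e0.
have [err k0] := err_bound _ _ _ _ Pbad EY' k40 (le_trans k4ka katau) V0.
have X0 : 0 <= f + k4 / V ^+ 2 / f by rewrite addr_ge0 // ltW.
by apply/andP; split; [apply: fin_lo c1l R1 lo err _|apply: fin_up c2u R2 up err _];
  rewrite mulr_ge0.
Qed.

(** * Centring and scaling *)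

Section centering_asymptotics.
Context (R : realType).

(** Use [ln a - ln b <= (a - b) / b] in both directions; the factor [2] comes from [S >= M / 2]. *)
Lemma ln_rel_close (S M z : R) : 0 < M -> z <= 2^-1 -> `|S - M| <= M * z ->
  0 < S /\ `|ln S - ln M| <= 2 * z.
Proof.
move=> M0 z2; rewrite ler_norml => /andP[lo up].
have Mz : M * z <= M * 2^-1 by rewrite ler_pM2l.
have S0 : 0 < S by lra.
have z0 : 0 <= z by rewrite -(pmulr_rge0 _ M0); lra.
have lnle (a b : R) : 0 < a -> 0 < b -> ln a - ln b <= (a - b) / b.
  move=> a0 b0; rewrite -ln_div ?posrE //.
  have -> : a / b = 1 + (a - b) / b by field; rewrite gt_eqF.
  apply: le_ln1Dx; rewrite mulrBl divff ?gt_eqF // ltrBrDr addNr.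
  exact: divr_gt0.
split => //; rewrite ler_norml; apply/andP; split.
  rewrite lerNl opprB; apply: le_trans (lnle _ _ M0 S0) _.
  rewrite ler_pdivrMr //.
  have h : z * (M * 2^-1) <= z * S by apply: ler_wpM2l => //; lra.
  lra.
apply: le_trans (lnle _ _ S0 M0) _; rewrite ler_pdivrMr //.
have : 0 <= M * z by rewrite mulr_ge0 // ltW.
lra.
Qed.

(** With [M = m * N], the factor [4] reflects [S >= M / 2] in the denominator, and the factor [3]
    the bound [S + M <= 3 * M] in a difference of squares. *)
Lemma ratio_rel_close (N m S Q z g : R) : 0 < N -> 0 < m -> z <= 2^-1 ->
  `|S - m * N| <= m * N * z -> `|Q - m ^+ 2 * N| <= m ^+ 2 * N * g ->
  `|Q / S ^+ 2 - N^-1| <= 4 * (g + 3 * z) / N.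
Proof.
move=> N0 m0 z2 Sz Qg; have M0 : 0 < m * N by rewrite mulr_gt0.
have [S0 _] := ln_rel_close M0 z2 Sz.
set M := m * N in Sz M0.
have z0 : 0 <= z by rewrite -(pmulr_rge0 _ M0); apply: le_trans Sz.
have SM : M <= 2 * S.
  have : M * z <= M * 2^-1 by rewrite ler_pM2l.
  by move: Sz; rewrite ler_norml => /andP[]; lra.
have S20 : 0 < S ^+ 2 by rewrite exprn_gt0.
have M20 : 0 < M ^+ 2 by rewrite exprn_gt0.
have S2M : M ^+ 2 <= 4 * S ^+ 2.
  have : M ^+ 2 <= (2 * S) ^+ 2 by rewrite lerXn2r // nnegrE; lra.
  by rewrite exprMn; lra.
have h1 : `|Q * N - M ^+ 2| <= M ^+ 2 * g.
  have -> : Q * N - M ^+ 2 = N * (Q - m ^+ 2 * N) by rewrite /M; ring.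
  rewrite normrM (gtr0_norm N0).
  have -> : M ^+ 2 * g = N * (m ^+ 2 * N * g) by rewrite /M; ring.
  by rewrite ler_pM2l.
have h2 : `|M ^+ 2 - S ^+ 2| <= M ^+ 2 * (3 * z).
  rewrite distrC subr_sqr normrM (gtr0_norm (_ : 0 < S + M)); last by rewrite addr_gt0.
  have -> : M ^+ 2 * (3 * z) = M * z * (3 * M) by ring.
  apply: ler_pM => //; first by rewrite ltW // addr_gt0.
  have : M * z <= M * 2^-1 by rewrite ler_pM2l.
  by move: Sz; rewrite ler_norml => /andP[]; lra.
have -> : Q / S ^+ 2 - N^-1 = ((Q * N - M ^+ 2) + (M ^+ 2 - S ^+ 2)) / (N * S ^+ 2).
  by field; rewrite !gt_eqF.
rewrite normrM (gtr0_norm (_ : 0 < (N * S ^+ 2)^-1)) ?invr_gt0 ?mulr_gt0 //.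
rewrite ler_pdivrMr ?mulr_gt0 //.
have -> : 4 * (g + 3 * z) / N * (N * S ^+ 2) = 4 * S ^+ 2 * (g + 3 * z) by field; rewrite gt_eqF.
apply: le_trans (ler_normD _ _) _; apply: le_trans (lerD h1 h2) _.
rewrite -mulrDr; apply: ler_wpM2r => //.
have : 0 <= M ^+ 2 * (g + 3 * z) by rewrite mulrDr addr_ge0 //; [apply: le_trans h1|apply: le_trans h2].
by rewrite pmulr_rge0.
Qed.

Context (n p : nat) (lam : 'I_n -> R) (C c0 : R).
Hypotheses (C1 : 1 <= C) (lamC : forall k, C^-1 <= lam k <= C).
Hypotheses (p0 : (0 < p)%N) (pn : (p <= n)%N) (c00 : 0 < c0) (pc : c0 * n%:R <= n%:R - p%:R).

Notation m := (n%:R^-1 * \sum_k lam k).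
Notation spread := (\sum_k (lam k - m) ^+ 2).
Notation V := (\sum_(0 <= j < p) distsq_var R n j).

Let nR : 0 < (n%:R : R). Proof. by rewrite ltr0n (leq_trans p0). Qed.
Let C0 : 0 < C. Proof. exact: lt_le_trans C1. Qed.
Let sp0 : 0 <= spread. Proof. by apply: sumr_ge0 => k _; exact: sqr_ge0. Qed.

Lemma mean_weight_ge : C^-1 <= m.
Proof.
rewrite mulrC ler_pdivlMr //.
have -> : C^-1 * n%:R = \sum_(k < n) C^-1 by rewrite sumr_const card_ord mulr_natr.
by apply: ler_sum => k _; have /andP[] := lamC k.
Qed.

Let m0 : 0 < m. Proof. by apply: lt_le_trans mean_weight_ge; rewrite invr_gt0. Qed.

Let gap j : (j < p)%N -> c0 * n%:R <= (n - j)%:R.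
Proof.
move=> jp; rewrite natrB; last by apply: leq_trans pn; exact: ltnW.
by apply: le_trans pc _; rewrite lerB // ler_nat ltnW.
Qed.

Let c0n : 0 < c0 * n%:R. Proof. by rewrite mulr_gt0. Qed.

Let p_n : (p%:R : R) <= n%:R. Proof. by rewrite ler_nat. Qed.

Let sum_le_n (a : nat -> R) (b : R) k : 0 <= b -> (forall j, (j < p)%N -> a j <= b) ->
  \sum_(k <= j < p) a j <= n%:R * b.
Proof.
move=> b0 ab; apply: (@le_trans _ _ (\sum_(k <= j < p) b)).
  by apply: ler_sum_nat => j /andP[_ jp]; exact: ab.
rewrite sumr_const_nat -[b *+ _]mulr_natl; apply: ler_wpM2r => //.
by rewrite ler_nat (leq_trans (leq_subr _ _)).
Qed.

Lemma distsq_var_sum_le : V <= 2 / c0.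
Proof.
apply: (@le_trans _ _ (n%:R * (2 / (c0 * n%:R)))); last first.
  by rewrite le_eqVlt; apply/orP; left; apply/eqP; field; rewrite !gt_eqF.
apply: sum_le_n => [|j jp]; first by rewrite divr_ge0 // ltW.
have jn : (j%:R : R) <= n%:R + 2.
  by apply: le_trans (_ : _ <= n%:R) _; [rewrite ler_nat (leq_trans (ltnW jp))|lra].
have nj := gap jp; have nj0 : 0 < ((n - j)%:R : R) by apply: lt_le_trans nj.
have n2 : 0 < n%:R + 2 :> R by rewrite addr_gt0.
rewrite /distsq_var.
have -> : 2 * j%:R / ((n%:R + 2) * (n - j)%:R) = 2 * (j%:R / (n%:R + 2)) / (n - j)%:R :> R.
  by field; rewrite !gt_eqF.
apply: ler_pM.
- by rewrite mulr_ge0 // divr_ge0 // ltW.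
- by rewrite invr_ge0 ltW.
- by rewrite -[leRHS]mulr1 ler_pM2l // ler_pdivrMr // mul1r.
- by rewrite lef_pV2.
Qed.

(** Replacing [n - j] by [n] leaves [p (p - 1) / ((n + 2) n)]; then [p - 1 >= p / 2] and
    [n + 2 <= 3 n] give the [6]. This keeps the variance away from zero. *)
Lemma distsq_var_sum_ge c1 : 0 < c1 -> (1 < p)%N -> c1 * n%:R <= p%:R -> c1 ^+ 2 / 6 <= V.
Proof.
move=> c10 p1 pc1.
have p2 : 2 <= (p%:R : R) by rewrite ler_nat.
have lo : \sum_(0 <= j < p) (j%:R * (2 / ((n%:R + 2) * n%:R))) <= V.
  apply: ler_sum_nat => j /andP[_ jp]; rewrite /distsq_var.
  rewrite mulrCA mulrA; apply: ler_wpM2l; first by rewrite mulr_ge0.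
  have nj0 : 0 < ((n - j)%:R : R) by apply: lt_le_trans (gap jp).
  rewrite lef_pV2 ?posrE ?mulr_gt0 ?addr_gt0 // ler_pM2l ?addr_gt0 //.
  by rewrite ler_nat leq_subr.
apply: le_trans lo; rewrite -mulr_suml.
have -> : \sum_(0 <= j < p) j%:R = p%:R * (p%:R - 1) / 2 :> R.
  rewrite -natr_sum; elim: (p) => [|k IH]; first by rewrite big_nil; field.
  by rewrite big_nat_recr //= natrD IH -natr1; field.
have n1 : 1 <= (n%:R : R) by rewrite ler1n (leq_trans p0).
have -> : p%:R * (p%:R - 1) / 2 * (2 / ((n%:R + 2) * n%:R)) =
    p%:R * (p%:R - 1) / ((n%:R + 2) * n%:R) :> R.
  by field; rewrite !gt_eqF // addr_gt0.
rewrite ler_pdivlMr ?mulr_gt0 ?addr_gt0 //.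
have h1 : (n%:R + 2) * n%:R <= 3 * n%:R * n%:R :> R by rewrite ler_pM2r //; lra.
have h2 : p%:R * (p%:R / 2) <= p%:R * (p%:R - 1) :> R by rewrite ler_pM2l; lra.
have h3 : (c1 * n%:R) ^+ 2 <= p%:R ^+ 2 by rewrite lerXn2r // nnegrE ?mulr_ge0 // ltW.
have h4 : c1 ^+ 2 / 6 * ((n%:R + 2) * n%:R) <= c1 ^+ 2 / 6 * (3 * n%:R * n%:R).
  by apply: ler_wpM2l => //; rewrite divr_ge0 // sqr_ge0.
have h5 : (c1 * n%:R) ^+ 2 = 2 * (c1 ^+ 2 / 6 * (3 * n%:R * n%:R)) by field.
have h6 : p%:R * (p%:R / 2) = p%:R ^+ 2 / 2 :> R by field.
lra.
Qed.

Lemma kurtosis_sum_le :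
  \sum_(0 <= j < p) (distsq_mean R n j)^-1 ^+ 4 * (3 / (4 * n%:R ^+ 2)) <= c0^-1 ^+ 4 / n%:R.
Proof.
apply: (@le_trans _ _ (n%:R * (c0^-1 ^+ 4 * (n%:R ^+ 2)^-1))); last first.
  by rewrite le_eqVlt; apply/orP; left; apply/eqP; field; rewrite !gt_eqF.
have n20 : 0 < (n%:R ^+ 2 : R) by rewrite exprn_gt0.
apply: sum_le_n => [|j jp].
  by rewrite mulr_ge0 ?exprn_ge0 ?invr_ge0 // ltW.
have mj : c0 <= distsq_mean R n j by rewrite ler_pdivlMr // gap.
have mj0 : 0 < distsq_mean R n j by apply: lt_le_trans mj.
apply: ler_pM.
- by rewrite exprn_ge0 // invr_ge0 ltW.
- by rewrite divr_ge0 // mulr_ge0 // ltW.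
- by rewrite lerXn2r ?nnegrE ?invr_ge0 ?(ltW c00) ?(ltW mj0) // lef_pV2.
- have -> : 3 / (4 * n%:R ^+ 2) = 3 / 4 * (n%:R ^+ 2)^-1 :> R by field; rewrite gt_eqF.
  by rewrite ler_piMl ?invr_ge0 ?ltW //; lra.
Qed.

Lemma rel_spread_le : \sum_k (lam k / m - 1) ^+ 2 <= C ^+ 2 * spread.
Proof.
rewrite mulr_sumr; apply: ler_sum => k _.
have -> : lam k / m - 1 = m^-1 * (lam k - m) by rewrite mulrBr mulVf ?gt_eqF // mulrC.
rewrite exprMn; apply: ler_wpM2r; first exact: sqr_ge0.
rewrite lerXn2r ?nnegrE ?invr_ge0 ?(ltW m0) ?(ltW C0) //.
by rewrite -[leRHS]invrK lef_pV2 ?posrE ?invr_gt0 // mean_weight_ge.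
Qed.

Lemma rel_dev_sum : \sum_k (lam k / m - 1) = 0.
Proof.
rewrite sumrB -mulr_suml sumr_const card_ord.
have lsum : \sum_k lam k = n%:R * m by rewrite mulrA mulfV ?gt_eqF // mul1r.
have -> : (\sum_k lam k) / m = n%:R by rewrite {1}lsum mulfK ?gt_eqF.
by rewrite subrr.
Qed.

(** The Lipschitz constant [C + C ^+ 3] of the weights, divided by the lower bound [C^-1 * (c0 * n)]
    of [m * (n - i)], with the factor [n^-1] left out. *)
Definition drift_const : R := (C + C ^+ 3) * C / c0.

Lemma drift_const_gt0 : 0 < drift_const.
Proof. by rewrite divr_gt0 // mulr_gt0 // addr_gt0 // exprn_gt0. Qed.

Let n1 : 1 <= (n%:R : R). Proof. by rewrite ler1n (leq_trans p0). Qed.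

Let gap_m i : (i < p)%N -> C^-1 * (c0 * n%:R) <= m * (n - i)%:R.
Proof.
move=> ip; apply: ler_pM; rewrite ?invr_ge0 ?(ltW C0) ?(ltW c0n) //.
  exact: mean_weight_ge.
exact: gap.
Qed.

Let natB i : (i < p)%N -> (n%:R - i%:R : R) = (n - i)%:R.
Proof. by move=> ip; rewrite natrB // (leq_trans (ltnW ip)). Qed.

Let mean_close i : (i < p)%N ->
  `|\sum_k lam k * t_ lam i k - m * (n - i)%:R| <=
    m * (n - i)%:R * (drift_const * spread / n%:R).
Proof.
move=> ip; have := weighted_mean_t C1 lamC (leq_trans ip pn); rewrite natB // => h.
apply: le_trans h _.
have -> : (C + C ^+ 3) * spread = C^-1 * (c0 * n%:R) * (drift_const * spread / n%:R).
  by rewrite /drift_const; field; rewrite !gt_eqF.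
apply: ler_wpM2r; last exact: gap_m.
by rewrite divr_ge0 // mulr_ge0 // ltW // drift_const_gt0.
Qed.

Let square_close i e : 0 < e -> (i < p)%N ->
  `|\sum_k lam k ^+ 2 * t_ lam i k - m ^+ 2 * (n - i)%:R| <=
    m ^+ 2 * (n - i)%:R * (C ^+ 3 / c0 * (e + spread / e)).
Proof.
move=> e0 ip; have := weighted_square_t C1 lamC (leq_trans ip pn) e0; rewrite natB // => h.
have se : 0 <= spread / e by rewrite divr_ge0 // ltW.
apply: le_trans h _.
apply: (@le_trans _ _ (C^-1 ^+ 2 * (c0 * n%:R) * (C ^+ 3 / c0 * (e + spread / e)))).
  have -> : C^-1 ^+ 2 * (c0 * n%:R) * (C ^+ 3 / c0 * (e + spread / e)) =
      C * (n%:R * e + n%:R * (spread / e)) by field; rewrite !gt_eqF.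
  by rewrite ler_pM2l // lerD2l ler_peMl.
apply: ler_wpM2r.
  by rewrite mulr_ge0 ?addr_ge0 ?(ltW e0) // divr_ge0 ?exprn_ge0 ?(ltW C0) ?(ltW c00).
apply: ler_pM; [by rewrite exprn_ge0 // invr_ge0 ltW|exact: ltW| |exact: gap].
by rewrite lerXn2r ?nnegrE ?invr_ge0 ?(ltW m0) ?(ltW C0) // mean_weight_ge.
Qed.

Hypothesis small : drift_const * spread <= 2^-1.

Let small_n : drift_const * spread / n%:R <= 2^-1.
Proof.
apply: le_trans small; rewrite ler_pdivrMr // ler_peMr //.
by rewrite mulr_ge0 // ltW // drift_const_gt0.
Qed.

Let ni0 i : (i < p)%N -> 0 < ((n - i)%:R : R).
Proof. by move=> ip; apply: lt_le_trans (gap ip). Qed.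

(** Both sides are compared with the sum [H] of the inverses of [n - i]. Replacing the weighted sums
    by their leading terms [m * (n - i)] and [m ^+ 2 * (n - i)] turns [sigma2] into [2 H - 2 p / n],
    from which the exact [V] differs by [O(1 / n)]. *)
Lemma sigma2_close e : 0 < e ->
  `|sigma2 lam p - V| <=
    8 / c0 * (C ^+ 3 / c0 * (e + spread / e) + 3 * (drift_const * spread)) + (4 / c0 + 6) / n%:R.
Proof.
move=> e0.
set g := C ^+ 3 / c0 * (e + spread / e); set z := drift_const * spread / n%:R.
pose H : R := \sum_(1 <= i < p) (n - i)%:R^-1.
have z0 : 0 <= drift_const * spread by rewrite mulr_ge0 // ltW // drift_const_gt0.
have g0 : 0 <= g.
  rewrite mulr_ge0 ?addr_ge0 ?(ltW e0) //; first by rewrite divr_ge0 ?exprn_ge0 ?(ltW C0) ?(ltW c00).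
  by rewrite divr_ge0 // ltW.
have H0 : 0 <= H by apply: sumr_ge0 => i _; rewrite invr_ge0.
have iH j : (j < p)%N -> (n - j)%:R^-1 <= (c0 * n%:R)^-1 :> R.
  by move=> jp; rewrite lef_pV2 ?posrE ?ni0 // gap.
have H1 : H <= c0^-1.
  apply: (@le_trans _ _ (n%:R * (c0 * n%:R)^-1)).
    by apply: sum_le_n => //; rewrite invr_ge0 ltW.
  by rewrite le_eqVlt; apply/orP; left; apply/eqP; field; rewrite !gt_eqF.
set Q := fun i => \sum_(k < n) lam k ^+ 2 * t_ lam i k.
set S := fun i => \sum_(k < n) lam k * t_ lam i k.
have part1 : `|\sum_(1 <= i < p) (Q i / S i ^+ 2) - H| <=
    4 / c0 * (g + 3 * (drift_const * spread)).
  rewrite -sumrB; apply: le_trans (ler_norm_sum _ _ _) _.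
  apply: (@le_trans _ _ (n%:R * (4 * (g + 3 * (drift_const * spread)) / (c0 * n%:R)))); last first.
    by rewrite le_eqVlt; apply/orP; left; apply/eqP; field; rewrite !gt_eqF.
  apply: sum_le_n => [|i ip].
    by rewrite divr_ge0 ?(ltW c0n) // mulr_ge0 // addr_ge0 // mulr_ge0.
  apply: le_trans (ratio_rel_close (ni0 ip) m0 small_n (mean_close ip) (square_close e0 ip)) _.
  rewrite -/g; apply: ler_pM; [| | |exact: iH].
  - by rewrite mulr_ge0 // addr_ge0 // mulr_ge0 // divr_ge0.
  - by rewrite invr_ge0.
  - by rewrite ler_pM2l // lerD2l ler_pM2l // ler_pdivrMr // ler_peMr.
(* Partial fractions: [j / (n - j) = n / (n - j) - 1]. The index [0], absent from [H], contributes
   [n^-1]. *)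
have VE : V = 2 * n%:R / (n%:R + 2) * (n%:R^-1 + H) - 2 * p%:R / (n%:R + 2).
  have n20 : 0 < n%:R + 2 :> R by rewrite addr_gt0.
  have -> : n%:R^-1 + H = \sum_(0 <= i < p) (n - i)%:R^-1.
    by rewrite big_ltn // subn0.
  rewrite mulr_sumr.
  have -> : 2 * p%:R / (n%:R + 2) = \sum_(0 <= i < p) (2 / (n%:R + 2)) :> R.
    by rewrite sumr_const_nat subn0 -[RHS]mulr_natl; ring.
  rewrite -sumrB; apply: eq_big_nat => j /andP[_ jp]; rewrite /distsq_var -natB //.
  have : (n%:R - j%:R : R) != 0 by rewrite natB // gt_eqF // ni0.
  by move=> nj; field; rewrite nj gt_eqF.
have part2 : `|2 * H - 2 * (p%:R / n%:R) - V| <= (4 / c0 + 6) / n%:R.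
  have n20 : 0 < n%:R + 2 :> R by rewrite addr_gt0.
  have -> : 2 * H - 2 * (p%:R / n%:R) - V = (4 * H - 4 * (p%:R / n%:R) - 2) / (n%:R + 2).
    by rewrite VE; field; rewrite !gt_eqF.
  rewrite normrM (gtr0_norm (_ : 0 < (n%:R + 2)^-1)) ?invr_gt0 //.
  apply: ler_pM => //.
    have r0 : 0 <= p%:R / n%:R :> R by rewrite divr_ge0.
    have r1 : p%:R / n%:R <= 1 :> R by rewrite ler_pdivrMr // mul1r.
    have c0' : 0 < c0^-1 by rewrite invr_gt0.
    by rewrite ler_norml; apply/andP; split; lra.
  by rewrite lef_pV2 ?posrE // lerDl.
rewrite /sigma2 -/Q -/S.
have -> : - 2 * (p%:R / n%:R) + 2 * \sum_(1 <= i < p) (Q i / S i ^+ 2) - V =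
    2 * (\sum_(1 <= i < p) (Q i / S i ^+ 2) - H) + (2 * H - 2 * (p%:R / n%:R) - V) by ring.
apply: le_trans (ler_normD _ _) _; apply: lerD => //.
rewrite normrM (gtr0_norm (_ : 0 < 2)) //.
have -> : 8 / c0 * (g + 3 * (drift_const * spread)) =
    2 * (4 / c0 * (g + 3 * (drift_const * spread))) by ring.
by rewrite ler_pM2l.
Qed.

(** Each of the at most [n] logarithms is off by [O(spread / n)], hence all together by [O(spread)]:
    one of the places where the spread has to tend to zero and not merely stay bounded. The
    remaining [sigma2 / 2] is matched with [V / 2]. *)
Lemma mu_close (A : 'M[R]_n) : \tr (A *m A^T) = \sum_k lam k ->
  `|mu lam A p - logdet_center n p m| <=
    2 * (drift_const * spread) + `|sigma2 lam p - V| / 2.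
Proof.
move=> trE.
have {}trE : \tr (A *m A^T) = n%:R * m by rewrite trE mulrA mulfV ?gt_eqF // mul1r.
have -> : mu lam A p - logdet_center n p m =
    \sum_(1 <= i < p) (ln (\sum_k lam k * t_ lam i k) - ln (m * (n - i)%:R)) -
    (sigma2 lam p - V) / 2.
  rewrite /mu /logdet_center trE lnM ?posrE //.
  (* The first row has mean squared distance [1] and no term in the sum of [mu]; the logarithm of
     the trace accounts for its [ln m]. *)
  rewrite (big_ltn (F := fun j => ln (distsq_mean R n j))) //.
  rewrite {1}/distsq_mean subn0 divff ?gt_eqF // ln1 add0r sumrB.
  have -> : \sum_(1 <= j < p) ln (distsq_mean R n j) =
      \sum_(1 <= j < p) ln (m * (n - j)%:R) - (p%:R - 1) * (ln m + ln n%:R).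
    have -> : (p%:R - 1) * (ln m + ln n%:R) = \sum_(1 <= j < p) (ln m + ln n%:R).
      by rewrite sumr_const_nat -[RHS]mulr_natl natrB.
    rewrite -sumrB; apply: eq_big_nat => j /andP[_ jp].
    by rewrite /distsq_mean ln_div ?posrE ?ni0 // lnM ?posrE ?ni0 //; ring.
  by field.
apply: le_trans (ler_normB _ _) _; apply: lerD; last first.
  by rewrite normrM (gtr0_norm (_ : 0 < 2^-1)) // invr_gt0.
apply: le_trans (ler_norm_sum _ _ _) _.
apply: (@le_trans _ _ (n%:R * (2 * (drift_const * spread / n%:R)))); last first.
  by rewrite le_eqVlt; apply/orP; left; apply/eqP; field; rewrite gt_eqF.
apply: sum_le_n => [|i ip].
  by rewrite mulr_ge0 // divr_ge0 // mulr_ge0 // ltW // drift_const_gt0.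
have M0 : 0 < m * (n - i)%:R by rewrite mulr_gt0 // ni0.
by have [] := ln_rel_close M0 small_n (mean_close ip).
Qed.

End centering_asymptotics.

Theorem theorem2p1 (R : realType)
  (p : nat -> nat) (gamma : R)
  (A : forall n : nat, 'M[R]_n)
  (lam : forall n : nat, 'I_n -> R)
  (C : R)
  (d : nat -> measure_display)
  (T : forall n : nat, measurableType (d n))
  (P : forall n : nat, probability (T n) R)
  (u : forall n : nat, 'I_(p n) -> {RV (P n) >-> n.-tuple R})
  (p_bounds : forall n : nat, (0 < n)%N -> (0 < p n <= n)%N)
  (p_ratio : ((p n)%:R / n%:R : R) @[n --> \oo] --> gamma)
  (gamma01 : 0 < gamma < 1)
  (A_rank : forall n : nat, \rank (A n) = n)
  (lam_spec : forall n : nat, ordered_eigenvalues (A n *m (A n)^T) (lam n))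
  (C_ge1 : 1 <= C)
  (lam_bounds : forall (n : nat) (k : 'I_n), C^-1 <= lam n k <= C)
  (lam_concentration :
    (\sum_(k < n) (lam n k - n%:R^-1 * \sum_(j < n) lam n j) ^+ 2)
      @[n --> \oo] --> (0 : R))
  (u_indep : forall n : nat, (0 < n)%N -> mutually_independent (P n) (u n))
  (u_unif : forall (n : nat) (i : 'I_(p n)), (0 < n)%N ->
    uniform_on_sphere (distribution (P n) (u n i))) :
  cvg_in_distribution P
    (fun n => standardized_logdet (A n) (u n)
                (mu (lam n) (A n) (p n)) (sigma (lam n) (p n)))
    (std_normal R).
Proof.
move=> x cx.
have ratio_le (g r : R) : `|g - r| <= (1 - g) / 2 -> r <= 1 - (1 - g) / 2.
  by rewrite ler_norml => /andP[]; lra.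
have ratio_ge (g r : R) : `|g - r| <= g / 2 -> g / 2 <= r.
  by rewrite ler_norml => /andP[]; lra.
have gap_le (q N a : R) : q <= (1 - a) * N -> a * N <= N - q by lra.
have quarter (a s t : R) : s * (4 * a) <= t -> a * s <= t / 4 by lra.
have sum_quarters (a b t : R) : 0 < t -> a <= t / 4 -> b <= t / 4 -> t / 4 + a + b <= t by lra.
have sum_halves (a s t y : R) : s * (4 * a) <= t -> y <= t / 2 -> 2 * (a * s) + y <= t by lra.
have sandwich (F Fl Fu q h : R) : `|F - Fl| <= h / 2 -> `|F - Fu| <= h / 2 ->
    Fl - h / 2 <= q -> q <= Fu + h / 2 -> `|F - q| <= h.
  by rewrite !ler_norml => /andP[? ?] /andP[? ?] ? ?; apply/andP; split; lra.
have quarter_lt (a : R) : 0 < a -> 2 * (a / 4) < a by lra.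
have cdfE n : cdf (P := P n) (standardized_logdet (A n) (u n)
      (mu (lam n) (A n) (p n)) (sigma (lam n) (p n))) x =
    (Pr (P n) [set w | standardized_logdet (A n) (u n)
      (mu (lam n) (A n) (p n)) (sigma (lam n) (p n)) w <= x])%:E.
  have SE : standardized_logdet (A n) (u n) (mu (lam n) (A n) (p n)) (sigma (lam n) (p n)) @^-1`
      `]-oo, x] = [set w | standardized_logdet (A n) (u n)
        (mu (lam n) (A n) (p n)) (sigma (lam n) (p n)) w <= x].
    by apply/seteqP; split => w /=; rewrite in_itv.
  have mS := @measurable_standardized_logdet _ _ _ (P n) _ _ (A n) (u n)
    (mu (lam n) (A n) (p n)) (sigma (lam n) (p n)) measurableT _ (measurable_itv `]-oo, x]).
  rewrite setTI SE in mS; rewrite -(PrE (P n) mS) -SE; reflexivity.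
rewrite (eq_cvg _ _ cdfE).
rewrite PhiE; apply: cvg_EFin; first exact: nearW.
have {}cx : {for x, continuous (@Phi R)}.
  move: cx; congr (continuous_at x _).
  by apply/funext => y; rewrite PhiE.
apply/cvgrPdist_le => eta eta0 /=.
have eta2 : 0 < eta / 2 by rewrite divr_gt0.
have /cvgrPdist_le /(_ _ eta2) /nbhs_ballP[de /= de0 xde] := cx.
pose e := de / 4.
have e0 : 0 < e by rewrite divr_gt0.
have /andP[g0 g1] := gamma01.
(* Half the distances from [gamma] to [1] and to [0]; for large [n] the ratio of [p n] to [n] keeps
   these margins. *)
pose c0 := (1 - gamma) / 2; pose c1 := gamma / 2.
have c00 : 0 < c0 by rewrite divr_gt0 // subr_gt0.
have c10 : 0 < c1 by rewrite divr_gt0.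
have C0 : 0 < C by apply: lt_le_trans C_ge1.
have v00 : 0 < c1 ^+ 2 / 6 by rewrite divr_gt0 // exprn_gt0.
have v10 : 0 <= 2 / c0 by rewrite divr_ge0 // ltW.
have [tau tau0 bound] := logdet_cdf_bound x e0 eta2 v00 v10.
pose spread n := \sum_(k < n) (lam n k - n%:R^-1 * \sum_(j < n) lam n j) ^+ 2.
have sp0 n : 0 <= spread n by apply: sumr_ge0 => k _; exact: sqr_ge0.
have near_sp a : 0 < a -> \forall n \near \oo, spread n <= a.
  move=> a0; have /cvgrPdist_le /(_ _ a0) := lam_concentration.
  apply: filterS => n; rewrite sub0r normrN; exact: le_trans (ler_norm _).
have near_n (a : R) : \forall n \near \oo, a <= n%:R by exact: nbhs_infty_ger.
have near_p a : 0 < a -> \forall n \near \oo, `|gamma - (p n)%:R / n%:R| <= a.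
  by move=> a0; have /cvgrPdist_le /(_ _ a0) := p_ratio.
pose dc := drift_const C c0.
have dc0 : 0 < dc by exact: drift_const_gt0.
(* Makes the part of the variance error that involves neither the spread nor [n] equal to [tau / 4];
   [k1] collects the coefficients of the spread. *)
pose ee := tau * c0 ^+ 2 / (32 * C ^+ 3).
have ee0 : 0 < ee by rewrite divr_gt0 // mulr_gt0 // exprn_gt0.
pose k1 := 8 / c0 * (C ^+ 3 / c0 / ee + 3 * dc).
have k10 : 0 < k1.
  have h : 0 < C ^+ 3 / c0 / ee by apply: divr_gt0 => //; apply: divr_gt0 => //; exact: exprn_gt0.
  by apply: mulr_gt0; [exact: divr_gt0|apply: addr_gt0 => //; exact: mulr_gt0].
near=> n.
have np1 : `|gamma - (p n)%:R / n%:R| <= c0 by near: n; exact: near_p.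
have np2 : `|gamma - (p n)%:R / n%:R| <= c1 by near: n; exact: near_p.
have nn1 : 2 / c1 <= n%:R by near: n; exact: near_n.
have nn2 : 4 * (4 / c0 + 6) / tau <= n%:R by near: n; exact: near_n.
have nn3 : c0^-1 ^+ 4 / tau <= n%:R by near: n; exact: near_n.
have ns1 : spread n <= tau / (4 * k1) by near: n; apply: near_sp; rewrite divr_gt0 // mulr_gt0.
have ns2 : spread n <= tau / (4 * dc) by near: n; apply: near_sp; rewrite divr_gt0 // mulr_gt0.
have ns3 : spread n <= 2^-1 / dc by near: n; apply: near_sp; rewrite divr_gt0.
have ns4 : spread n <= tau / C ^+ 2 by near: n; apply: near_sp; rewrite divr_gt0 // exprn_gt0.
have ns5 : spread n <= 4^-1 / C ^+ 2 by near: n; apply: near_sp; rewrite divr_gt0 // exprn_gt0.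
have nR : 0 < (n%:R : R) by apply: lt_le_trans nn1; rewrite divr_gt0.
have n0 : (0 < n)%N by move: nR; rewrite ltr0n.
have /andP[p0 pn] := p_bounds n n0.
have pc1 : c1 * n%:R <= (p n)%:R.
  by rewrite -ler_pdivlMr //; exact: ratio_ge.
have pc0 : c0 * n%:R <= n%:R - (p n)%:R.
  by apply: gap_le; rewrite -ler_pdivrMr //; exact: ratio_le.
have p1 : (1 < p n)%N.
  by rewrite -(ler_nat R); apply: le_trans pc1; rewrite mulrC -ler_pdivrMr.
have lamC := lam_bounds n.
set m := n%:R^-1 * \sum_k lam n k.
have m0 : 0 < m by apply: lt_le_trans (mean_weight_ge lamC p0 pn); rewrite invr_gt0.
pose c k := lam n k / m - 1.
have [charA _] := lam_spec n.
have Au : A n \in unitmx by rewrite -row_free_unit /row_free A_rank.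
have small : dc * spread n <= 2^-1 by rewrite mulrC -ler_pdivlMr.
have s2close := sigma2_close C_ge1 lamC p0 pn c00 pc0 small ee0.
have {}s2close : `|sigma2 (lam n) (p n) - \sum_(0 <= j < p n) distsq_var R n j| <= tau.
  apply: le_trans s2close _; rewrite -/dc -/(spread n).
  have h1 : (4 / c0 + 6) / n%:R <= tau / 4.
    rewrite mulrC; apply: quarter.
    by rewrite mulrA ler_pdivrMr // (mulrC _ 4) (mulrC tau) -ler_pdivrMr.
  have h2 : k1 * spread n <= tau / 4.
    by apply: quarter; rewrite -ler_pdivlMr // mulr_gt0.
  have -> : 8 / c0 * (C ^+ 3 / c0 * (ee + spread n / ee) + 3 * (dc * spread n)) =
      tau / 4 + k1 * spread n.
    by rewrite /k1 /ee; field; rewrite !gt_eqF // ?exprn_gt0.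
  exact: sum_quarters.
have trE : \tr (A n *m (A n)^T) = \sum_k lam n k.
  have sym : (A n *m (A n)^T)^T = A n *m (A n)^T by rewrite trmx_mul trmxK.
  have [Q [QQ ->]] := real_spectral sym charA.
  rewrite mxtrace_mulC mulmxA QQ mul1mx mxtrace_diag.
  by apply: eq_bigr => k _; rewrite mxE.
have muclose : `|mu (lam n) (A n) (p n) - logdet_center n (p n) m| <= tau.
  apply: le_trans (mu_close C_ge1 lamC p0 pn c00 pc0 small trE) _.
  have h1 : spread n * (4 * dc) <= tau by rewrite -ler_pdivlMr // mulr_gt0.
  have : `|sigma2 (lam n) (p n) - \sum_(0 <= j < p n) distsq_var R n j| / 2 <= tau / 2.
    by rewrite ler_pM2r // invr_gt0.
  exact: sum_halves.
have relsp := rel_spread_le C_ge1 lamC p0 pn.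
have C2 : 0 < C ^+ 2 by rewrite exprn_gt0.
have ctau : \sum_k c k ^+ 2 <= tau.
  by apply: le_trans relsp _; rewrite mulrC -ler_pdivlMr.
have c_half k : `|c k| <= 2^-1.
  have : c k ^+ 2 <= 4^-1.
    apply: (@le_trans _ _ (\sum_k c k ^+ 2)).
      by rewrite (bigD1 k) //= lerDl sumr_ge0 // => l _; exact: sqr_ge0.
    by apply: le_trans relsp _; rewrite mulrC -ler_pdivlMr.
  have -> : 4^-1 = 2^-1 ^+ 2 :> R by field.
  by rewrite -(real_normK (num_real (c k))) ler_pXn2r ?nnegrE // invr_ge0.
have ka : \sum_(0 <= j < p n) (distsq_mean R n j)^-1 ^+ 4 * (3 / (4 * n%:R ^+ 2)) <= tau.
  apply: le_trans (kurtosis_sum_le p0 pn c00 pc0) _.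
  by rewrite ler_pdivrMr // mulrC -ler_pdivrMr.
have V01 : c1 ^+ 2 / 6 <= \sum_(0 <= j < p n) distsq_var R n j <= 2 / c0.
  by rewrite (distsq_var_sum_ge p0 pn c00 pc0 c10 p1 pc1) (distsq_var_sum_le p0 pn c00 pc0).
have lamE k : lam n k = m * (1 + c k).
  by rewrite /c addrC subrK mulrC divfK ?gt_eqF.
have c_sum : \sum_k c k = 0 by exact: (rel_dev_sum C_ge1 lamC p0 pn).
have := bound _ _ (P n) n (p n) (A n) (lam n) (u n) m c _ _ n0 pn Au charA (u_indep n n0)
  (fun i => u_unif n i n0) m0 lamE c_half c_sum ctau V01 ka muclose s2close.
rewrite -/(sigma (lam n) (p n)) => /andP[lo up].
have near_x y : `|x - y| < de -> `|Phi x - Phi y| <= eta / 2 by move=> xy; exact: (xde y).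
have e2 : 2 * e < de by exact: quarter_lt.
have xl : `|Phi x - Phi (x - 2 * e)| <= eta / 2.
  by apply: near_x; rewrite opprB addrCA subrr addr0 gtr0_norm // mulr_gt0.
have xu : `|Phi x - Phi (x + 2 * e)| <= eta / 2.
  by apply: near_x; rewrite opprD addrA subrr sub0r normrN gtr0_norm // mulr_gt0.
exact: sandwich xl xu lo up.
Unshelve. all: by end_near.
Qed.
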